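(* Let $\mathfrak g=\mathfrak{sl}_{n+1}(\mathbb C)$ and let $\lambda=m_1\varpi_1+\cdots+m_n\varpi_n$ be a dominant integral weight. Let $V^{\mathcal F}(\lambda)$ be the associated graded $S(\mathfrak n^-)$-module of the simple module $V(\lambda)$ with respect to the filtration induced by $\deg(f_{\alpha_i+\cdots+\alpha_j})=(j-i+1)(n-j+1)$, and let $S(\lambda)=P(\lambda)\cap\mathbb Z^{\Delta_+}$ be the set of lattice points of the polytope $P(\lambda)$. Then: (1) the set $\{f^{\mathbf s}v_\lambda \mid \mathbf s\in S(\lambda)\}$ is a basis of $V^{\mathcal F}(\lambda)$; (2) the annihilating ideal $I^{\mathcal F}(\lambda)\subset S(\mathfrak n^-)$ of $V^{\mathcal F}(\lambda)$ is a monomial ideal.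
   Context: Fix a Cartan decomposition $\mathfrak{sl}_{n+1}=\mathfrak n^+\oplus\mathfrak h\oplus\mathfrak n^-$ with simple roots $\alpha_1,\dots,\alpha_n$, fundamental weights $\varpi_1,\dots,\varpi_n$ and positive roots $\Delta_+=\{\alpha_{i,j}:=\alpha_i+\cdots+\alpha_j\mid 1\le i\le j\le n\}$. For each $\alpha\in\Delta_+$ fix a nonzero root vector $f_\alpha\in\mathfrak n^-$ of weight $-\alpha$. Filtration: put $\deg(f_{\alpha_{i,j}})=(j-i+1)(n-j+1)$, extend it to monomials by total degree, and let $\mathcal F_mU=\operatorname{span}\{\prod_{\alpha>0}f_\alpha^{n_\alpha}\mid \deg\le m\}\subset U(\mathfrak n^-)$ (products taken in a fixed order). This makes $U(\mathfrak n^-)$ a filtered algebra whose associated graded algebra is isomorphic to the polynomial algebra $S(\mathfrak n^-)=\mathbb C[f_\alpha\mid\alpha\in\Delta_+]$. $V(\lambda)$ is the simple finite-dimensional $\mathfrak g$-module of highest weight $\lambda$, with highest weight vector $v_\lambda$; it is filtered by $\mathcal F_mV(\lambda)=\mathcal F_mU.v_\lambda$. The associated graded space $V^{\mathcal F}(\lambda)$ is a cyclic $S(\mathfrak n^-)$-module generated by (the class of) $v_\lambda$, and $I^{\mathcal F}(\lambda)$ is its annihilating ideal. ''Monomial ideal'' means generated by monomials in the $f_\alpha$. Dyck paths: a Dyck path from $i$ to $j$ ($i\le j$) is a sequence of positive roots $\mathbf p=(\beta(0),\dots,\beta(k))$, $k\ge0$, with $\beta(0)=\alpha_{i,i}$,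 $\beta(k)=\alpha_{j,j}$, such that if $\beta(s)=\alpha_{t,r}$ then $\beta(s+1)=\alpha_{t,r+1}$ or $\beta(s+1)=\alpha_{t+1,r}$. Let $\mathbb D_{i,j}$ be the set of these. Polytope: $P(\lambda)=\{(s_\alpha)\in\mathbb R_{\ge0}^{\Delta_+}\mid \sum_{\alpha\in\mathbf p}s_\alpha\le m_i+\cdots+m_j\ \text{for all } 1\le i\le j\le n \text{ and } \mathbf p\in\mathbb D_{i,j}\}$. For $\mathbf s\in\mathbb N^{\Delta_+}$ put $f^{\mathbf s}=\prod_{\alpha>0}f_\alpha^{s_\alpha}$. *)

(* Defs.v *)
From HB Require Import structures.
From mathcomp Require Import all_boot all_order all_algebra.
From mathcomp Require Import generic_quotient ring_quotient.
From mathcomp Require Import boolp reals.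
From mathcomp.real_closed Require Import complex.
From mathcomp.multinomials Require Import mpoly.

Set Implicit Arguments.
Unset Strict Implicit.
Unset Printing Implicit Defensive.

Import Order.TTheory GRing.Theory Num.Theory.
Local Open Scope ring_scope.

Section QuotientSpace.
Variables (K : fieldType) (V : vectType K) (U : {vspace V}).

Definition quotv : Type := {ideal_quot U}.
HB.instance Definition _ := GRing.Zmodule.on quotv.

Definition piv (u : V) : quotv := \pi_({ideal_quot U})%qT u.
Definition reprv (x : quotv) : V := repr (x : {ideal_quot U}).

Lemma reprvK x : piv (reprv x) = x.
Proof. exact: reprK. Qed.

Lemma piv_eq u v : (piv u == piv v) = (u - v \in U).
Proof. by rewrite /piv -Quotient.idealrBE. Qed.

Lemma pivD u v : piv (u + v) = piv u + piv v.
Proof. exact: (raddfD (\pi_({ideal_quot U})%qT)). Qed.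

Definition scaleq (a : K) (x : quotv) : quotv := piv (a *: reprv x).

Lemma pivZ a u : piv (a *: u) = scaleq a (piv u).
Proof.
apply/eqP; rewrite piv_eq -scalerBr rpredZ //.
by rewrite -piv_eq reprvK.
Qed.

Lemma scaleqA a b x : scaleq a (scaleq b x) = scaleq (a * b) x.
Proof. by rewrite -[x]reprvK -!pivZ scalerA. Qed.
Lemma scale1q : left_id 1 scaleq.
Proof. by move=> x; rewrite -[x]reprvK -pivZ scale1r. Qed.
Lemma scaleqDr : right_distributive scaleq +%R.
Proof.
by move=> a x y; rewrite -[x]reprvK -[y]reprvK -pivD -!pivZ -pivD scalerDr.
Qed.
Lemma scaleqDl x : {morph scaleq^~ x : a b / a + b}.
Proof. by move=> a b; rewrite -[x]reprvK -!pivZ -pivD scalerDl. Qed.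

HB.instance Definition _ :=
  GRing.Zmodule_isLmodule.Build K quotv scaleqA scale1q scaleqDr scaleqDl.

Lemma piv_linear : linear piv.
Proof. by move=> a u v; rewrite pivD pivZ. Qed.
HB.instance Definition _ :=
  GRing.isLinear.Build K V quotv *:%R piv piv_linear.

End QuotientSpace.

Section AssociatedGraded.
Variables (K : fieldType) (V : vectType K) (F : nat -> {vspace V}).

Definition filt_pred (m : nat) : {vspace V} := if m is m'.+1 then F m' else 0%VS.

(* F_(m-1), seen as a subspace of the vector space F_m. *)
Definition filt_sub (m : nat) : {vspace subvs_of (F m)} :=
  (linfun (vsval : subvs_of (F m) -> V) @^-1: filt_pred m)%VS.

Definition gr_piece (m : nat) : Type := quotv (filt_sub m).
HB.instance Definition _ m := GRing.Lmodule.on (gr_piece m).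

Definition gr_prod : Type := forall m, gr_piece m.
HB.instance Definition _ := gen_eqMixin gr_prod.
HB.instance Definition _ := gen_choiceMixin gr_prod.

Section ProdOps.
Implicit Types w : gr_prod.
Definition gp_zero : gr_prod := fun=> 0.
Definition gp_opp w : gr_prod := fun m => - w m.
Definition gp_add w1 w2 : gr_prod := fun m => w1 m + w2 m.
Definition gp_scale (a : K) w : gr_prod := fun m => a *: w m.
Let ext w1 w2 : (forall m, w1 m = w2 m) -> w1 = w2.
Proof. exact: functional_extensionality_dep. Qed.
Lemma gp_addA : associative gp_add.
Proof. by move=> *; apply: ext => m; exact: addrA. Qed.
Lemma gp_addC : commutative gp_add.
Proof. by move=> *; apply: ext => m; exact: addrC. Qed.
Lemma gp_add0 : left_id gp_zero gp_add.
Proof. by move=> *; apply: ext => m; exact: add0r. Qed.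
Lemma gp_addN : left_inverse gp_zero gp_opp gp_add.
Proof. by move=> *; apply: ext => m; exact: addNr. Qed.
HB.instance Definition _ :=
  GRing.isZmodule.Build gr_prod gp_addA gp_addC gp_add0 gp_addN.
Lemma gp_scaleA a b w : gp_scale a (gp_scale b w) = gp_scale (a * b) w.
Proof. by apply: ext => m; exact: scalerA. Qed.
Lemma gp_scale1 : left_id 1 gp_scale.
Proof. by move=> *; apply: ext => m; exact: scale1r. Qed.
Lemma gp_scaleDr : right_distributive gp_scale +%R.
Proof. by move=> *; apply: ext => m; exact: scalerDr. Qed.
Lemma gp_scaleDl w : {morph gp_scale^~ w : a b / a + b}.
Proof. by move=> *; apply: ext => m; exact: scalerDl. Qed.
HB.instance Definition _ := GRing.Zmodule_isLmodule.Build K gr_prod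
  gp_scaleA gp_scale1 gp_scaleDr gp_scaleDl.
End ProdOps.

Definition fin_supp : {pred gr_prod} :=
  fun w => `[< exists B, forall m, (B <= m)%N -> w m = 0 >].

Lemma fin_supp_submod : submod_closed fin_supp.
Proof.
split; first by apply/asboolP; exists 0.
move=> a w1 w2 /asboolP[B1 h1] /asboolP[B2 h2]; apply/asboolP.
exists (maxn B1 B2) => m; rewrite geq_max => /andP[le1 le2].
by rewrite /GRing.add /= /gp_add /GRing.scale /= /gp_scale h1 // h2 // scaler0 addr0.
Qed.
HB.instance Definition _ := GRing.isSubmodClosed.Build K gr_prod fin_supp
  fin_supp_submod.

(* The direct sum of the F_m / F_(m-1), with F_(-1) = 0. *)
Record gr : Type := Gr { gr_comp :> gr_prod; _ : gr_comp \in fin_supp }.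
HB.instance Definition _ := [isSub for gr_comp].
HB.instance Definition _ := [Choice of gr by <:].
HB.instance Definition _ := [SubChoice_isSubLmodule of gr by <:].

Lemma fin_supp_cl (k : nat) (u : V) :
  ((fun m => if m == k then piv (filt_sub m) (vsproj (F m) u) else 0) : gr_prod)
    \in fin_supp.
Proof. by apply/asboolP; exists k.+1 => m; case: eqP => // ->; rewrite ltnn. Qed.

(* For u in F_k, the class of u in the summand F_k / F_(k-1); junk otherwise. *)
Definition gr_cl (k : nat) (u : V) : gr := Gr (fin_supp_cl k u).

Definition supp_bound (w : gr) : nat := projT1 (cid (asboolW (valP w))).

Definition gr_rep (w : gr) (k : nat) : V := vsval (reprv (gr_comp w k)).

(* The map of degree d on gr induced by a linear map g of V which sends F_k to
   F_(k+d) for all k: the class of u in F_k goes to the class of g u in F_(k+d)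
   (gr_mapE below); components beyond supp_bound w are zero. *)
Definition gr_map (d : nat) (g : V -> V) (w : gr) : gr :=
  \sum_(k < supp_bound w) gr_cl (k + d) (g (gr_rep w k)).

Lemma gr_repP w k : gr_rep w k \in F k.
Proof. exact: subvsP. Qed.

Lemma gr_cl_comp k u m : gr_comp (gr_cl k u) m =
  if m == k then piv (filt_sub m) (vsproj (F m) u) else 0.
Proof. by []. Qed.

Lemma gr_cl_eq k u v : u \in F k -> v \in F k ->
  (gr_cl k u == gr_cl k v) = (u - v \in filt_pred k).
Proof.
move=> uF vF; have E : (gr_cl k u == gr_cl k v) =
    (piv (filt_sub k) (vsproj (F k) u) == piv (filt_sub k) (vsproj (F k) v)).
  apply/eqP/eqP => [/(congr1 (fun w => gr_comp w k))|e].
    by rewrite !gr_cl_comp eqxx.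
  apply: val_inj; apply: functional_extensionality_dep => m /=.
  by case: eqP => // ->.
rewrite E piv_eq -memv_preim lfunE /=.
by rewrite !vsprojK.
Qed.

Lemma gr_rep_cl k u m : u \in F k ->
  gr_rep (gr_cl k u) m - (if m == k then u else 0) \in filt_pred m.
Proof.
move=> uF; rewrite /gr_rep; set x := gr_comp _ _.
have : piv (filt_sub m) (reprv x) == piv (filt_sub m)
    (vsproj (F m) (if m == k then u else 0)).
  by rewrite reprvK /x gr_cl_comp; case: (m == k); rewrite ?linear0.
rewrite piv_eq -memv_preim lfunE /= vsprojK //.
by case: eqP => [->|]; rewrite ?mem0v.
Qed.

Lemma gr_cl0 k : gr_cl k 0 = 0.
Proof.
apply: val_inj; apply: functional_extensionality_dep => m /=.
by case: (m == k); rewrite ?linear0.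
Qed.

Lemma gr_mapE d (g : V -> V) k u : {morph g : x y / x - y} ->
  (forall j v, v \in F j -> g v \in F (j + d)%N) -> u \in F k ->
  gr_map d g (gr_cl k u) = gr_cl (k + d) (g u).
Proof.
move=> gB gF uF; have g0 : g 0 = 0 by have := gB 0 0; rewrite !subrr.
have gP j v : v \in filt_pred j -> g v \in filt_pred (j + d).
  case: j => [|j] /=; last exact: gF.
  by rewrite memv0 => /eqP->; rewrite g0 mem0v.
have step j : gr_cl (j + d) (g (gr_rep (gr_cl k u) j)) =
    if j == k then gr_cl (k + d) (g u) else 0.
  have := gP _ _ (gr_rep_cl j uF); rewrite gB.
  case: eqP => [->|_] h; [|rewrite -(gr_cl0 (j + d))]; apply/eqP.
    by rewrite gr_cl_eq // gF // gr_repP.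
  by rewrite gr_cl_eq ?mem0v ?gF ?gr_repP //; rewrite g0 in h.
rewrite /gr_map; under eq_bigr do rewrite step.
case: (ltnP k (supp_bound (gr_cl k u))) => [lt|le].
  rewrite (bigD1 (Ordinal lt)) //= eqxx big1 ?addr0 // => j.
  by rewrite -val_eqE /= => /negPf->.
rewrite big1 => [|j _]; last first.
  by rewrite ltn_eqF // (leq_trans (ltn_ord j)).
have : gr_cl k u == gr_cl k 0.
  rewrite gr_cl0; apply/eqP; apply: val_inj.
  apply: functional_extensionality_dep => m /=.
  case: (m =P k) => // ->.
  by have /= := projT2 (cid (asboolW (valP (gr_cl k u)))) k le; rewrite eqxx.
rewrite gr_cl_eq ?mem0v // subr0 => /(gP _) h.
by apply/esym/eqP; rewrite -(gr_cl0 (k + d)) gr_cl_eq ?mem0v ?gF // subr0.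
Qed.

End AssociatedGraded.

Section BasisIdeal.
Variable K : fieldType.

Definition lin_indep (W : lmodType K) (I : eqType) (S : I -> Prop) (b : I -> W) :=
  forall (r : seq I) (c : I -> K), uniq r -> (forall s, s \in r -> S s) ->
    \sum_(s <- r) c s *: b s = 0 -> forall s, s \in r -> c s = 0.

Definition spanning (W : lmodType K) (I : eqType) (S : I -> Prop) (b : I -> W) :=
  forall w : W, exists (r : seq I) (c : I -> K),
    (forall s, s \in r -> S s) /\ w = \sum_(s <- r) c s *: b s.

Definition is_basis (W : lmodType K) (I : eqType) (S : I -> Prop) (b : I -> W) :=
  lin_indep S b /\ spanning S b.

Definition ideal_gen (N : nat) (M : {mpoly K[N]} -> Prop) (p : {mpoly K[N]}) :=
  exists r : seq ({mpoly K[N]} * {mpoly K[N]}),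
    (forall qg, qg \in r -> M qg.2) /\ p = \sum_(qg <- r) qg.1 * qg.2.

Definition monomial_ideal (N : nat) (I : {mpoly K[N]} -> Prop) :=
  exists M : 'X_{1..N} -> Prop,
    forall p, I p <-> ideal_gen (fun g => exists2 s, M s & g = 'X_[s]) p.

End BasisIdeal.

(* The pair (i, j) stands for alpha_{i+1,j+1}: simple roots are indexed from 0. *)
Definition posroot (n : nat) : predArgType := {ij : 'I_n * 'I_n | (ij.1 <= ij.2)%N}.
HB.instance Definition _ n := SubFinite.on (posroot n).
Notation nroots n := #|posroot n|.

Section Combinatorics.
Variable n : nat.
Implicit Types a b : posroot n.

Definition lo a : 'I_n := (sval a).1.
Definition hi a : 'I_n := (sval a).2.

(* (j-i+1)(n-j+1) in 1-based indices. *)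
Definition rdeg a : nat := ((hi a - lo a).+1 * (n - hi a))%N.

Definition dyck_step a b : bool :=
  (lo b == lo a :> nat) && (hi b == (hi a).+1 :> nat) ||
  (lo b == (lo a).+1 :> nat) && (hi b == hi a :> nat).

Definition dyck_path (i j : 'I_n) (p : seq (posroot n)) : bool :=
  if p is a :: p' then
    [&& sval a == (i, i), path dyck_step a p' & sval (last a p') == (j, j)]
  else false.

Definition polytope (R : numDomainType) (m : 'I_n -> nat) (x : posroot n -> R) :=
  (forall a, 0 <= x a) /\
  (forall (i j : 'I_n) (p : seq (posroot n)), (i <= j)%N -> dyck_path i j p ->
    \sum_(a <- p) x a <= (\sum_(k < n | i <= k <= j) m k)%N%:R).

(* Once the positive roots are enumerated as beta_0, ..., beta_(N-1), the
   multi-exponent s : 'X_{1..N} gives beta_k the exponent s k. *)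
Variable beta : 'I_(nroots n) -> posroot n.

Definition wdeg (s : 'X_{1..nroots n}) : nat := (\sum_k s k * rdeg (beta k))%N.

Definition lattice_point (R : numDomainType) (m : 'I_n -> nat)
    (s : 'X_{1..nroots n}) : Prop :=
  exists2 x : posroot n -> R, polytope m x & forall k, x (beta k) = (s k)%:R.

End Combinatorics.

(* sl_(n+1) is the set of traceless matrices, with its standard Cartan
   decomposition: the diagonal, strictly upper and strictly lower triangular
   ones. *)
Section LieAlgebra.
Variables (K : fieldType) (n : nat).
Local Notation gl := 'M[K]_n.+1.
Implicit Types x y h : gl.

Definition lie x y : gl := x *m y - y *m x.

Definition in_sl x : Prop := \tr x = 0.
Definition in_cartan h : Prop := is_diag_mx h /\ in_sl h.
Definition in_nplus x : Prop := forall i j : 'I_n.+1, (j <= i)%N -> x i j = 0.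
Definition in_nminus x : Prop := forall i j : 'I_n.+1, (i <= j)%N -> x i j = 0.

Definition simple_root (k : 'I_n) h : K :=
  h (widen_ord (leqnSn n) k) (widen_ord (leqnSn n) k) - h (lift ord0 k) (lift ord0 k).

Definition root_val (a : posroot n) h : K :=
  \sum_(k < n | (lo a <= k <= hi a)%N) simple_root k h.

(* The weights dual to the coroots E_(i,i) - E_(i+1,i+1). *)
Definition fund_weight (i : 'I_n) h : K := \sum_(k < n.+1 | (k <= i)%N) h k k.

Definition weight_val (m : 'I_n -> nat) h : K :=
  \sum_i (m i)%:R * fund_weight i h.

Definition neg_root_vector (a : posroot n) x : Prop :=
  [/\ x != 0, in_nminus x &
      forall h, in_cartan h -> lie h x = - root_val a h *: x].

Section Module.
Variables (V : vectType K) (rho : gl -> 'End(V)).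

(* Only the values of rho on traceless matrices matter. *)
Definition sl_module : Prop :=
  (forall c x y, in_sl x -> in_sl y -> rho (c *: x + y) = c *: rho x + rho y) /\
  (forall x y u, in_sl x -> in_sl y ->
     rho (lie x y) u = rho x (rho y u) - rho y (rho x u)).

Definition simple_module : Prop :=
  [/\ sl_module, (fullv : {vspace V}) != 0%VS &
      forall U : {vspace V},
        (forall x u, in_sl x -> u \in U -> rho x u \in U) -> U = 0%VS \/ U = fullv].

Definition highest_weight_vector (m : 'I_n -> nat) (v : V) : Prop :=
  [/\ v != 0, (forall x, in_nplus x -> rho x v = 0) &
      (forall h, in_cartan h -> rho h v = weight_val m h *: v)].

Variables (f : posroot n -> gl) (beta : 'I_(nroots n) -> posroot n) (v : V).
Local Notation N := (nroots n).

(* f_(beta_0)^(s_0) (f_(beta_1)^(s_1) (... u)) *)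
Definition fmon (s : 'X_{1..N}) (u : V) : V :=
  foldr (fun k u' => iter (s k) (rho (f (beta k))) u') u (enum 'I_N).

(* F_m V = F_m U . v: since rdeg is positive, the s with wdeg s <= m all have
   total degree at most m, so they are among the finite type 'X_{1..N < m.+1}. *)
Definition pbw_filt (m : nat) : {vspace V} :=
  (\sum_(s : 'X_{1..N < m.+1} | (wdeg beta s <= m)%N) <[fmon s v]>)%VS.

(* p in S(n-) = C[f_(beta_0), ..., f_(beta_(N-1))] acts through the isomorphism
   gr U(n-) = S(n-), in which the monomial 'X_[s] is the class of the ordered
   monomial f^s, of degree wdeg s. *)
Definition gr_act (p : {mpoly K[N]}) (w : gr pbw_filt) : gr pbw_filt :=
  \sum_(s <- msupp p) p@_s *: gr_map (wdeg beta s) (fmon s) w.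

Definition gr_gen : gr pbw_filt := gr_cl pbw_filt 0 v.

Definition gr_annihilator (p : {mpoly K[N]}) : Prop :=
  forall w : gr pbw_filt, gr_act p w = 0.

End Module.
End LieAlgebra.

(* Main.v *)
Require Import Defs.
From HB Require Import structures.
From mathcomp Require Import all_boot all_order all_algebra.
From mathcomp Require Import all_fingroup.
From mathcomp Require Import reals.
From mathcomp Require boolp.
From mathcomp.real_closed Require Import complex.
From mathcomp.multinomials Require Import mpoly.
From mathcomp Require Import zify ring.
Set Implicit Arguments.
Unset Strict Implicit.
Unset Printing Implicit Defensive.
Import Order.TTheory GRing.Theory Num.Theory.
Local Open Scope ring_scope.

(** Up to a scalar, f_alpha is the matrix unit E_(top, bot), which moves the
    index bot = lo alpha to top = hi alpha + 1, and its degree is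
    (top - bot)(n + 1 - top).  These degrees are strictly superadditive along
    the composition of moves, so commutators of root vectors have strictly
    smaller degree ([move_deg_split]); the filtration is therefore
    multiplicative and the ordered monomials act commutatively on the graded
    module ([words_mons], [ordmonD]).  It remains to compare the vectors
    f^s v with one another, degree by degree.

    This is done in a concrete module: the tensors with one antisymmetric block
    of size k + 1 for each of the m_k copies of the k-th fundamental weight,
    counted from 0, and their highest weight vector w, whose coordinates are products of minors of
    the identity matrix.  The contravariant hermitian form of the tensor module
    and the simplicity of V together show that the vectors f^s v and f^s w
    satisfy the same linear relations ([related_0l], [related_0r]).

    Exponents outside the polytope vanish in the graded module.  Let s be
    supported on a Dyck path from i to j with total K larger than
    m_i + ... + m_j, the number of blocks on which the moves in question have a
    nontrivial effect.  Distribute K units E_(A_l, B_sigma(l)) over distinct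
    positions of these blocks and sum over all permutations sigma: two of them
    always meet in the same block, so antisymmetry makes the sum vanish
    ([normal_ordered_null]).  Each summand is a word in the units plus terms of
    lower degree ([normal_ordered_word]).  Among the rearrangements of the tops
    and bottoms of s, the monomial f^s itself has the strictly largest degree:
    the degree of a move is, up to functions of the top and of the bottom alone,
    the product top * bot, and the elements of a Dyck path are coupled
    monotonically, as in the rearrangement inequality ([potentials],
    [path_weights]).  Hence f^s w has lower degree than expected
    ([path_relation]).

    Exponents in the polytope are independent.  The coordinates of f^s w are, up
    to factorials, the coefficients of z^s in products of minors of the
    product of the unipotent matrices 1 + z_alpha f_alpha ([coef_unipotent]).
    A lattice point is a sum of indicator functions of antichains, one for each
    block, every root of which straddles the index of the block
    ([antichain_decomposition]).  The minor read off from an antichain has as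
    its term of lowest degree the single monomial of that antichain, again by
    rearrangement ([lowest_det]), so some coordinate is nonzero on f^s w
    but vanishes on f^t w for every other t of degree at most that of s
    ([separating_state]).

    The graded module thus has the lattice points as a basis and is killed by
    the other monomials, whence the annihilator consists of the polynomials
    without lattice points among their exponents ([gr_annihilatorE]); this is a
    monomial ideal. *)

(** * Linear spans *)

Section LinearSpan.
Variables (K : fieldType) (Z : lmodType K).
Implicit Types (P Q : Z -> Prop) (x y : Z).

(** An inductive span allows arguments by induction on a linear combination and
    membership in spans of families indexed by words, without bases. *)
Inductive lspan P : Z -> Prop :=
| lspan0 : lspan P 0
| lspan_cons c x y of P x & lspan P y : lspan P (c *: x + y).

Lemma lspan_mem P x : P x -> lspan P x.
Proof.
by move=> Px; have := lspan_cons 1 Px (lspan0 P); rewrite scale1r addr0.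
Qed.

Lemma lspanD P x y : lspan P x -> lspan P y -> lspan P (x + y).
Proof.
move=> Sx Sy; elim: Sx => [|c u u' Pu _ IH]; first by rewrite add0r.
by rewrite -addrA; apply: lspan_cons.
Qed.

Lemma lspanZ P c x : lspan P x -> lspan P (c *: x).
Proof.
elim=> [|d u u' Pu _ IH]; first by rewrite scaler0; apply: lspan0.
by rewrite scalerDr scalerA; apply: lspan_cons.
Qed.

Lemma lspanN P x : lspan P x -> lspan P (- x).
Proof. by rewrite -scaleN1r; apply: lspanZ. Qed.

Lemma lspanB P x y : lspan P x -> lspan P y -> lspan P (x - y).
Proof. by move=> Sx Sy; apply/lspanD/lspanN. Qed.

Lemma lspan_sum P (I : Type) (r : seq I) (B : pred I) (F : I -> Z) :
  (forall i, B i -> lspan P (F i)) -> lspan P (\sum_(i <- r | B i) F i).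
Proof.
by move=> SF; elim/big_rec: _ => [|i x Bi Sx]; [apply: lspan0 | apply/lspanD/Sx/SF].
Qed.

Lemma lspanS P Q x : (forall y, P y -> Q y) -> lspan P x -> lspan Q x.
Proof.
by move=> PQ; elim=> [|c u u' /PQ Qu _ IH]; [apply: lspan0 | apply: lspan_cons].
Qed.

Lemma lspan_map P Q (g : Z -> Z) x : linear g ->
  (forall y, P y -> lspan Q (g y)) -> lspan P x -> lspan Q (g x).
Proof.
move=> glin Pg; elim=> [|c u u' /Pg Qu _ IH].
  have /= := glin (-1) 0 0; rewrite scaleN1r addNr scaleN1r addNr => ->.
  exact: lspan0.
by rewrite glin; apply/lspanD/IH/lspanZ.
Qed.

End LinearSpan.

(** * Roots as moves of indices *)

Section Roots.
Variable n : nat.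
Local Notation I := 'I_n.+1.
Implicit Types (x y : posroot n) (a b : I).

Definition top x : I := lift ord0 (hi x).
Definition bot x : I := widen_ord (leqnSn n) (lo x).

(** The degree of the move from b to a: for the root alpha_(i,j) the index moves
    from i to j + 1. *)
Definition move_deg (a b : nat) : nat := (a - b) * (n.+1 - a).

Lemma bot_lt_top x : (bot x < top x)%N.
Proof. by rewrite /= /bump /= add1n ltnS; apply: (valP x). Qed.

Lemma rdegE x : rdeg x = move_deg (top x) (bot x).
Proof.
rewrite /rdeg /move_deg /= /bump /= add1n subSS subSn //; exact: (valP x).
Qed.

Lemma root_inj x y : top x = top y -> bot x = bot y -> x = y.
Proof.
move=> /lift_inj eh /(congr1 val) /= el; apply: val_inj.
by case: x y eh el => [[l h] lh] [[l' h'] lh'] /= ? el; congr pair => //; apply: val_inj.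
Qed.

Lemma posroot_of a b : (b < a)%N -> {x : posroot n | top x = a & bot x = b}.
Proof.
move=> ba; have hn : (a.-1 < n)%N by case: a ba => -[|a] //= .
have ln : (b < n)%N by apply: leq_trans ba _; rewrite -ltnS ltn_ord.
have lh : (b <= a.-1)%N by lia.
exists (exist (fun ij : 'I_n * 'I_n => (ij.1 <= ij.2)%N) (Ordinal ln, Ordinal hn) lh).
  by apply: val_inj; rewrite /= /bump /=; lia.
exact: val_inj.
Qed.

(** The reason why the degrees define a multiplicative filtration with
    commutative graded algebra: E_(a,c) is the commutator of E_(a,b) and
    E_(b,c).  The second factor n + 1 - a is decreasing in a, whence the strict
    inequality. *)
Lemma move_deg_split (a b c : I) : (c < b)%N -> (b < a)%N ->
  (move_deg a c < move_deg a b + move_deg b c)%N.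
Proof.
move=> cb ba; have an := ltn_ord a; rewrite /move_deg.
have -> : (a - c = (a - b) + (b - c))%N by lia.
rewrite mulnDl ltn_add2l ltn_pmul2l; lia.
Qed.

End Roots.

(** * Words in the matrix units and ordered monomials *)

Section GlModules.
Variables (K : fieldType) (n : nat).
Local Notation I := 'I_n.+1.
Local Notation N := (nroots n).

(** The matrix units act as plain functions, which covers both the given module
    and the space of tensors below; full gl rather than sl makes the commutation
    relations uniform. *)
Record gl_module (Z : lmodType K) (E : I -> I -> Z -> Z) : Prop := GlModule {
  gl_linear : forall a b, linear (E a b);
  gl_comm : forall a b c d u,
    E a b (E c d u) - E c d (E a b u) =
    (b == c)%:R *: E a d u - (d == a)%:R *: E c b u }.

Record highest_vector (Z : lmodType K) (E : I -> I -> Z -> Z) (lam : I -> K)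
    (z : Z) : Prop := HighestVector {
  hw_up : forall a b : I, (a < b)%N -> E a b z = 0;
  hw_diag : forall a, E a a z = lam a *: z }.

Definition word (Z : lmodType K) (E : I -> I -> Z -> Z) (ps : seq (I * I)) (u : Z) :=
  foldr (fun ab u' => E ab.1 ab.2 u') u ps.

Variables (beta : 'I_N -> posroot n) (cf : 'I_N -> K).

Definition ordmon (Z : lmodType K) (E : I -> I -> Z -> Z) (s : 'X_{1..N}) (u : Z) :=
  foldr (fun k u' => iter (s k) (fun x => cf k *: E (top (beta k)) (bot (beta k)) x) u')
    u (enum 'I_N).

Definition mon_word (s : 'X_{1..N}) : seq (I * I) :=
  flatten [seq nseq (s k) (top (beta k), bot (beta k)) | k <- enum 'I_N].

Section OneModule.
Variables (Z : lmodType K) (E : I -> I -> Z -> Z) (glE : gl_module E).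
Variables (lam : I -> K) (z : Z) (hwz : highest_vector E lam z).
Implicit Types (ps qs : seq (I * I)) (u : Z).

Let ElinP a b : linear (E a b). Proof. exact: gl_linear. Qed.
HB.instance Definition _ a b := GRing.isLinear.Build K Z Z *:%R (E a b) (ElinP a b).

Lemma word_linear ps : linear (word E ps).
Proof.
by elim: ps => [|[a b] ps IH] c x y //=; rewrite IH linearP.
Qed.
HB.instance Definition _ ps := GRing.isLinear.Build K Z Z *:%R (word E ps) (word_linear ps).

Lemma word_cat ps qs u : word E (ps ++ qs) u = word E ps (word E qs u).
Proof. exact: foldr_cat. Qed.

Definition mon_coef (s : 'X_{1..N}) : K := \prod_k cf k ^+ s k.

Lemma mon_coefD s t : mon_coef (s + t) = mon_coef s * mon_coef t.
Proof.
by rewrite /mon_coef -big_split; apply: eq_bigr => k _; rewrite mnmDE exprD.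
Qed.

Lemma mon_coef_neq0 s : (forall k, cf k != 0) -> mon_coef s != 0.
Proof. by move=> cf0; apply/prodf_neq0 => k _; apply: expf_neq0. Qed.

Lemma ordmonE s u : ordmon E s u = mon_coef s *: word E (mon_word s) u.
Proof.
rewrite /ordmon /mon_word /mon_coef -big_enum; elim: (enum _) => [|k l IH] /=.
  by rewrite big_nil scale1r.
rewrite IH word_cat big_cons; elim: (s k) => [|r IHr] /=; first by rewrite expr0 mul1r.
by rewrite IHr linearZ /= scalerA exprS mulrA.
Qed.

(** Commuting two neighbours costs words that are one letter shorter. *)
Lemma word_swap ps a b c d qs u :
  word E (ps ++ (a, b) :: (c, d) :: qs) u - word E (ps ++ (c, d) :: (a, b) :: qs) u =
  (b == c)%:R *: word E (ps ++ (a, d) :: qs) u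
    - (d == a)%:R *: word E (ps ++ (c, b) :: qs) u.
Proof. by rewrite !word_cat /= -linearB /= gl_comm // linearB !linearZ. Qed.

(** A family Q of units closed under composition, with a weight that drops by at
    least 1 under composition and dominates k times the degree on lowering
    units.  The degree itself is one instance; the weights adapted to a Dyck
    path are another, with k = 3. *)
Section Weights.
Variables (Q : I -> I -> bool) (wt : I -> I -> int) (k : nat).
Hypothesis Qtrans : forall a b c, Q a b -> Q b c -> Q a c.
Hypothesis wt_split : forall a b c, Q a b -> Q b c -> wt a c + 1 <= wt a b + wt b c.
Hypothesis wt_diag : forall a, Q a a -> 0 <= wt a a.
Hypothesis wt_deg : forall a b : I, Q a b -> (b < a)%N -> (k * move_deg n a b)%N%:Z <= wt a b.
Hypothesis beta_bij : bijective beta.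
Hypothesis cf0 : forall k, cf k != 0.

Definition in_word ps := all (fun ab => Q ab.1 ab.2) ps.
Definition word_wt ps : int := \sum_(ab <- ps) wt ab.1 ab.2.

Definition words_le (W : int) : Z -> Prop :=
  lspan (fun u => exists ps, [/\ in_word ps, word_wt ps <= W & u = word E ps z]).
Definition mons_le (W : int) : Z -> Prop :=
  lspan (fun u => exists2 s, (k * wdeg beta s)%N%:Z <= W & u = ordmon E s z).

Lemma words_leS W W' u : W <= W' -> words_le W u -> words_le W' u.
Proof.
move=> le; apply: lspanS => y [ps [Qp wp ->]]; exists ps; split => //.
exact: le_trans wp le.
Qed.

Lemma mons_leS W W' u : W <= W' -> mons_le W u -> mons_le W' u.
Proof.
by move=> le; apply: lspanS => y [s ws ->]; exists s => //; apply: le_trans ws le.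
Qed.

Lemma word_wt_cat ps qs : word_wt (ps ++ qs) = word_wt ps + word_wt qs.
Proof. by rewrite /word_wt big_cat. Qed.
Lemma word_wt_cons a b qs : word_wt ((a, b) :: qs) = wt a b + word_wt qs.
Proof. by rewrite /word_wt big_cons. Qed.

Lemma word_move ps x qs : in_word (ps ++ x :: qs) ->
  lspan (fun u => exists rs, [/\ (size rs <= size ps + size qs)%N, in_word rs,
      word_wt rs <= word_wt (ps ++ x :: qs) - 1 & u = word E rs z])
    (word E (x :: ps ++ qs) z - word E (ps ++ x :: qs) z).
Proof.
case: x => c d.
elim/last_ind: ps qs => [|ps [a b] IH] qs; first by rewrite subrr; left.
rewrite !cat_rcons => Qp.
rewrite -[X in lspan _ X](subrKA (word E (ps ++ (c, d) :: (a, b) :: qs) z)).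
move: Qp; rewrite /in_word all_cat /= => /and4P[Qps Qab Qcd Qqs].
apply: lspanD.
  have : in_word (ps ++ (c, d) :: (a, b) :: qs).
    by rewrite /in_word all_cat /= Qps Qcd Qab Qqs.
  move/IH; apply: lspanS => u [rs [sz Qr wr ->]]; exists rs; split => //.
    by move: sz; rewrite /= size_rcons; lia.
  by apply: le_trans wr _; rewrite !word_wt_cat !word_wt_cons; lia.
rewrite word_swap; apply: lspanB.
  case: eqP => [dE|_]; last by rewrite scale0r; left.
  subst a; rewrite scale1r; apply: lspan_mem; exists (ps ++ (c, b) :: qs); split => //.
  - by rewrite size_cat size_rcons /=; lia.
  - by rewrite /in_word all_cat /= Qps Qqs (Qtrans Qcd Qab).
  - by rewrite !word_wt_cat !word_wt_cons; have := wt_split Qcd Qab; lia.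
case: eqP => [bE|_]; last by rewrite scale0r; left.
subst c; rewrite scale1r; apply: lspan_mem; exists (ps ++ (a, d) :: qs); split => //.
- by rewrite size_cat size_rcons /=; lia.
- by rewrite /in_word all_cat /= Qps Qqs (Qtrans Qab Qcd).
- by rewrite !word_wt_cat !word_wt_cons; have := wt_split Qab Qcd; lia.
Qed.

(** All the correction terms are shorter and of smaller weight; the length
    makes the induction in [words_mons] terminate, the weight is what it
    controls. *)
Lemma word_perm_short ps qs : perm_eq ps qs -> in_word ps ->
  lspan (fun u => exists rs, [/\ (size rs < size ps)%N, in_word rs,
      word_wt rs <= word_wt ps - 1 & u = word E rs z])
    (word E ps z - word E qs z).
Proof.
elim: ps qs => [|x ps IH] qs.
  by rewrite perm_sym => /perm_nilP -> _; rewrite subrr; left.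
move=> pq Qp; have := perm_mem pq x; rewrite mem_head => /esym xq.
case/splitPr: xq pq => q1 q2 pq.
have pq' : perm_eq ps (q1 ++ q2).
  by rewrite -(perm_cons x) (perm_trans pq) // perm_catC /= perm_cons perm_catC.
have wE : word_wt (x :: ps) = word_wt (q1 ++ x :: q2) by apply: perm_big.
have Qq : in_word (q1 ++ x :: q2) by rewrite /in_word -(perm_all _ pq).
rewrite -[X in lspan _ X](subrKA (word E (x :: q1 ++ q2) z)); apply: lspanD.
  have -> : word E (x :: ps) z - word E (x :: q1 ++ q2) z =
            word E [:: x] (word E ps z - word E (q1 ++ q2) z).
    by rewrite linearB.
  move: Qp => /= /andP[Qx Qps].
  apply: (lspan_map (word_linear [:: x]) _ (IH _ pq' Qps)) => y [rs [sz Qr wr ->]].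
  apply: lspan_mem; exists (x :: rs); split => //; first by rewrite /= Qx.
  by move: wr; case: (x) => a b; rewrite !word_wt_cons; lia.
apply: lspanS (word_move Qq) => u [rs [sz Qr wr ->]]; exists rs; split => //.
- by have /= := perm_size pq'; rewrite size_cat; lia.
- by rewrite wE.
Qed.

Lemma beta_pair (a b : I) : (b < a)%N -> exists k0, (top (beta k0), bot (beta k0)) = (a, b).
Proof.
move=> /posroot_of [x <- <-]; case: beta_bij => g gK Kg; by exists (g x); rewrite Kg.
Qed.

Lemma pair_inj k1 k2 :
  (top (beta k1), bot (beta k1)) = (top (beta k2), bot (beta k2)) -> k1 = k2.
Proof.
by move=> /[dup] /(congr1 fst) ? /(congr1 snd) ?; apply/(bij_inj beta_bij)/root_inj.
Qed.

Lemma count_mon_word s k0 :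
  count_mem (top (beta k0), bot (beta k0)) (mon_word s) = s k0.
Proof.
rewrite /mon_word count_flatten -map_comp sumnE big_map big_enum /=.
rewrite (bigD1 k0) //= big1 => [|k1 nk]; rewrite count_nseq /= ?eqxx ?mul1n ?addn0 //.
by case: eqP => // /pair_inj k10; rewrite k10 eqxx in nk.
Qed.

Lemma mon_word_low s a b : (a, b) \in mon_word s -> (b < a)%N.
Proof.
case/flattenP => _ /mapP[k0 _ ->] /nseqP[[-> ->] _]; exact: bot_lt_top.
Qed.

Lemma low_word_mon ps : all (fun ab : I * I => (ab.2 < ab.1)%N) ps ->
  exists s, perm_eq ps (mon_word s).
Proof.
move=> low; exists [multinom count_mem (top (beta k0), bot (beta k0)) ps | k0 < N].
apply/allP => -[a b] /= _; apply/eqP.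
have [ba|ba] := ltnP b a.
  by have [k0 <-] := beta_pair ba; rewrite count_mon_word mnmE.
have out qs : all (fun ab : I * I => (ab.2 < ab.1)%N) qs -> count_mem (a, b) qs = 0%N.
  move=> lq; apply: count_memPn; apply/negP => /(allP lq) /=; lia.
by rewrite !out //; apply/allP => -[c d] /mon_word_low.
Qed.

Lemma wdeg_mon_word s : wdeg beta s = (\sum_(ab <- mon_word s) move_deg n ab.1 ab.2)%N.
Proof.
rewrite /mon_word big_flatten big_map big_enum /wdeg /=; apply: eq_bigr => k0 _.
by rewrite big_nseq iter_addn_0 /= -rdegE mulnC.
Qed.

(** Straightening, as in the Poincare-Birkhoff-Witt theorem: by induction on the
    length, a word is reordered modulo shorter words; if it contains a
    diagonal or raising unit, that unit is brought to the right, where it acts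
    on the highest weight vector by a scalar. *)
Lemma words_mons W u : words_le W u -> mons_le W u.
Proof.
have main r ps : (size ps < r)%N -> in_word ps -> mons_le (word_wt ps) (word E ps z).
  elim: r ps => // r IH ps sz Qp.
  have reorder qs : perm_eq ps qs -> mons_le (word_wt ps) (word E qs z) ->
      mons_le (word_wt ps) (word E ps z).
    move=> pq Mq; rewrite -[word E ps z](subrK (word E qs z)); apply: lspanD Mq.
    have := word_perm_short pq Qp; set P := fun u => _.
    elim=> [|c x y [rs [sr Qr wr ->]] _ IHy]; first exact: lspan0.
    apply/lspanD/IHy/lspanZ; apply: mons_leS (IH rs _ Qr); last exact: leq_trans sr _.
    by apply: le_trans wr _; rewrite gerBl.
  have [low|] := boolP (all (fun ab : I * I => (ab.2 < ab.1)%N) ps).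
    have [s ps_s] := low_word_mon low; apply: (reorder _ ps_s).
    have -> : word E (mon_word s) z = (mon_coef s)^-1 *: ordmon E s z.
      by rewrite ordmonE scalerA mulVf ?scale1r ?mon_coef_neq0.
    apply/lspanZ/lspan_mem; exists s => //.
    rewrite wdeg_mon_word -(perm_big _ ps_s) /=.
    elim: (ps) Qp low => [|[a b] l IHl] /=; first by rewrite /word_wt !big_nil muln0.
    move=> /andP[Qab Ql] /andP[ba lowl].
    rewrite word_wt_cons big_cons mulnDr PoszD lerD //; first exact: wt_deg.
    exact: IHl.
  case/allPn => -[a b] /= abps; rewrite -leqNgt => le_ab.
  case/splitPr: abps sz Qp reorder => p1 p2 sz Qp reorder.
  have pE : perm_eq (p1 ++ (a, b) :: p2) (rcons (p1 ++ p2) (a, b)).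
    by rewrite -cats1 -catA perm_cat2l -cat1s perm_catC.
  apply: (reorder _ pE); rewrite -cats1 word_cat /=.
  have [lt_ab|] := ltnP a b; first by rewrite (hw_up hwz) // linear0; left.
  move=> le_ba; have ab : a = b by apply/val_inj/eqP; rewrite /= eqn_leq le_ab.
  subst b; rewrite (hw_diag hwz) linearZ; apply: lspanZ.
  move: Qp; rewrite /in_word all_cat /= => /and3P[Q1 Qa Q2].
  have := IH (p1 ++ p2); rewrite /in_word all_cat Q1 Q2 => /(_ _ isT) h.
  apply: mons_leS (h _); last by move: sz; rewrite !size_cat /=; lia.
  by rewrite !word_wt_cat word_wt_cons; have := wt_diag Qa; lia.
elim=> [|c x y [ps [Qp wp ->]] _ IHy]; first exact: lspan0.
by apply/lspanD/IHy/lspanZ/(mons_leS wp)/(main (size ps).+1).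
Qed.

Lemma word_perm ps qs : perm_eq ps qs -> in_word ps ->
  words_le (word_wt ps - 1) (word E ps z - word E qs z).
Proof.
move=> pq Qp; apply: lspanS (word_perm_short pq Qp) => u [rs [_ Qr wr ->]].
by exists rs.
Qed.

End Weights.

Section StandardDegree.
Hypothesis beta_bij : bijective beta.
Hypothesis cf0 : forall k, cf k != 0.

Let gtI (a b : I) : bool := (b < a)%N.
Let deg (a b : I) : int := (move_deg n a b)%:Z.
Let deg_split a b c : gtI a b -> gtI b c -> deg a c + 1 <= deg a b + deg b c.
Proof. by rewrite /gtI /deg => ba cb; have := move_deg_split cb ba; lia. Qed.

Let word_wt_deg s : word_wt deg (mon_word s) = wdeg beta s.
Proof.
rewrite (wdeg_mon_word s) /word_wt; elim: mon_word => [|ab l IH]; first by rewrite !big_nil.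
by rewrite !big_cons IH -PoszD.
Qed.

Let gt_word s : in_word gtI (mon_word s).
Proof. by apply/allP => -[a b] /mon_word_low. Qed.

Lemma low_words_mons W u : words_le gtI deg W u -> mons_le 1 W u.
Proof.
apply: (words_mons _ deg_split) => //; rewrite /gtI.
  by move=> a b c; lia.
by move=> a b _ _; rewrite mul1n.
Qed.

Lemma wdegD s t : wdeg beta (s + t) = (wdeg beta s + wdeg beta t)%N.
Proof.
by rewrite /wdeg -big_split; apply: eq_bigr => k0 _; rewrite mnmDE mulnDl.
Qed.

(** Ordered monomials multiply as in the polynomial ring modulo lower degree:
    the action of the graded algebra is that of S(n-). *)
Lemma ordmonD s t :
  mons_le 1 ((wdeg beta (s + t))%:Z - 1) (ordmon E s (ordmon E t z) - ordmon E (s + t) z).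
Proof.
rewrite !ordmonE linearZ /= scalerA mon_coefD -scalerBr; apply: lspanZ.
rewrite -word_cat; apply: low_words_mons.
have -> : (wdeg beta (s + t))%:Z = word_wt deg (mon_word s ++ mon_word t).
  by rewrite word_wt_cat !word_wt_deg wdegD.
apply: (word_perm _ deg_split) => //; last by rewrite /in_word all_cat; apply/andP; split;
  apply: gt_word.
  by rewrite /gtI => a b c; lia.
apply/allP => -[a b] _ /=; apply/eqP; rewrite count_cat.
have [ba|ba] := ltnP b a.
  by have [k0 <-] := beta_pair beta_bij ba; rewrite !count_mon_word ?mnmDE.
have out r : count_mem (a, b) (mon_word r) = 0%N.
  by apply: count_memPn; apply/negP => /mon_word_low; rewrite ltnNge ba.
by rewrite !out.
Qed.

Lemma ordmon_mons s W u :
  mons_le 1 W u -> mons_le 1 (W + (wdeg beta s)%:Z) (ordmon E s u).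
Proof.
have Flin : linear (ordmon E s).
  by move=> c x y; rewrite !ordmonE linearP scalerDr !scalerA mulrC.
apply: (lspan_map Flin) => _ [t wt ->].
rewrite -[ordmon E s _](subrK (ordmon E (s + t) z)); apply: lspanD.
  by apply: mons_leS (ordmonD s t); rewrite wdegD PoszD; lia.
by apply: lspan_mem; exists (s + t)%MM => //; rewrite wdegD; lia.
Qed.

End StandardDegree.
End OneModule.
End GlModules.

(** * Chains of roots and antichain decompositions *)

Section DyckPaths.
Local Open Scope nat_scope.
Variable n : nat.
Implicit Types (x y : posroot n) (i j k : 'I_n).

(** Dyck paths are the saturated chains of this order between simple roots. *)
Definition root_le x y := (lo x <= lo y) && (hi x <= hi y).
Definition root_lt x y := (x != y) && root_le x y.

Lemma posroot_eq x y : lo x = lo y :> nat -> hi x = hi y :> nat -> x = y.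
Proof.
move=> el eh; apply: val_inj; rewrite [LHS]surjective_pairing [RHS]surjective_pairing.
by congr pair; apply: val_inj.
Qed.

Lemma lo_le_hi x : lo x <= hi x.
Proof. exact: (valP x). Qed.

Lemma root_le_trans : transitive root_le.
Proof. by move=> y x z /andP[? ?] /andP[? ?]; apply/andP; split; lia. Qed.

Lemma root_le_anti x y : root_le x y -> root_le y x -> x = y.
Proof. by move=> /andP[? ?] /andP[? ?]; apply: posroot_eq; lia. Qed.

Lemma root_lt_trans : transitive root_lt.
Proof.
move=> y x z /andP[xy lxy] /andP[yz lyz]; apply/andP; split; last exact: root_le_trans lxy lyz.
by apply: contraNneq xy => xz; rewrite -xz in lyz; apply/eqP/root_le_anti.
Qed.

Lemma dyck_step_lt x y : dyck_step x y -> root_lt x y.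
Proof.
move=> xy; apply/andP; split.
  by apply: contraTneq xy => ->; rewrite /dyck_step; lia.
by move: xy; rewrite /dyck_step /root_le; lia.
Qed.

Definition mkroot i j (h : i <= j) : posroot n :=
  exist (fun ij : 'I_n * 'I_n => ij.1 <= ij.2) (i, j) h.

Lemma lo_mkroot i j (h : i <= j) : lo (mkroot h) = i. Proof. by []. Qed.
Lemma hi_mkroot i j (h : i <= j) : hi (mkroot h) = j. Proof. by []. Qed.

(** Raise the right end first, then the left end: the intervals on the way stay
    nonempty. *)
Lemma dyck_connect x y : root_le x y -> exists p, path (@dyck_step n) x p /\ last x p = y.
Proof.
move: {2}(lo y + hi y - (lo x + hi x)).+1 (ltnSn (lo y + hi y - (lo x + hi x))) => r.
elim: r x => // r IH x lt_r /andP[ll lh].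
have [hlt|hge] := ltnP (hi x) (hi y).
  have hn : (hi x).+1 < n by apply: leq_ltn_trans hlt (ltn_ord _).
  have lx := leqW (lo_le_hi x).
  have [||p [pp lp]] := IH (mkroot (lx : lo x <= Ordinal hn)).
  - by rewrite lo_mkroot hi_mkroot /=; lia.
  - by rewrite /root_le lo_mkroot hi_mkroot ll.
  by exists (mkroot (lx : lo x <= Ordinal hn) :: p); split=> //=; rewrite pp andbT /dyck_step !eqxx.
have [llt|lge] := ltnP (lo x) (lo y).
  have ly := lo_le_hi y.
  have ln : (lo x).+1 < n by apply: leq_ltn_trans llt (ltn_ord _).
  have lx : (lo x).+1 <= hi x by lia.
  have [||p [pp lp]] := IH (mkroot (lx : Ordinal ln <= hi x)).
  - by rewrite lo_mkroot hi_mkroot /=; lia.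
  - by rewrite /root_le lo_mkroot hi_mkroot lh llt.
  by exists (mkroot (lx : Ordinal ln <= hi x) :: p); split=> //=;
    rewrite pp andbT /dyck_step !eqxx orbT.
by exists [::]; split=> //=; apply: posroot_eq; lia.
Qed.

Section ChainBound.
Variable c : posroot n -> nat.

Lemma chain_path x xs : path root_lt x xs ->
  exists p, [/\ path (@dyck_step n) x p, last x p = last x xs &
                \sum_(y <- xs) c y <= \sum_(y <- p) c y].
Proof.
elim: xs x => [|y xs IH] x /=; first by exists [::].
move=> /andP[/andP[xy lxy] /IH[p [pp lp cp]]].
have [q [qp lq]] := dyck_connect lxy.
exists (q ++ p); split; first by rewrite cat_path qp lq.
  by rewrite last_cat lq.
rewrite big_cons big_cat leq_add //.
have: y \in q.
  by have := mem_last x q; rewrite lq inE eq_sym (negPf xy).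
by case/splitPr => q1 q2; rewrite big_cat big_cons /=; lia.
Qed.

(** A chain whose roots lie in the interval from i to j extends to a Dyck path
    between the simple roots at its two extremities, so the inequalities of the
    polytope bound the sums over all chains. *)
Lemma chain_bound (m : 'I_n -> nat) :
  (forall i j p, i <= j -> dyck_path i j p ->
     \sum_(a <- p) c a <= \sum_(k < n | i <= k <= j) m k) ->
  forall l i j, sorted root_lt l -> all (fun x => (i <= lo x) && (hi x <= j)) l ->
    \sum_(x <- l) c x <= \sum_(k < n | i <= k <= j) m k.
Proof.
move=> bnd [|x xs] i j; first by rewrite big_nil.
rewrite [sorted _ _]/= => pxs lej; have [p [pp lp cp]] := chain_path pxs.
have /(allP lej) /andP[_ zj] := mem_last x xs.
have /andP[ix _] := allP lej x (mem_head _ _).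
set z := last x xs in lp zj.
have lz := lo_le_hi z; have lx := lo_le_hi x.
have lexz : root_le x z.
  by move: (order_path_min root_lt_trans pxs) (mem_last x xs); rewrite inE -/z => /allP h
    /predU1P[->|/h /andP[] //]; rewrite /root_le !leqnn.
have [|q [qp lq]] := @dyck_connect (mkroot (leqnn (lo x))) x.
  by rewrite /root_le lo_mkroot hi_mkroot leqnn.
have [|r [rp lr]] := @dyck_connect z (mkroot (leqnn (hi z))).
  by rewrite /root_le lo_mkroot hi_mkroot leqnn andbT.
have lxz : lo x <= hi z by case/andP: lexz => _; lia.
have := bnd _ _ (mkroot (leqnn (lo x)) :: q ++ p ++ r) lxz.
rewrite /dyck_path !cat_path !last_cat lq lp lr qp pp rp !eqxx => /(_ isT) bd.
apply: leq_trans (leq_trans bd _); last first.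
  rewrite [leqRHS]big_mkcond [leqLHS]big_mkcond leq_sum // => k _.
  by case: ifP => // /andP[? ?]; rewrite (_ : _ && _ = true) //; lia.
rewrite [leqLHS]big_cons -cat_cons big_cat big_cat /=.
have : x \in mkroot (leqnn (lo x)) :: q by rewrite -{1}lq mem_last.
by case/splitPr => q1 q2; rewrite big_cat !big_cons /=; lia.
Qed.

End ChainBound.

(** Lattice points are sums of antichains: a weighted form of the dual of
    Dilworth's theorem, in which each antichain straddles a given index.
    If k is the smallest element of the list, every root in the support of c
    ends at or after k.  Peel off the set M of the minimal roots
    among those in the support that start at or before k; M is an antichain of
    roots straddling k.  After its removal the bounds for the remaining list
    hold: a chain of the support that starts at or before k either begins in M
    or can be prolonged downwards by a root of the support. *)
Lemma antichain_decomposition (ks : seq 'I_n) (c : posroot n -> nat) :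
  sorted leq (map val ks) ->
  (forall l i j, sorted root_lt l -> all (fun x => (i <= lo x) && (hi x <= j)) l ->
     \sum_(x <- l) c x <= count (fun k : 'I_n => i <= k <= j) ks) ->
  exists M : seq {set posroot n},
    [/\ size M = size ks,
        forall d k0, d < size ks -> forall x, x \in nth set0 M d ->
          lo x <= nth k0 ks d <= hi x,
        forall d, {in nth set0 M d &, forall x y, root_le x y -> x = y} &
        forall x, c x = \sum_(d < size ks) (x \in nth set0 M d)].
Proof.
elim: ks c => [|k ks IH] c srt bnd.
  exists [::]; split=> //= [d x y|x]; first by rewrite nth_nil inE.
  rewrite big_ord0; have := bnd [:: x] (lo x) (hi x) isT.
  by rewrite /= !leqnn /= big_seq1 => /(_ isT); rewrite leqn0 => /eqP.
have kmin k' : k' \in ks -> k <= k'.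
  move: srt; rewrite /= (path_sortedE leq_trans) => /andP[/allP kl _] k'ks.
  exact/kl/map_f.
pose M := [set x | [&& 0 < c x, lo x <= k &
  [forall y, [&& 0 < c y, lo y <= k & root_le y x] ==> (y == x)]]].
have Mpos x : x \in M -> 0 < c x by rewrite inE => /and3P[].
pose c' x := c x - (x \in M).
have c'E x : c x = c' x + (x \in M).
  by rewrite /c'; case: (boolP (x \in M)) => [/Mpos|]; lia.
have hik x : 0 < c x -> k <= hi x.
  move=> cx; have := bnd [:: x] (lo x) (hi x) isT.
  rewrite /= !leqnn big_seq1 => /(_ isT) h;
    have : 0 < count (fun k0 : 'I_n => lo x <= k0 <= hi x) (k :: ks).
    by apply: leq_trans h.
  rewrite -has_count => /hasP[k' /predU1P[->|/kmin kk'] /andP[_ ?]] //.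
  exact: leq_trans kk' _.
have bnd' l i j : sorted root_lt l -> all (fun x => (i <= lo x) && (hi x <= j)) l ->
    \sum_(x <- l) c' x <= count (fun k0 : 'I_n => i <= k0 <= j) ks.
  move=> sl al.
  have -> : \sum_(x <- l) c' x = \sum_(x <- [seq x <- l | 0 < c x]) c' x.
    rewrite big_filter [RHS]big_mkcond /=; apply: eq_bigr => x _.
    by case: posnP => // cx0; rewrite /c' cx0.
  have {sl}: sorted root_lt [seq x <- l | 0 < c x] by apply: sorted_filter root_lt_trans _ _ sl.
  have : all (fun x => (i <= lo x) && (hi x <= j)) [seq x <- l | 0 < c x].
    by apply/allP => x; rewrite mem_filter => /andP[_ /(allP al)].
  have := filter_all (fun x => 0 < c x) l.
  case: [seq _ <- _ | _] => [|x xs]; first by rewrite big_nil.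
  move=> lpos lij slt.
  have c'c (r : seq (posroot n)) : \sum_(y <- r) c' y <= \sum_(y <- r) c y.
    by apply: leq_sum => y _; apply: leq_subr.
  have /andP[ix _] := allP lij x (mem_head _ _).
  have lo_min y : y \in x :: xs -> lo x <= lo y.
    move: slt => /= /(order_path_min root_lt_trans)/allP h /predU1P[->|/h /andP[_ /andP[]]] //.
  have [kx|xk] := ltnP k (lo x).
    apply: leq_trans (c'c _) _.
    have := bnd _ (lo x) j slt; have -> : all (fun y => (lo x <= lo y) && (hi y <= j)) (x :: xs).
      by apply/allP => y yl; rewrite lo_min //; case/andP: (allP lij y yl).
    move=> /(_ isT) h; apply: leq_trans h _; rewrite /= [lo x <= k]leqNgt kx /= add0n.
    by apply: sub_count => k' /andP[? ?]; apply/andP; split=> //; lia.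
  (* The first root of the chain starts at or before k. *)
  have [xM|xM] := boolP (x \in M).
    have := bnd _ i j slt lij; rewrite /= !big_cons [in c x](c'E x) xM.
    have := c'c xs; lia.
  move: xM; rewrite inE xk (allP lpos _ (mem_head _ _)) /= => /forallPn[y].
  rewrite negb_imply => /andP[/and3P[cy yk yx] neq_yx].
  (* Prolong the chain downwards by y, enlarging the interval if necessary. *)
  pose i' : 'I_n := if i <= lo y then i else lo y.
  have i'i : i' <= i by rewrite /i'; case: (leqP i (lo y)) => ?; lia.
  have i'y : i' <= lo y by rewrite /i'; case: (leqP i (lo y)) => ?; lia.
  have := bnd (y :: x :: xs) i' j.
  have -> : sorted root_lt (y :: x :: xs) by move: slt => /= ->; rewrite /root_lt neq_yx yx.
  have -> : all (fun y0 => (i' <= lo y0) && (hi y0 <= j)) (y :: x :: xs).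
    have /andP[_ xj] := allP lij x (mem_head _ _).
    apply/allP => u /predU1P[->|/(allP lij) /andP[iu ->]].
      by rewrite i'y (leq_trans _ xj) //; case/andP: yx.
    by rewrite andbT; apply: leq_trans i'i iu.
  have -> : count (fun k0 : 'I_n => i' <= k0 <= j) (k :: ks)
      = (i' <= k <= j) + count (fun k0 : 'I_n => i <= k0 <= j) ks.
    congr (_ + _); apply: eq_in_count => k' /kmin kk'; have ik : i <= k' by lia.
    by rewrite ik (leq_trans i'i ik).
  move=> /(_ isT isT); have := c'c (x :: xs); have := leq_b1 (i' <= k <= j).
  by rewrite !big_cons /=; lia.
have [|Ms [sM Mk Ma Mc]] := IH c' _ bnd'; first exact: path_sorted srt.
exists (M :: Ms); split.
- by rewrite /= sM.
- move=> [|d] k0 /=; last by rewrite ltnS; apply: Mk.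
  by move=> _ x; rewrite inE => /and3P[/hik -> ->].
- move=> [|d] //= x y; rewrite !inE => /and3P[cx xk _] /and3P[_ _ /forallP/(_ x)] /implyP h.
  by move=> xy; apply/eqP/h; rewrite cx xk.
- by move=> x; rewrite c'E Mc big_ord_recl addnC.
Qed.

End DyckPaths.

(** * Degrees along a Dyck path *)

Section Potentials.
Variable n : nat.
Implicit Types (x y z : posroot n) (p : seq (posroot n)).

Lemma dyck_path_between x p y : path (@dyck_step n) x p -> y \in x :: p ->
  root_le x y && root_le y (last x p).
Proof.
move=> pp; have {}pp : path (@root_le n) x p.
  by apply: sub_path pp => u v /dyck_step_lt /andP[].
elim: p x pp y => [|z p IH] x /=.
  by move=> _ y; rewrite inE => /eqP ->; rewrite /root_le !leqnn.
move=> /andP[xz pz] y /predU1P[->|/(IH _ pz)].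
  have /andP[_ zl] := IH _ pz z (mem_head _ _).
  by rewrite (root_le_trans xz zl) /root_le !leqnn.
by move=> /andP[zy ->]; rewrite (root_le_trans xz zy).
Qed.

Lemma dyck_comparable x p : path (@dyck_step n) x p ->
  {in x :: p &, forall y z, root_le y z || root_le z y}.
Proof.
elim: p x => [|x' p IH] x pp y z.
  by rewrite !inE => /eqP -> /eqP ->; rewrite /root_le !leqnn.
have xmin u : u \in x :: x' :: p -> root_le x u by move=> /(dyck_path_between pp) /andP[].
move=> yp zp; have := yp; have := zp; rewrite !(in_cons x).
case/predU1P => [-> _|zp']; first by rewrite (xmin y) ?orbT.
case/predU1P => [->|yp']; first by rewrite (xmin z).
by apply: (IH x') => //; case/andP: pp.
Qed.

(** The function r l is supermodular, so a monotone staircase supports optimal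
    potentials for it, in the sense of transport problems: phi r + psi l
    dominates r l on the rectangle spanned by the path, with equality exactly
    on the path.  The potentials are built from the end of the path, each step
    adding one row or one column. *)
Lemma potentials x p : path (@dyck_step n) x p ->
  exists phi psi : nat -> int, forall r l : nat,
    (hi x <= r <= hi (last x p))%N -> (lo x <= l <= lo (last x p))%N ->
    let P := has (fun y => (hi y == r :> nat) && (lo y == l :> nat)) (x :: p) in
    (P -> phi r + psi l = (r * l)%N%:Z) /\ (~~ P -> (r * l)%N%:Z + 1 <= phi r + psi l).
Proof.
elim: p x => [|x' p IH] x.
  exists (fun r => (r * lo x)%N%:Z), (fun=> 0) => r l /= hr hl.
  have -> : r = hi x by lia.
  have -> : l = lo x by lia.
  by rewrite !eqxx; split=> //; lia.
have hasE (a : pred (posroot n)) u s : has a (u :: s) = a u || has a s by [].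
move=> /andP[xx' pp]; have [phi [psi pot]] := IH _ pp.
have /andP[xl _] := dyck_path_between pp (mem_last x' p).
have above y : y \in x' :: p -> root_le x' y by move=> /(dyck_path_between pp) /andP[].
rewrite [last _ _]/=; move: (last x' p) pot xl => z pot xl.
case/orP: xx' => /andP[/eqP e1 /eqP e2]; have {e1}e1 : (lo x' : nat) = _ := e1;
  have {e2}e2 : (hi x' : nat) = _ := e2.
- exists (fun r : nat => if r == hi x :> nat then phi (hi x).+1 - (lo x)%:Z else phi r), psi.
  move=> r l hr hl P; case: (r =P hi x :> nat) => [rE|nr].
    subst r; have [||pot1 pot2] := pot (hi x).+1 l.
    + by rewrite e2; case/andP: xl; lia.
    + by rewrite e1; lia.
    rewrite {}/P hasE.
    have -> : has (fun y => (hi y == hi x :> nat) && (lo y == l :> nat)) (x' :: p) = false.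
      by apply/hasP => -[y /above /andP[_ ?] /andP[/eqP ? _]]; lia.
    rewrite orbF eqxx /=; split=> [/eqP lE|/eqP nl].
      have := pot1; rewrite hasE e2 e1 lE !eqxx => /(_ isT); lia.
    have : ((hi x).+1 * l)%N%:Z <= phi (hi x).+1 + psi l.
      by case: has pot1 pot2 => [/(_ isT) <-|_ /(_ isT)]; lia.
    lia.
  have [||pot1 pot2] := pot r l; rewrite ?e2 ?e1; [lia|lia|].
  by rewrite {}/P hasE (_ : (hi x == r :> nat) = false) //; apply/eqP; lia.
exists phi, (fun l : nat => if l == lo x :> nat then psi (lo x).+1 - (hi x)%:Z else psi l).
move=> r l hr hl P; case: (l =P lo x :> nat) => [lE|nl].
  subst l; have [||pot1 pot2] := pot r (lo x).+1.
  + by rewrite e2; lia.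
  + by rewrite e1; case/andP: xl; lia.
  rewrite {}/P hasE.
  have -> : has (fun y => (hi y == r :> nat) && (lo y == lo x :> nat)) (x' :: p) = false.
    by apply/hasP => -[y /above /andP[? _] /andP[_ /eqP ?]]; lia.
  rewrite orbF eqxx andbT /=; split=> [/eqP rE|/eqP nr].
    have := pot1; rewrite hasE e2 e1 -rE !eqxx => /(_ isT); lia.
  have : (r * (lo x).+1)%N%:Z <= phi r + psi (lo x).+1.
    by case: has pot1 pot2 => [/(_ isT) <-|_ /(_ isT)]; lia.
  lia.
have [||pot1 pot2] := pot r l; rewrite ?e2 ?e1; [lia|lia|].
by rewrite {}/P hasE (_ : (lo x == l :> nat) = false) ?andbF //; apply/eqP; lia.
Qed.

Local Notation I := 'I_n.+1.

Definition root_pair x : I * I := (top x, bot x).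

Lemma top_val x : top x = (hi x).+1 :> nat. Proof. by []. Qed.
Lemma bot_val x : bot x = lo x :> nat. Proof. by []. Qed.

Definition box (i j : 'I_n) (a b : I) : bool := (i < a <= j.+1)%N && (i <= b <= j)%N.

(** The degree (a - b)(n + 1 - a) is a b up to a function of a and a function of
    b, so the potentials of the path turn it into a weight phi a + psi b that
    only depends on the multisets of tops and bottoms of a word, is at least the
    degree on lowering units, and equals it exactly on the path.  The
    factor 3 makes room for subtracting 1 off the path, so that words leaving
    the path are strictly lighter, while the weight still drops when two units
    are composed. *)
Lemma path_weights i j p : dyck_path i j p ->
  exists phi psi : nat -> int,
  let wt (a b : I) := 3 * (phi a + psi b) - ((a, b) \notin map root_pair p)%:Z in
  [/\ forall a b c, box i j a b -> box i j b c -> wt a c + 1 <= wt a b + wt b c,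
      forall a, box i j a a -> 2 <= wt a a,
      forall a b, box i j a b -> (b < a)%N -> (3 * move_deg n a b)%N%:Z <= wt a b &
      forall x, x \in p -> box i j (top x) (bot x) /\
         wt (top x) (bot x) = (3 * rdeg x)%N%:Z].
Proof.
case: p => // x p /and3P[/eqP x_i pp /eqP x_j].
have lox : lo x = i by rewrite /lo x_i.
have hix : hi x = i by rewrite /hi x_i.
have loz : lo (last x p) = j by rewrite /lo x_j.
have hiz : hi (last x p) = j by rewrite /hi x_j.
have [phi [psi pot]] := potentials pp.
(* With a = r + 1, (a - l)(n + 1 - a) = r l + (a (n + 1) - a^2) + (l - l (n + 1)). *)
pose f (a : nat) : int := (a * n.+1)%N%:Z - (a * a)%N%:Z + phi a.-1.
pose g (b : nat) : int := psi b + b%:Z - (b * n.+1)%N%:Z.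
exists f, g.
move=> wt; have {}wt_ (a b : I) : wt a b =
  3 * (f a + g b) - ((a, b) \notin map root_pair (x :: p))%:Z by [].
have fg (a b : I) : box i j a b ->
    let P := (a, b) \in map root_pair (x :: p) in
    (P -> f a + g b = (a%:Z - b%:Z) * (n.+1%:Z - a%:Z)) /\
    (~~ P -> (a%:Z - b%:Z) * (n.+1%:Z - a%:Z) + 1 <= f a + g b).
  move=> /andP[ra rb] P.
  have [||] := pot a.-1 b; rewrite ?lox ?hix ?loz ?hiz; [lia|lia|].
  have -> : has (fun y => (hi y == a.-1 :> nat) && (lo y == b :> nat)) (x :: p) = P.
    apply/hasP/mapP => -[y yp].
      by move=> /andP[/eqP ea /eqP eb]; exists y => //; congr pair; apply: val_inj;
        rewrite /= ?[LHS]top_val -?eb //; move: ra; rewrite [bump _ _]top_val; lia.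
    by case=> -> ->; exists y => //; rewrite top_val bot_val !eqxx.
  have aE : (a : nat) = a.-1.+1 by lia.
  rewrite /f /g; set r := a.-1 in aE *; rewrite aE.
  by case: P => pot1 pot2; split=> // _; [have := pot1 isT | have := pot2 isT]; nia.
have low (a b : I) : box i j a b -> (a%:Z - b%:Z) * (n.+1%:Z - a%:Z) +
    ((a, b) \notin map root_pair (x :: p))%:Z <= f a + g b.
  by move=> /fg; case: (_ \in _) => -[f1 f2]; [rewrite f1 ?addr0 | apply: f2].
have diag (a : I) : box i j a a -> 1 <= f a + g a.
  move=> /low; suff -> : (a, a) \notin map root_pair (x :: p) by lia.
  by apply/mapP => -[y _ [-> e]]; have := bot_lt_top y; rewrite -e ltnn.
split.
- move=> a b c ab bc; rewrite !wt_.
  have := diag b; rewrite /box in ab bc *; move=> /(_ ltac:(lia)).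
  by case: (_ \notin _) (_ \notin _) (_ \notin _) => -[] []; lia.
- by move=> a /diag; rewrite !wt_; case: (_ \notin _); lia.
- move=> a b /low h ba; have := h; rewrite !wt_.
  have -> : (3 * move_deg n a b)%N%:Z = 3 * ((a%:Z - b%:Z) * (n.+1%:Z - a%:Z)) :> int.
    by rewrite /move_deg; have := ltn_ord a; nia.
  by case: (_ \notin _); lia.
move=> y yp; have /andP[/andP[l1 h1] /andP[l2 h2]] := dyck_path_between pp yp.
have by_ : box i j (top y) (bot y).
  rewrite /box top_val bot_val; have := lo_le_hi y; move: l1 l2 h1 h2.
  by rewrite lox hix loz hiz; lia.
split=> //; rewrite !wt_ rdegE.
have yP : (top y, bot y) \in map root_pair (x :: p) by apply: (map_f root_pair).
have [/(_ yP) -> _] := fg _ _ by_; rewrite yP /move_deg.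
by have := bot_lt_top y; have := ltn_ord (top y); nia.
Qed.

(** On a chain the tops and bottoms increase together, so sorting both lists
    recovers the roots. *)
Lemma comparable_marginals (P : pred (posroot n)) (us vs : seq (posroot n)) :
  {in P &, forall x y, root_le x y || root_le y x} -> all P us -> all P vs ->
  perm_eq (map (@top n) us) (map (@top n) vs) ->
  perm_eq (map (@bot n) us) (map (@bot n) vs) -> perm_eq us vs.
Proof.
move=> cmp Pu Pv pt pb.
pose leT x y := (lo x + hi x <= lo y + hi y)%N.
have leTt : total leT by move=> x y; apply: leq_total.
have leT_rle : {in P &, forall x y, leT x y -> root_le x y}.
  move=> x y Px Py; rewrite /leT => le; have := cmp x y Px Py.
  by case/orP => // /andP[? ?]; apply/andP; split; lia.
have key (f : posroot n -> nat) : (forall x y, root_le x y -> (f x <= f y)%N) ->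
    perm_eq (map f us) (map f vs) -> map f (sort leT us) = map f (sort leT vs).
  move=> fmono pf; apply: (sorted_eq leq_trans anti_leq).
  - apply: (homo_sorted_in (e := leT) (P := P)); rewrite ?all_sort ?sort_sorted //.
    by move=> x y Px Py /(leT_rle _ _ Px Py); apply: fmono.
  - apply: (homo_sorted_in (e := leT) (P := P)); rewrite ?all_sort ?sort_sorted //.
    by move=> x y Px Py /(leT_rle _ _ Px Py); apply: fmono.
  - apply: perm_trans (perm_trans _ pf) _; first by apply: perm_map; rewrite perm_sort.
    by apply: perm_map; rewrite perm_sym perm_sort.
have et : map (fun x => top x : nat) (sort leT us) = map (fun x => top x : nat) (sort leT vs).
  apply: key => [x y /andP[_]|]; first by rewrite !top_val.
  by rewrite !(map_comp (@nat_of_ord _) (@top n)) perm_map.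
have eb : map (fun x => bot x : nat) (sort leT us) = map (fun x => bot x : nat) (sort leT vs).
  apply: key => [x y /andP[]|]; first by rewrite !bot_val.
  by rewrite !(map_comp (@nat_of_ord _) (@bot n)) perm_map.
suff sE : sort leT us = sort leT vs by rewrite -(perm_sort leT us) sE perm_sort.
have sz : size (sort leT us) = size (sort leT vs) by have := congr1 size et; rewrite !size_map.
elim: (sort leT us) (sort leT vs) et eb sz => [|x l IH] [|y l'] //= [ex el] [ey el'] [sz].
have -> : x = y by apply: posroot_eq; [exact: ey | exact: ex].
by rewrite (IH l').
Qed.

End Potentials.

(** * The tensor module *)

Section TensorModule.
Variables (n L : nat) (kap : 'I_L -> 'I_n).
Local Notation I := 'I_n.+1.

(** There is one block for each d, of n + 1 positions each, of which only the
    first kap d + 1 carry the action.  A state is an index of coordinates of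
    tensors, that is, a choice of one basis vector for each position. *)
Definition pos : finType := ('I_L * I)%type.
Definition acting (q : pos) : bool := (q.2 <= kap q.1)%N.
Definition state := {ffun pos -> I}.
Definition upd (al : state) (q : pos) (b : I) : state :=
  [ffun r => if r == q then b else al r].

Lemma upd_same al q b : upd al q b q = b.
Proof. by rewrite ffunE eqxx. Qed.
Lemma upd_other al q b r : r != q -> upd al q b r = al r.
Proof. by rewrite ffunE => /negPf ->. Qed.
Lemma upd_upd al q b c : upd (upd al q b) q c = upd al q c.
Proof. by apply/ffunP => r; rewrite !ffunE; case: eqP. Qed.
Lemma upd_comm al q r b c : q != r -> upd (upd al q b) r c = upd (upd al r c) q b.
Proof.
move=> qr; apply/ffunP => s; rewrite !ffunE; case: (s =P r) => // ->.
by rewrite eq_sym (negPf qr).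
Qed.
Lemma upd_id al q : upd al q (al q) = al.
Proof. by apply/ffunP => r; rewrite ffunE; case: eqP => // ->. Qed.

(** The rows beyond kap d are those of the identity matrix, so the determinant
    is the minor of G on the rows selected by al and the first kap d + 1
    columns, while all blocks share the same size. *)
Definition minor_mx (R : comNzRingType) (G : 'M[R]_n.+1) (al : state) (d : 'I_L) : 'M[R]_n.+1 :=
  \matrix_(p, q) if (p <= kap d)%N then G (al (d, p)) q else (p == q)%:R.
Definition minors (R : comNzRingType) (G : 'M[R]_n.+1) (al : state) : R :=
  \prod_d \det (minor_mx G al d).

Variable K : fieldType.
Definition tens := {ffun state -> K^o}.
HB.instance Definition _ := GRing.Lmodule.on tens.
Implicit Types u : tens.

Definition unit_at (q : pos) (a b : I) u : tens :=
  [ffun al : state => (al q == a)%:R * u (upd al q b)].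
Definition tens_unit (a b : I) u : tens := \sum_(q | acting q) unit_at q a b u.
(** The tensor product over the blocks of e_0 /\ ... /\ e_(kap d). *)
Definition tens_hw : tens := [ffun al : state => minors 1%:M al].

Lemma unit_atE q a b u al : unit_at q a b u al = (al q == a)%:R * u (upd al q b).
Proof. by rewrite ffunE. Qed.
Lemma tensZ (c : K) u al : (c *: u) al = c * u al.
Proof. by rewrite ffunE. Qed.

Lemma unit_at_linear q a b : linear (unit_at q a b).
Proof.
move=> c x y; apply/ffunP => al; rewrite !ffunE mulrDr; congr (_ + _).
by rewrite /GRing.scale /= mulrCA.
Qed.
HB.instance Definition _ q a b := GRing.isLinear.Build K tens tens *:%R (unit_at q a b)
  (unit_at_linear q a b).

Lemma tens_unit_linear a b : linear (tens_unit a b).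
Proof.
move=> c x y; rewrite /tens_unit scaler_sumr -big_split; apply: eq_bigr => q _.
exact: linearP.
Qed.

Lemma unit_at_same q a b c d u : unit_at q a b (unit_at q c d u) = (b == c)%:R *: unit_at q a d u.
Proof.
by apply/ffunP => al; rewrite tensZ !unit_atE upd_same upd_upd mulrCA.
Qed.

Lemma unit_at_comm q r a b c d u : q != r ->
  unit_at q a b (unit_at r c d u) = unit_at r c d (unit_at q a b u).
Proof.
move=> qr; apply/ffunP => al; rewrite !unit_atE (upd_comm _ _ _ qr).
by rewrite !upd_other // 1?eq_sym // mulrCA.
Qed.

Lemma tens_gl_module : gl_module tens_unit.
Proof.
split=> [a b|a b c d u]; first exact: tens_unit_linear.
have comp a' b' c' d' : tens_unit a' b' (tens_unit c' d' u) =
    \sum_(q | acting q) \sum_(r | acting r) unit_at q a' b' (unit_at r c' d' u).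
  by apply: eq_bigr => q _; rewrite linear_sum.
rewrite !comp [X in _ - X]exchange_big /= -sumrB /tens_unit !scaler_sumr -sumrB.
apply: eq_bigr => q aq; rewrite -sumrB (bigD1 q) //= !unit_at_same big1 ?addr0 //.
by move=> r /andP[_ rq]; rewrite unit_at_comm 1?eq_sym // subrr.
Qed.

(** The weight of [tens_hw]: block d has a factor e_a exactly if a <= kap d. *)
Definition tens_wt (a : I) : K := (\sum_d (a <= kap d)%N)%:R.

Lemma minor_mx_upd (R : comNzRingType) (G : 'M[R]_n.+1) al d p b d' :
  minor_mx G (upd al (d, p) b) d' = if (d' == d) && (p <= kap d)%N then
    \matrix_(p', q) (if p' == p then G b q else minor_mx G al d' p' q) else minor_mx G al d'.
Proof.
case: ifP => [/andP[/eqP -> pk]|dp]; apply/matrixP => p' q; rewrite !mxE !ffunE xpair_eqE.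
  by rewrite eqxx; case: (p' =P p) => // ->; rewrite pk.
case: ifP => // p'k; move: dp; case: eqP => //= dd; case: eqP => //= pp.
by rewrite -dd -pp p'k.
Qed.

Lemma minors_upd (R : comNzRingType) (G : 'M[R]_n.+1) al d p b : acting (d, p) ->
  minors G (upd al (d, p) b) = (\prod_(d' | d' != d) \det (minor_mx G al d')) *
    \det (\matrix_(p', q) (if p' == p then G b q else minor_mx G al d p' q)).
Proof.
move=> adp; rewrite /minors (bigD1 d) //= mulrC; congr (_ * _).
  by apply: eq_bigr => d' /negPf nd; rewrite minor_mx_upd nd.
by rewrite minor_mx_upd eqxx (adp : (p <= kap d)%N).
Qed.

Lemma minors_split (R : comNzRingType) (G : 'M[R]_n.+1) al d :
  minors G al = (\prod_(d' | d' != d) \det (minor_mx G al d')) * \det (minor_mx G al d).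
Proof. by rewrite /minors (bigD1 d) //= mulrC. Qed.

(** The derivative of the determinant at A in the direction of A *m E, computed
    with the adjugate. *)
Lemma sum_det_rows (R : comNzRingType) (A E : 'M[R]_n.+1) :
  \sum_p \det (\matrix_(p', q) (if p' == p then (A *m E) p q else A p' q)) =
  \tr E * \det A.
Proof.
transitivity (\tr (E *m (\adj A *m A))); last first.
  by rewrite mul_adj_mx mxtrace_mulC mul_scalar_mx mxtraceZ mulrC.
rewrite mulmxA mxtrace_mulC mulmxA /mxtrace; apply: eq_bigr => p _.
rewrite (expand_det_row _ p) [RHS]mxE; apply: eq_bigr => q _.
rewrite [X in X * _]mxE eqxx [\adj A q p]mxE; congr (_ * _).
rewrite /cofactor; congr (_ * \det _); apply/matrixP => r s.
by rewrite !mxE eq_sym (negPf (neq_lift _ _)).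
Qed.

(** On e_0 /\ ... /\ e_k the unit E_(a,b) is zero if b > k, for lack of a factor
    e_b.  If a, b <= k it replaces e_b by e_a: this repeats a factor unless
    a = b, and then it is the identity. *)
Lemma block_act d (a b : I) : (a <= kap d)%N || (kap d < b)%N ->
  \sum_(p : I | acting (d, p)) unit_at (d, p) a b tens_hw =
  ((a == b) && (b <= kap d)%N)%:R *: tens_hw.
Proof.
have [bk|kb] := leqP b (kap d); last first.
  move=> _; rewrite andbF scale0r big1 // => p adp; apply/ffunP => al; rewrite !ffunE.
  rewrite minors_upd //; set B := (X in \det X).
  rewrite (_ : \det B = 0) ?mulr0 //.
  have bp : b != p by apply: contraTneq adp => <-; rewrite /acting /= -ltnNge.
  apply: (@determinant_alternate _ _ _ p b); rewrite 1?eq_sym //.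
  by move=> q; rewrite !mxE eqxx (negPf bp) leqNgt kb.
rewrite orbF andbT => ak; apply/ffunP => al; rewrite sum_ffunE !ffunE /GRing.scale /=.
pose A := minor_mx (1%:M : 'M[K]_n.+1) al d.
have trE : \tr (delta_mx a b : 'M[K]_n.+1) = (a == b)%:R.
  rewrite /mxtrace (bigD1 a) //= mxE eqxx big1 ?addr0 // => r.
  by rewrite mxE => /negPf ->.
rewrite (minors_split _ _ d) mulrCA -[in RHS]trE -sum_det_rows mulr_sumr big_mkcond /=.
apply: eq_bigr => p _; case: ifPn => [adp|/negbTE nadp].
  have adp' : (p <= kap d)%N = true := adp.
  rewrite !ffunE minors_upd // mulrCA; congr (_ * _).
  have [alp|alp] := eqVneq (al (d, p)) a.
    rewrite mul1r; congr (\det _); apply/matrixP => p' q; rewrite !mxE.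
    case: eqP => // _; rewrite (bigD1 a) //= !mxE adp' alp eqxx big1 ?addr0 ?mul1r.
      by rewrite andTb eq_sym.
    by move=> r ra; rewrite !mxE (negPf ra) mulr0.
  rewrite mul0r (expand_det_row _ p) big1 // => q _; rewrite !mxE eqxx.
  rewrite [X in X * _]big1 ?mul0r // => r _; rewrite !mxE adp'.
  by case: (r =P a) => [->|]; rewrite ?(negPf alp) ?mul0r ?mulr0.
have nadp' : (p <= kap d)%N = false := nadp.
rewrite (_ : \det _ = 0) ?mulr0 // (expand_det_row _ p) big1 // => q _; rewrite !mxE eqxx.
rewrite [X in X * _]big1 ?mul0r // => r _; rewrite !mxE nadp'.
case: (r =P a) => [->|]; rewrite ?mulr0 //; case: (p =P a) => [pa|]; rewrite ?mul0r //.
by move: nadp'; rewrite pa ak.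
Qed.

Lemma tens_unit_blocks a b u : tens_unit a b u =
  \sum_d \sum_(p : I | acting (d, p)) unit_at (d, p) a b u.
Proof.
rewrite /tens_unit pair_big_dep /=; by apply: eq_big => [[d p]|[d p] _].
Qed.

Lemma tens_hw_highest : highest_vector tens_unit tens_wt tens_hw.
Proof.
split=> [a b ab|a]; rewrite tens_unit_blocks.
  rewrite big1 // => d _; rewrite block_act; last by case: leqP => //=; lia.
  by rewrite (_ : a == b = false) ?scale0r //; apply/eqP => e; rewrite e ltnn in ab.
rewrite /tens_wt natr_sum scaler_suml; apply: eq_bigr => d _.
by rewrite block_act ?eqxx // ; case: leqP.
Qed.

Lemma tens_hw_alt d p1 p2 al x y : p1 != p2 -> acting (d, p1) -> acting (d, p2) ->
  tens_hw (upd (upd al (d, p1) x) (d, p2) y) = - tens_hw (upd (upd al (d, p1) y) (d, p2) x).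
Proof.
move=> np a1 a2; rewrite !ffunE !minors_upd //.
have prodE z : \prod_(d' | d' != d) \det (minor_mx (1%:M : 'M[K]_n.+1) (upd al (d, p1) z) d') =
            \prod_(d' | d' != d) \det (minor_mx (1%:M : 'M[K]_n.+1) al d').
  by apply: eq_bigr => d' /negPf nd; rewrite minor_mx_upd nd.
rewrite !prodE -mulrN; congr (_ * _).
set A := (X in \det X = _); set B := (X in _ = - \det X).
have -> : A = row_perm (tperm p1 p2) B.
  apply/matrixP => p q; rewrite /A /B !minor_mx_upd eqxx (a1 : (p1 <= kap d)%N) /= !mxE.
  case: tpermP => [->|->|/eqP n1 /eqP n2].
  - by rewrite (negPf np) !eqxx.
  - by rewrite (negPf np) !eqxx.
  - by rewrite (negPf n1) (negPf n2).
by rewrite row_permE det_mulmx det_perm odd_tperm np expr1 mulN1r.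
Qed.

End TensorModule.

(** * Normal ordered products and antisymmetry *)

Section NormalOrdered.
Variables (n L : nat) (kap : 'I_L -> 'I_n) (K : numFieldType) (i j : 'I_n).
Local Notation I := 'I_n.+1.
Local Notation pos := (pos n L).
Local Notation tens := (tens n L K).
Local Notation tens_hw := (tens_hw kap K).
Local Notation tens_unit := (@tens_unit n L kap K).
Implicit Types (u : tens) (ps : seq (I * I)) (ts : seq (pos * (I * I))).

(** The blocks with i <= kap d <= j are the only ones on which the units of the
    box of i and j do not act by scalars; see [normal_ordered_inactive]. *)
Definition active (d : 'I_L) : bool := (i <= kap d <= j)%N.
Definition active_pos (q : pos) : bool := acting kap q && active q.1.

Definition place ts u : tens := foldr (fun t u' => unit_at t.1 t.2.1 t.2.2 u') u ts.

Lemma place_linear ts : linear (place ts).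
Proof. by elim: ts => [|t ts IH] c x y //=; rewrite IH linearP. Qed.
HB.instance Definition _ ts := GRing.isLinear.Build K tens tens *:%R (place ts) (place_linear ts).

Lemma place_cat ts ts' u : place (ts ++ ts') u = place ts (place ts' u).
Proof. exact: foldr_cat. Qed.

Lemma place_comm q a b ts u : q \notin map fst ts ->
  unit_at q a b (place ts u) = place ts (unit_at q a b u).
Proof.
elim: ts => [|[r [c d]] ts IH] //=; rewrite inE negb_or => /andP[qr qts].
by rewrite unit_at_comm // IH.
Qed.

Lemma place_perm ts ts' u : uniq (map fst ts) -> perm_eq ts ts' ->
  place ts u = place ts' u.
Proof.
elim: ts ts' => [|t ts IH] ts' un; first by rewrite perm_sym => /perm_nilP ->.
move=> pt; have := perm_mem pt t; rewrite mem_head => /esym tts'.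
case/splitPr: tts' pt => t1 t2 pt.
have pt' : perm_eq ts (t1 ++ t2).
  by rewrite -(perm_cons t) (perm_trans pt) // perm_catC /= perm_cons perm_catC.
move: un => /= /andP[nt un]; rewrite (IH _ un pt') !place_cat /= place_comm //.
by rewrite (perm_mem (perm_map fst pt')) map_cat mem_cat negb_or in nt; case/andP: nt.
Qed.

(** As for Wick products, the units act simultaneously at pairwise distinct
    positions. *)
Definition normal_ordered k ps u : tens :=
  \sum_(qs : k.-tuple pos | uniq qs && all active_pos qs) place (zip qs ps) u.

Lemma zip_fst k (qs : k.-tuple pos) ps : size ps = k -> map fst (zip qs ps) = qs.
Proof. by move=> sz; rewrite -/unzip1 unzip1_zip // size_tuple sz. Qed.

(** The product of E_(a,b) with the l-th unit of ps at the same position. *)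
Definition contract (ab : I * I) ps l :=
  set_nth (ord0, ord0) ps l (ab.1, (nth (ord0, ord0) ps l).2).

Lemma unit_at_contract k (qs : k.-tuple pos) ps (l : 'I_k) a b u : size ps = k -> uniq qs ->
  unit_at (tnth qs l) a b (place (zip qs ps) u) =
  (b == (nth (ord0, ord0) ps l).1)%:R *: place (zip qs (contract (a, b) ps l)) u.
Proof.
move=> sz un; have lps : (l < size ps)%N by rewrite sz.
have lqs : (l < size qs)%N by rewrite size_tuple.
set c := nth _ ps l; rewrite /contract set_nthE lps -/c.
have {1}-> : ps = take l ps ++ c :: drop l.+1 ps by rewrite -drop_nth // cat_take_drop.
have qE : qs = take l qs ++ tnth qs l :: drop l.+1 qs :> seq _.
  by rewrite (tnth_nth (tnth qs l)) -drop_nth // cat_take_drop.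
have szt : size (take l qs) = size (take l ps) by rewrite !size_take lps lqs.
rewrite [in zip _ _]qE [in X in _ *: X]qE !zip_cat // /= !place_cat /= place_comm; last first.
  rewrite -/unzip1 unzip1_zip ?szt //; move: un; rewrite {1}qE cat_uniq /=.
  by rewrite negb_or => /and3P[_ /andP[]].
by rewrite unit_at_same linearZ /=; case: (c).
Qed.

(** Wick's rule: a further unit acts at a free position, or at an occupied one,
    where it is multiplied with the unit already there. *)
Lemma normal_ordered_cons k ps a b u : size ps = k ->
  \sum_(q | active_pos q) unit_at q a b (normal_ordered k ps u) =
  normal_ordered k.+1 ((a, b) :: ps) u +
  \sum_(l < k) (b == (nth (ord0, ord0) ps l).1)%:R *: normal_ordered k (contract (a, b) ps l) u.
Proof.
move=> sz.
under eq_bigr do rewrite linear_sum.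
rewrite exchange_big /= (eq_bigr (fun qs : k.-tuple pos =>
   \sum_(q | active_pos q && (q \notin qs)) unit_at q a b (place (zip qs ps) u) +
   \sum_(l < k) unit_at (tnth qs l) a b (place (zip qs ps) u))); last first.
  move=> qs /andP[un aq]; rewrite (bigID (mem qs)) addrC; congr (_ + _).
  rewrite -(big_tuple _ _ qs predT (fun q => unit_at q a b (place (zip qs ps) u))).
  rewrite big_uniq //; apply: eq_bigl => q /=.
  by case: (boolP (q \in qs)) => [/(allP aq) -> //|]; rewrite andbF.
rewrite big_split /=; congr (_ + _).
  pose h (p : k.-tuple pos * pos) : k.+1.-tuple pos := cons_tuple p.2 p.1.
  pose g (t : k.+1.-tuple pos) := (behead_tuple t, thead t).
  rewrite /normal_ordered (reindex h); last first.
    exists g => [[qs q] _|t _]; rewrite /h /g /=; last by rewrite [RHS]tuple_eta; apply: val_inj.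
    by congr pair; apply: val_inj.
  rewrite pair_big_dep /=; apply: eq_big => [[qs q]|[qs q] _] //=.
  by rewrite andbC -!andbA andbC -!andbA; do !bool_congr.
rewrite exchange_big; apply: eq_bigr => l _; rewrite /normal_ordered scaler_sumr.
by apply: eq_bigr => qs /andP[un _]; apply: unit_at_contract.
Qed.

Section Null.
Variables (k : nat) (A B : 'I_k -> I).

Definition pairing (s : 'S_k) : seq (I * I) := [seq (A l, B (s l)) | l <- enum 'I_k].

(** With more units than active blocks, two of the positions lie in the same
    block.  Exchanging their sources B changes the sign, by antisymmetry, and
    permutes the summands. *)
Lemma normal_ordered_null : (\sum_d active d < k)%N ->
  \sum_(s : 'S_k) normal_ordered k (pairing s) tens_hw = 0.
Proof.
move=> lt_k; rewrite exchange_big big1 //= => qs /andP[un aq].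
have [l1 [l2 [nl eqd]]] : exists l1 l2, l1 != l2 /\ (tnth qs l1).1 = (tnth qs l2).1.
  have /injectivePn[l1 [l2 nl e]] : ~~ injectiveb (fun l => (tnth qs l).1); last by exists l1, l2.
  apply: contraL lt_k => /injectiveP inj; rewrite -leqNgt.
  have -> : (\sum_d active d)%N = #|[pred d | active d]|.
    by rewrite -sum1_card [RHS]big_mkcond.
  rewrite -[leqLHS]card_ord -(card_imset _ inj).
  apply: subset_leq_card; apply/subsetP => _ /imsetP[l _ ->].
  by have /(allP aq)/andP[] := mem_tnth l qs.
pose F (s : 'S_k) := place (zip qs (pairing s)) tens_hw.
have q12 : tnth qs l1 != tnth qs l2.
  by rewrite (tnth_nth (tnth qs l1)) [X in _ != X](tnth_nth (tnth qs l1)) nth_uniq ?size_tuple.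
pose rest := [seq l <- enum 'I_k | (l != l1) && (l != l2)].
pose gs (s : 'S_k) l := (tnth qs l, (A l, B (s l))).
have FE s : F s = place (map (gs s) rest) (place [:: gs s l1; gs s l2] tens_hw).
  rewrite -place_cat -[[:: _; _]]/(map (gs s) [:: l1; l2]) -map_cat /F.
  have -> : zip qs (pairing s) = map (gs s) (enum 'I_k).
    by rewrite -{1}(map_tnth_enum qs) /pairing zip_map.
  apply: place_perm; first by rewrite -map_comp /comp /= map_tnth_enum.
  apply: perm_map; apply: uniq_perm; rewrite ?enum_uniq //.
    rewrite cat_uniq filter_uniq ?enum_uniq //= inE nl !orbF andbT.
    by rewrite !mem_filter !eqxx /= andbF.
  by move=> l; rewrite mem_cat /rest mem_filter mem_enum !inE; case: (l == l1); case: (l == l2).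
have FN s : F (tperm l1 l2 * s)%g = - F s.
  rewrite !FE -linearN; congr (place _ _); rewrite ?/gs.
    apply/eq_in_map => l; rewrite mem_filter => /andP[/andP[n1 n2] _].
    by rewrite permM tpermD // eq_sym.
  rewrite /gs /= !permM tpermL tpermR.
  case: (tnth qs l1) (tnth qs l2) eqd q12 (allP aq _ (mem_tnth l1 qs)) (allP aq _ (mem_tnth l2 qs)).
  move=> d p1 [d' p2] /= <- q12' /andP[a1 _] /andP[a2 _].
  apply/ffunP => al; rewrite [RHS]ffunE !unit_atE !(upd_other _ _ (r := (d, p2))) 1?eq_sym //.
  rewrite -!mulrN tens_hw_alt // ; by apply: contraNneq q12' => ->.
have : \sum_s F s = - \sum_s F s.
  rewrite [LHS](reindex_inj (mulgI (tperm l1 l2))) -sumrN.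
  by apply: eq_bigr => s _; apply: FN.
move/eqP; rewrite -subr_eq0 opprK -mulr2n -scaler_nat scaler_eq0 pnatr_eq0 /=.
by move/eqP.
Qed.
End Null.

End NormalOrdered.

(** * The relation attached to a Dyck path *)

Section PathRelation.
Variables (n L : nat) (kap : 'I_L -> 'I_n) (K : numFieldType) (i j : 'I_n).
Local Notation I := 'I_n.+1.
Local Notation pos := (pos n L).
Local Notation tens := (tens n L K).
Local Notation tens_hw := (tens_hw kap K).
Local Notation tens_unit := (@tens_unit n L kap K).
Local Notation normal_ordered := (normal_ordered kap i j).
Local Notation box := (box i j).

Section Words.
Variable wt : I -> I -> int.
Hypothesis wt_split : forall a b c, box a b -> box b c -> wt a c + 1 <= wt a b + wt b c.
Hypothesis wt_diag : forall a, box a a -> 2 <= wt a a.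
Local Notation low := (words_le tens_unit tens_hw box wt).

Lemma box_trans a b c : box a b -> box b c -> box a c.
Proof. by move=> /andP[ia _] /andP[_ jc]; apply/andP. Qed.

(** Outside the active blocks a unit of the box meets [tens_hw] unchanged.
    There it is zero if kap d < i <= b, and if a <= j + 1 <= kap d it acts by
    the scalar of [block_act], which is zero off the diagonal. *)
Lemma normal_ordered_inactive a b k ps : box a b -> size ps = k ->
  exists2 c, (a != b -> c = 0) &
    tens_unit a b (normal_ordered k ps tens_hw) =
    \sum_(q | active_pos kap i j q) unit_at q a b (normal_ordered k ps tens_hw)
      + c *: normal_ordered k ps tens_hw.
Proof.
move=> /andP[ia jb] sz.
exists (\sum_(d | ~~ active kap i j d) ((a == b) && (b <= kap d)%N)%:R).
  by move=> /negPf ->; apply: big1.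
rewrite /tens_unit (bigID (fun q : pos => active kap i j q.1)) /=; congr (_ + _).
have -> : \sum_(q | acting kap q && ~~ active kap i j q.1) unit_at q a b (normal_ordered k ps
  tens_hw) =
    \sum_(qs : k.-tuple pos | uniq qs && all (active_pos kap i j) qs)
       place (zip qs ps) (\sum_(q | acting kap q && ~~ active kap i j q.1) unit_at q a b tens_hw).
  under eq_bigr do rewrite linear_sum.
  rewrite exchange_big; apply: eq_bigr => qs /andP[_ aq].
  rewrite linear_sum /=; apply: eq_bigr => q /andP[_ nq].
  rewrite place_comm // zip_fst //.
  by apply: contra nq => /(allP aq) /andP[].
have -> : \sum_(q | acting kap q && ~~ active kap i j q.1) unit_at q a b tens_hw =
    (\sum_(d | ~~ active kap i j d) ((a == b) && (b <= kap d)%N)%:R) *: tens_hw.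
  transitivity (\sum_(d | ~~ active kap i j d) \sum_(p : I | acting kap (d, p)) unit_at (d, p) a
    b tens_hw).
    by rewrite pair_big_dep /=; apply: eq_big => [[d p]|[d p] _] //=; rewrite andbC.
  rewrite scaler_suml; apply: eq_bigr => d nd; apply: block_act.
  by move: nd; rewrite /active; have := ltn_ord a; lia.
rewrite /normal_ordered scaler_sumr; apply: eq_bigr => qs _.
exact: linearZ.
Qed.

Lemma words_le_unit a b W u : box a b -> low W u -> low (W + wt a b) (tens_unit a b u).
Proof.
move=> bab; apply: (lspan_map (tens_unit_linear kap a b)) => _ [ps [Qp wp ->]].
apply: lspan_mem; exists ((a, b) :: ps); split=> //; first by rewrite /= bab.
by rewrite word_wt_cons addrC lerD2r.
Qed.

Lemma word_wt_contract ps l a b : (l < size ps)%N -> in_word box ps -> box a b ->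
  b = (nth (ord0, ord0) ps l).1 ->
  in_word box (contract (a, b) ps l) /\
  word_wt wt (contract (a, b) ps l) <= word_wt wt ((a, b) :: ps) - 1.
Proof.
move=> lt_l Qp bab; rewrite /contract set_nthE lt_l.
have := cat_take_drop l ps; rewrite (drop_nth (ord0, ord0)) //.
case: (nth _ _ _) => c d; move: (take _ _) (drop _ _) => p1 p2 /= psE bc; subst c.
move: Qp; rewrite -psE /in_word !all_cat /= => /and3P[-> bbd ->].
rewrite (box_trans bab bbd) word_wt_cons !word_wt_cat !word_wt_cons; split=> //.
by have := wt_split bab bbd; lia.
Qed.

(** The contractions in Wick's rule compose two units and so lose weight; the
    scalars coming from the inactive blocks lose the positive weight of a
    diagonal unit. *)
Lemma normal_ordered_word k ps : size ps = k -> in_word box ps ->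
  low (word_wt wt ps - 1) (normal_ordered k ps tens_hw - word tens_unit ps tens_hw).
Proof.
elim: k ps => [|k IH] [|[a b] ps] //=; last case=> sz.
  move=> _ _; rewrite /normal_ordered (big_pred1 [tuple]) ?subrr; first by left.
  by move=> qs; rewrite tuple0; apply/esym/eqP.
move=> /andP[bab Qp].
have low_no ps' W : size ps' = k -> in_word box ps' -> word_wt wt ps' <= W ->
  low W (normal_ordered k ps' tens_hw).
  move=> sz' Qp' leW; rewrite -[normal_ordered k ps' tens_hw](subrK (word tens_unit ps'
    tens_hw)); apply: lspanD.
    by apply: words_leS (IH _ sz' Qp'); lia.
  by apply: lspan_mem; exists ps'.
have [c c0 unitE] := normal_ordered_inactive bab sz.
have -> : normal_ordered k.+1 ((a, b) :: ps) tens_hw =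
    tens_unit a b (normal_ordered k ps tens_hw) - c *: normal_ordered k ps tens_hw -
    \sum_(l < k) (b == (nth (ord0, ord0) ps l).1)%:R *: normal_ordered k (contract (a, b) ps l)
      tens_hw.
  by rewrite unitE addrK normal_ordered_cons // addrK.
have reorder (x y z w : tens) : x - y - z - w = (x - w) - (y + z).
  by rewrite opprD addrA [x - w - y]addrAC [_ - w - z]addrAC.
rewrite reorder; apply: lspanB.
  have -> : tens_unit a b (normal_ordered k ps tens_hw)
        - tens_unit a b (word tens_unit ps tens_hw) =
      tens_unit a b (normal_ordered k ps tens_hw - word tens_unit ps tens_hw).
    by have := tens_unit_linear kap a b (-1) (word tens_unit ps tens_hw) (normal_ordered k ps
      tens_hw); rewrite !scaleN1r ![- _ + _]addrC.
  by apply: words_leS (words_le_unit bab (IH _ sz Qp)); rewrite word_wt_cons; lia.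
apply: lspanD.
  have [ab|/c0 ->] := eqVneq a b; last by rewrite scale0r; left.
  apply/lspanZ/low_no => //; subst b; rewrite word_wt_cons; have := wt_diag bab; lia.
apply: lspan_sum => l _; case: eqP => [bE|_]; last by rewrite scale0r; left.
have [|Qc wc] := word_wt_contract (l := l) _ Qp bab bE; first by rewrite sz.
by apply/lspanZ/low_no => //; rewrite size_set_nth sz; have := ltn_ord l; lia.
Qed.

End Words.

Variables (beta : 'I_(nroots n) -> posroot n) (cf : 'I_(nroots n) -> K).
Hypothesis beta_bij : bijective beta.
Hypothesis cf0 : forall k, cf k != 0.

(** Sum the normal ordered products over all ways of pairing the tops of the
    monomial with its bottoms: the sum is zero.  A pairing that stays on the
    path is a rearrangement of the monomial, because a path is a chain; all
    other pairings are strictly lighter.  Hence a positive multiple of the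
    monomial is a combination of lighter words. *)
Lemma path_relation (p : seq (posroot n)) (t : 'X_{1..nroots n}) :
  dyck_path i j p -> (forall k, t k != 0%N -> beta k \in p) ->
  (\sum_d active kap i j d < \sum_k t k)%N ->
  mons_le beta cf tens_unit tens_hw 1 ((wdeg beta t)%:Z - 1) (ordmon beta cf tens_unit t tens_hw).
Proof.
move=> dp tp big_t.
have cmp : {in mem p &, forall x y, root_le x y || root_le y x}.
  move: dp; case: (p) => [//|z q] /and3P[_ pq _]; exact: dyck_comparable.
have glT := tens_gl_module kap K; have hwT := tens_hw_highest kap K.
have [phi [psi /=]] := path_weights dp.
set off := fun (a b : I) => ((a, b) \notin map (@root_pair n) p)%:Z : int.
pose wt (a b : I) : int := 3 * (phi a + psi b) - off a b.
rewrite -/(wt) => -[wt_split wt_diag wt_deg wt_path].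
have wt_diag0 a : box a a -> 0 <= wt a a by move=> /wt_diag; apply: le_trans.
pose us : seq (posroot n) := flatten [seq nseq (t k) (beta k) | k <- enum 'I_(nroots n)].
have usE : mon_word beta t = map (@root_pair n) us.
  rewrite /mon_word /us map_flatten -map_comp; congr flatten; apply: eq_map => k /=.
  by rewrite map_nseq.
have us_p : all (mem p) us.
  apply/allP => x /flattenP[_ /mapP[k _ ->] /nseqP[-> tk]]; apply: tp.
  by rewrite -lt0n.
have us_size : size us = (\sum_k t k)%N.
  rewrite size_flatten /shape -map_comp sumnE big_map big_enum /=.
  by apply: eq_bigr => k _; rewrite size_nseq.
pose k := size us; pose A (l : 'I_k) := top (tnth (in_tuple us) l).
pose B (l : 'I_k) := bot (tnth (in_tuple us) l).
pose W : int := (3 * wdeg beta t)%N%:Z.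
have usP (l : 'I_k) : tnth (in_tuple us) l \in p by apply: (allP us_p); apply: mem_tnth.
have boxAB l l' : box (A l) (B l').
  have [/andP[bA _] _] := wt_path _ (usP l); have [/andP[_ bB] _] := wt_path _ (usP l').
  exact/andP.
have Qs s : in_word box (pairing A B s).
  by apply/allP => _ /mapP[l _ ->]; apply: boxAB.
have szs s : size (pairing A B s) = k by rewrite size_map size_enum_ord.
have usT : us = [seq tnth (in_tuple us) l | l <- enum 'I_k] by rewrite map_tnth_enum.
have fstE s : map fst (pairing A B s) = map (@top n) us.
  by rewrite [in RHS]usT -!map_comp; apply: eq_map.
have sndE s : perm_eq (map snd (pairing A B s)) (map (@bot n) us).
  have -> : map snd (pairing A B s) = map B (map s (enum 'I_k)).
    by rewrite -!map_comp; apply: eq_map.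
  have -> : map (@bot n) us = map B (enum 'I_k) by rewrite [in LHS]usT -map_comp; apply: eq_map.
  apply: perm_map.
  apply: uniq_perm; rewrite ?enum_uniq ?(map_inj_uniq (@perm_inj _ s)) ?enum_uniq //.
  move=> l; rewrite mem_enum inE; apply/mapP; exists ((s^-1)%g l); rewrite ?mem_enum //.
  by rewrite permKV.
have wtW s : word_wt wt (pairing A B s) = W - \sum_(ab <- pairing A B s) off ab.1 ab.2.
  rewrite /word_wt /wt sumrB; congr (_ - _).
  rewrite -mulr_sumr big_split /= mulrDr big_map big_enum /= big_map big_enum /=.
  have -> : \sum_(l < k) psi (B (s l)) = \sum_(l < k) psi (B l).
    by rewrite [RHS](reindex_inj (@perm_inj _ s)).
  rewrite -mulrDr -big_split /= mulr_sumr /W wdeg_mon_word usE big_map big_distrr /=.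
  rewrite [X in _ = Posz (\sum_(_ <- X) _)]usT big_map big_enum /=.
  rewrite (big_morph Posz PoszD (erefl _)); apply: eq_bigr => l _.
  have [_] := wt_path _ (usP l); rewrite /wt /off.
  rewrite (_ : (_, _) \notin _ = false) ?subr0 ?rdegE //.
  by apply/negbTE; rewrite negbK; apply: (map_f (@root_pair n)).
pose good s := all (fun ab => ab \in map (@root_pair n) p) (pairing A B s).
have offW s : word_wt wt (pairing A B s) <= W - (~~ good s)%:Z.
  rewrite wtW lerD2l lerN2 /good; elim: (pairing A B s) => [|ab l IHl] /=.
    by rewrite big_nil.
  rewrite big_cons; have : 0 <= \sum_(ab <- l) off ab.1 ab.2 by apply: sumr_ge0.
  rewrite (_ : off ab.1 ab.2 = (ab \notin map (@root_pair n) p)%:Z); last by case: (ab).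
  by move: IHl; case: (_ \in _) => /=; lia.
pose low := words_le tens_unit tens_hw box wt.
(* Each summand is the monomial itself or zero, modulo smaller weight. *)
have lowgood s : low (W - 1)
    (normal_ordered k (pairing A B s) tens_hw -
      (good s)%:R *: word tens_unit (mon_word beta t) tens_hw).
  have := normal_ordered_word (wt := wt) wt_split wt_diag (szs s) (Qs s).
  have := offW s; have [gs|bs] := boolP (good s);
    rewrite [~~ _]/= [Posz _]/= ?subr0 ?scale1r ?scale0r ?subr0 => lesW lows.
    rewrite -(subrKA (word tens_unit (pairing A B s) tens_hw)); apply: lspanD.
      by apply: words_leS lows; lia.
    have [vs vs_p vsE] : exists2 vs, all (mem p) vs & pairing A B s = map (@root_pair n) vs.
      by apply/subset_mapP => ab; apply: (allP gs).
    have perm_uv : perm_eq vs us.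
      apply: (comparable_marginals (P := mem p)); rewrite ?vs_p ?us_p //.
        by rewrite -(fstE s) vsE -map_comp.
      by rewrite -(permPr (sndE s)) vsE -map_comp.
    rewrite usE vsE; apply: words_leS (word_perm (wt := wt) glT tens_hw box_trans wt_split _ _);
      rewrite -?vsE //.
      by move: lesW; lia.
    by rewrite vsE perm_map.
  rewrite -[normal_ordered _ _ _](subrK (word tens_unit (pairing A B s) tens_hw)); apply: lspanD.
    by apply: words_leS lows; lia.
  by apply: lspan_mem; exists (pairing A B s); split => //; lia.
have lowsum : low (W - 1) (\sum_s normal_ordered k (pairing A B s) tens_hw -
    (\sum_s good s)%:R *: word tens_unit (mon_word beta t) tens_hw).
  rewrite natr_sum scaler_suml -sumrB; apply: lspan_sum => s _; exact: lowgood.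
move: lowsum; rewrite normal_ordered_null ?sub0r; last by rewrite /k us_size.
move=> /lspanN; rewrite opprK => lowmon.
(* The identity pairing is good, so the coefficient of the monomial is nonzero. *)
have good1 : good 1%g.
  apply/allP => _ /mapP[l _ ->]; rewrite perm1; exact: (map_f (@root_pair n)).
have lown : low (W - 1) (word tens_unit (mon_word beta t) tens_hw).
  have := lspanZ (\sum_s good s)%:R^-1 lowmon; rewrite scalerA mulVf ?scale1r //.
  by rewrite pnatr_eq0 (bigD1 1%g) //= good1.
rewrite ordmonE //; apply: lspanZ.
have := words_mons (wt := wt) glT hwT box_trans wt_split wt_diag0 wt_deg beta_bij cf0 lown.
apply: lspanS => _ [s ws ->]; exists s => //.
by move: ws; rewrite /W; lia.
Qed.

End PathRelation.

(** * Terms of lowest degree *)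

Section LowestTerms.
Variables (K : fieldType) (N : nat) (wd : 'X_{1..N} -> nat).
Hypothesis wdD : forall s t, wd (s + t)%MM = (wd s + wd t)%N.
Implicit Types (p q : {mpoly K[N]}) (s t : 'X_{1..N}).

Definition atleast (D : nat) p : Prop := forall t, p@_t != 0 -> (D <= wd t)%N.
(** The lowest homogeneous component of p is a single nonzero term. *)
Definition lowest s p : Prop :=
  p@_s != 0 /\ forall t, p@_t != 0 -> t <> s -> (wd s < wd t)%N.

Lemma atleast0 D : atleast D 0.
Proof. by move=> t; rewrite mcoeff0 eqxx. Qed.

Lemma atleastD D p q : atleast D p -> atleast D q -> atleast D (p + q).
Proof.
move=> hp hq t; rewrite mcoeffD; have [->|/hp //] := eqVneq p@_t 0.
by rewrite add0r => /hq.
Qed.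

Lemma mcoeffM_neq0 p q t : (p * q)@_t != 0 ->
  exists t1 t2, [/\ t = (t1 + t2)%MM, p@_t1 != 0 & q@_t2 != 0].
Proof.
rewrite mcoeffM => /eqP nz; apply: boolp.contrapT => none; apply: nz.
rewrite big1 // => -[k1 k2] /= /eqP tE; apply/eqP/contraT => nz12; case: none.
exists k1, k2; split=> //; first by apply: contraNneq nz12 => ->; rewrite mul0r.
by apply: contraNneq nz12 => ->; rewrite mulr0.
Qed.

Lemma atleastM D1 D2 p q : atleast D1 p -> atleast D2 q -> atleast (D1 + D2) (p * q).
Proof.
by move=> hp hq t /mcoeffM_neq0[t1 [t2 [-> /hp h1 /hq h2]]]; rewrite wdD leq_add.
Qed.

Lemma atleast_sign D (b : bool) p : atleast D p -> atleast D ((-1) ^+ b * p).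
Proof.
case: b; rewrite ?expr1 ?expr0 ?mulN1r ?mul1r => hp t; last exact: hp.
by rewrite mcoeffN oppr_eq0; apply: hp.
Qed.

Lemma lowest_atleast s p : lowest s p -> atleast (wd s) p.
Proof.
move=> [_ hp] t /hp h; have [->//|/eqP ts] := eqVneq t s.
exact/ltnW/h.
Qed.

(** As for initial terms, but without a monomial order: the two lowest terms are
    the unique pair of terms whose product has minimal degree. *)
Lemma lowestM s1 s2 p q : lowest s1 p -> lowest s2 q -> lowest (s1 + s2)%MM (p * q).
Proof.
move=> lp lq; have ap := lowest_atleast lp; have aq := lowest_atleast lq.
case: lp lq => p0 lp [q0 lq].
have key t1 t2 : p@_t1 != 0 -> q@_t2 != 0 -> (wd (t1 + t2)%MM <= wd (s1 + s2)%MM)%N ->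
    t1 = s1 /\ t2 = s2.
  rewrite !wdD => h1 h2 le; have a1 := ap _ h1; have a2 := aq _ h2.
  split; [have := lp _ h1 | have := lq _ h2].
    by have [//|/eqP n1 /(_ n1)] := eqVneq t1 s1; lia.
  by have [//|/eqP n1 /(_ n1)] := eqVneq t2 s2; lia.
split; last first.
  move=> t /mcoeffM_neq0[t1 [t2 [-> h1 h2]]] ts; rewrite ltnNge; apply/negP.
  by move=> /(key _ _ h1 h2) [e1 e2]; apply: ts; rewrite e1 e2.
have b1 : (mdeg s1 < (mdeg (s1 + s2)%MM).+1)%N by rewrite mdegD ltnS leq_addr.
have b2 : (mdeg s2 < (mdeg (s1 + s2)%MM).+1)%N by rewrite mdegD ltnS leq_addl.
rewrite mcoeffM (bigD1 (BMultinom b1, BMultinom b2)) //= big1 ?addr0 ?mulf_neq0 //.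
move=> [k1 k2] /= /andP[/eqP kE nk]; apply/eqP; apply: contraNT nk => nz.
have h1 : p@_k1 != 0 by apply: contraNneq nz => ->; rewrite mul0r.
have h2 : q@_k2 != 0 by apply: contraNneq nz => ->; rewrite mulr0.
have [|e1 e2] := key _ _ h1 h2; first by rewrite -kE.
by rewrite xpair_eqE -!val_eqE /= e1 e2 !eqxx.
Qed.

Lemma wd0 : wd 0%MM = 0%N.
Proof. by have := wdD 0%MM 0%MM; rewrite add0m; lia. Qed.

Lemma lowest1 : lowest 0%MM 1.
Proof.
split=> [|t]; first by rewrite mcoeff1 eqxx oner_neq0.
by rewrite mcoeff1; case: (eqVneq t 0%MM) => [-> _ []|_]; rewrite ?eqxx.
Qed.

Lemma lowest_prod (J : finType) (F : J -> {mpoly K[N]}) (S : J -> 'X_{1..N}) :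
  (forall r, lowest (S r) (F r)) -> lowest (\sum_r S r)%MM (\prod_r F r).
Proof.
move=> lF; elim/big_rec2: _ => [|r p s _ lp]; first exact: lowest1.
exact: lowestM.
Qed.

Lemma atleast_prod (J : finType) (F : J -> {mpoly K[N]}) (D : J -> nat) :
  (forall r, atleast (D r) (F r)) -> atleast (\sum_r D r)%N (\prod_r F r).
Proof.
move=> lF; elim/big_rec2: _ => [|r p d _ lp]; first by move=> t _.
exact: atleastM.
Qed.

Lemma lowestD s p q : lowest s p -> atleast (wd s).+1 q -> lowest s (p + q).
Proof.
move=> [p0 lp] aq; split.
  rewrite mcoeffD (_ : q@_s = 0) ?addr0 //.
  by apply/eqP/contraT => /aq; rewrite ltnn.
move=> t; rewrite mcoeffD => nz ts; have [qt|/aq //] := eqVneq q@_t 0.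
by apply: lp => //; rewrite qt addr0 in nz.
Qed.

End LowestTerms.

(** * The generating function of the ordered monomials *)

Section Derivations.
Variables (K : fieldType) (N : nat) (k : 'I_N).
Local Notation P := {mpoly K[N]}.
Local Notation D := (mderiv k).

Lemma mderiv_prod (J : finType) (F : J -> P) :
  D (\prod_r F r) = \sum_r \prod_r' (if r' == r then D (F r') else F r').
Proof.
elim: (index_enum J) (index_enum_uniq J) => [|x l IH] /=; first by rewrite !big_nil mderivC.
move=> /andP[xl ul]; rewrite big_cons mderivM IH // big_cons big_cons eqxx; congr (_ + _).
  congr (_ * _); apply: eq_big_seq => r rl.
  by case: eqP => // rx; rewrite -rx rl in xl.
rewrite mulr_sumr; apply: eq_big_seq => r rl; rewrite big_cons.
by case: eqP => // rx; rewrite rx rl in xl.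
Qed.

Lemma mderiv_det m (A : 'M[P]_m) :
  D (\det A) = \sum_r \det (\matrix_(r', c) if r' == r then D (A r' c) else A r' c).
Proof.
rewrite /determinant exchange_big linear_sum /=; apply: eq_bigr => s _.
rewrite -mulr_sumr; have -> (p : P) : D ((-1) ^+ (perm.odd_perm s) * p) =
  (-1) ^+ (perm.odd_perm s) * D p.
  by case: (perm.odd_perm s); rewrite ?expr1 ?mulN1r ?mderivN // expr0 !mul1r.
rewrite mderiv_prod; congr (_ * _); apply: eq_bigr => r _.
by apply: eq_bigr => r' _; rewrite mxE.
Qed.

(** Congruence modulo the ideal generated by 'X_k. *)
Definition eqmodX (p q : P) : Prop := forall t : 'X_{1..N}, t k = 0%N -> p@_t = q@_t.

Lemma eqmodXD p q p' q' : eqmodX p p' -> eqmodX q q' -> eqmodX (p + q) (p' + q').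
Proof. by move=> hp hq t t0; rewrite !mcoeffD hp ?hq. Qed.
Lemma eqmodXM p q p' q' : eqmodX p p' -> eqmodX q q' -> eqmodX (p * q) (p' * q').
Proof.
move=> hp hq t t0; rewrite !mcoeffM; apply: eq_bigr => -[k1 k2] /= /eqP tE.
have tk : t k = (k1 k + k2 k)%N by rewrite {1}tE mnmDE.
by rewrite hp ?hq //; lia.
Qed.

Lemma eqmodX_det m (A B : 'M[P]_m) : (forall r c, eqmodX (A r c) (B r c)) ->
  eqmodX (\det A) (\det B).
Proof.
move=> AB; rewrite /determinant; apply: (big_ind2 eqmodX) => [||s _] //.
  by move=> x1 x2 y1 y2 h1 h2; apply: eqmodXD h1 h2.
apply: eqmodXM => //; apply: (big_ind2 eqmodX) => // x1 x2 y1 y2 h1 h2; apply: eqmodXM h1 h2.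
Qed.
End Derivations.

Section GeneratingFunction.
Variables (n L : nat) (kap : 'I_L -> 'I_n) (K : fieldType).
Local Notation I := 'I_n.+1.
Local Notation N := (nroots n).
Local Notation P := {mpoly K[N]}.
Local Notation tens := (tens n L K).
Variables (beta : 'I_N -> posroot n) (cf : 'I_N -> K).
Implicit Types (G : 'M[P]_n.+1) (al : state n L) (l : seq 'I_N).

(** Left multiplication by 1 + z_k f_k, with z_k the variable 'X_k. *)
Definition unip_step k G : 'M[P]_n.+1 :=
  \matrix_(a, q) (G a q + (a == top (beta k))%:R * (cf k *: 'X_k) * G (bot (beta k)) q).
Definition unipotent l : 'M[P]_n.+1 := foldr unip_step 1%:M l.

Definition coef_tens G (t : 'X_{1..N}) : tens := [ffun al : state n L => (minors kap G al)@_t].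

(** Each variable enters through a single factor. *)
Lemma unipotent_free k l a q : k \notin l -> mderiv k (unipotent l a q) = 0.
Proof.
elim: l a q => [|k' l IH] a q /=; first by rewrite mxE; case: (_ == _);
  rewrite ?mderiv0 // -mpolyC1 mderivC.
rewrite inE negb_or => /andP[kk' kl]; rewrite mxE mderivD IH // add0r.
rewrite mderivM IH // mulr0 addr0 mderivM -[(_ == _)%:R]mpolyC_nat mderivC mul0r add0r mderivZ
  mderivX.
by rewrite mnm1E (eq_sym k' k) (negPf kk') scale0r scaler0 mulr0 mul0r.
Qed.

Lemma mderiv_unip_step k G a q : (forall a q, mderiv k (G a q) = 0) ->
  mderiv k (unip_step k G a q) = ((a == top (beta k))%:R * cf k) *: unip_step k G (bot (beta k)) q.
Proof.
move=> G0; rewrite !mxE mderivD G0 add0r mderivM G0 mulr0 addr0.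
have /negPf -> : bot (beta k) != top (beta k).
  by rewrite neq_ltn bot_lt_top.
rewrite mul0r mul0r addr0; case: (a == _); last first.
  by rewrite !mul0r mderiv0 mul0r scale0r.
rewrite !mul1r mderivZ mderivX mnm1E eqxx scale1r (_ : (U_(k) - U_(k) = 0)%MM) ?mpolyX0;
  last by apply/mnmP => r; rewrite mnmBE subnn mnm0E.
by rewrite -scalerAl mul1r.
Qed.

(** Since f_k squares to zero, differentiating 1 + z_k f_k in z_k amounts to
    multiplying by f_k on the left; by the Leibniz rule on rows this is the
    action of f_k on tensors. *)
Lemma mderiv_minors k G al : (forall a q, mderiv k (G a q) = 0) ->
  mderiv k (minors kap (unip_step k G) al) =
  \sum_(q | acting kap q) ((al q == top (beta k))%:R * cf k) *:
     minors kap (unip_step k G) (upd al q (bot (beta k))).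
Proof.
move=> G0; rewrite /minors mderiv_prod.
transitivity (\sum_d \sum_(p | acting kap (d, p)) ((al (d, p) == top (beta k))%:R * cf k) *:
     minors kap (unip_step k G) (upd al (d, p) (bot (beta k)))); last first.
  by rewrite pair_big_dep /=; apply: eq_big => [[d p]|[d p] _].
apply: eq_bigr => d _; rewrite (bigD1 d) //= eqxx mderiv_det mulr_suml [RHS]big_mkcond /=.
apply: eq_bigr => p _.
have -> : \prod_(d' | d' != d) (if d' == d then mderiv k (\det (minor_mx kap (unip_step k G) al d'))
     else \det (minor_mx kap (unip_step k G) al d')) =
       \prod_(d' | d' != d) \det (minor_mx kap (unip_step k G) al d').
  by apply: eq_bigr => d' /negPf ->.
case: ifPn => [adp|nadp].
  rewrite minors_upd // mulrC scalerAr; congr (_ * _).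
  set A := (X in \det X = _); set B := (X in _ = _ *: \det X).
  rewrite (expand_det_row A p) (expand_det_row B p) scaler_sumr; apply: eq_bigr => c _.
  have -> : cofactor A p c = cofactor B p c.
    rewrite /cofactor; congr (_ * \det _); apply/matrixP => r s.
    by rewrite /A /B ![row' _ _ _ _]mxE ![col' _ _ _ _]mxE ![(\matrix_(_, _) _) _ _]mxE eq_sym
      (negPf (neq_lift _ _)).
  rewrite scalerAl; congr (_ * _).
  have -> : A p c = mderiv k (unip_step k G (al (d, p)) c).
    by rewrite /A mxE eqxx mxE (adp : (p <= kap d)%N).
  by rewrite mderiv_unip_step // /B [in RHS]mxE eqxx.
rewrite (expand_det_row _ p) big1 ?mul0r // => c _; rewrite mxE eqxx mxE.
rewrite (negPf (nadp : ~~ (p <= kap d)%N)) -mpolyC_nat mderivC mul0r //.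
Qed.

Lemma coef_unip_step k G (t : 'X_{1..N}) : (forall a q, mderiv k (G a q) = 0) ->
  (t k).+1%:R *: coef_tens (unip_step k G) (t + U_(k)) =
  cf k *: tens_unit kap (top (beta k)) (bot (beta k)) (coef_tens (unip_step k G) t).
Proof.
move=> G0; apply/ffunP => al; rewrite !tensZ sum_ffunE [in LHS]ffunE.
rewrite mulr_natl -mcoeff_mderiv mderiv_minors // raddf_sum mulr_sumr; apply: eq_bigr => q _.
by rewrite /= mcoeffZ unit_atE [in RHS]ffunE mulrA [cf k * _]mulrC.
Qed.

Lemma coef_unip_step0 k G (t : 'X_{1..N}) : t k = 0%N -> coef_tens (unip_step k G) t =
  coef_tens G t.
Proof.
move=> t0; apply/ffunP => al; rewrite [LHS]ffunE [RHS]ffunE.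
suff h : eqmodX k (minors kap (unip_step k G) al) (minors kap G al) by rewrite h.
apply: (big_ind2 (eqmodX k)) => // [x1 x2 y1 y2 h1 h2|d _]; first exact: eqmodXM h1 h2.
apply: eqmodX_det => p q; rewrite !mxE; case: ifP => // _.
move=> s s0; rewrite mcoeffD [X in _ + X](_ : _ = 0) ?addr0 //.
apply/eqP; apply: contraT => /mcoeffM_neq0[s1 [s2 [sE /mcoeffM_neq0[s3 [s4 [s1E _ nz]]] _]]].
move: nz; rewrite mcoeffZ mcoeffX; case: (U_(k)%MM =P s4) => [s4E _|_];
  last by rewrite mulr0n mulr0 eqxx.
by move: s0; rewrite sE s1E -s4E !mnmDE mnm1E eqxx; lia.
Qed.

(** The minors of the product of the factors 1 + z_k f_k = exp(z_k f_k) are the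
    coordinates of the product of the exp(z_k f_k) acting on the highest weight
    tensor; the claim compares the coefficients of z^t. *)
Lemma coef_unipotent l (t : 'X_{1..N}) : uniq l -> (forall k, k \notin l -> t k = 0%N) ->
  (\prod_(k <- l) (t k)`!)%:R *: coef_tens (unipotent l) t =
  foldr (fun k u' => iter (t k) (fun x => cf k *: tens_unit kap (top (beta k)) (bot (beta k)) x) u')
    (tens_hw kap K) l.
Proof.
elim: l t => [|k l IH] t /=.
  move=> _ t0; have -> : t = 0%MM by apply/mnmP => k; rewrite t0 // mnm0E.
  rewrite big_nil scale1r; apply/ffunP => al; rewrite [LHS]ffunE [RHS]ffunE /unipotent.
  have -> : minors kap (1%:M : 'M[P]_n.+1) al = (minors kap (1%:M : 'M[K]_n.+1) al)%:MP.
    rewrite /minors rmorph_prod; apply: eq_bigr => d _ /=.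
    rewrite -det_map_mx; congr (\det _); apply/matrixP => p q; rewrite !mxE.
    by case: ifP => _; rewrite ?mxE rmorph_nat.
  by rewrite mcoeffC eqxx mulr1.
move=> /andP[kl ul] t0.
pose t1 := [multinom (if k' == k then 0 else t k')%N | k' < N].
have t1k : t1 k = 0%N by rewrite mnmE eqxx.
have G0 a q := unipotent_free a q kl.
set Fk := fun x => cf k *: tens_unit kap (top (beta k)) (bot (beta k)) x.
have FkZ c x : Fk (c *: x) = c *: Fk x.
  rewrite /Fk (GRing.scalable_linear (tens_unit_linear kap (top (beta k)) (bot (beta k)))).
  by rewrite !scalerA mulrC.
have iterE r : (r`!)%:R *: coef_tens (unip_step k (unipotent l)) (t1 + U_(k) *+ r)%MM =
    iter r Fk (coef_tens (unipotent l) t1).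
  elim: r => [|r IHr]; first by rewrite mulm0n addm0 scale1r coef_unip_step0.
  have -> : (t1 + U_(k) *+ r.+1 = t1 + U_(k) *+ r + U_(k))%MM.
    by apply/mnmP => k'; rewrite !mnmDE !mulmnE; lia.
  rewrite iterS -IHr FkZ /Fk -coef_unip_step // scalerA mnmDE t1k mulmnE mnm1E eqxx.
  by rewrite mul1n add0n factS natrM mulrC.
have tE : t = (t1 + U_(k) *+ t k)%MM.
  apply/mnmP => k'; rewrite mnmDE mnmE mulmnE mnm1E (eq_sym k k'); case: eqP => [->|] //=.
    by rewrite mul1n.
  by rewrite mul0n addn0.
have t1l k' : k' \in l -> t1 k' = t k'.
  by rewrite mnmE; case: eqP => // ->; rewrite (negPf kl).
pose Fs (t' : 'X_{1..N}) := foldr (fun k u' => iter (t' k)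
  (fun x => cf k *: tens_unit kap (top (beta k)) (bot (beta k)) x) u') (tens_hw kap K) l.
have FsE : Fs t1 = Fs t.
  rewrite /Fs; elim: (l) t1l => //= k' l' IHl h; rewrite (h _ (mem_head _ _)) IHl // => k2 k2l.
  by apply: h; rewrite inE k2l orbT.
rewrite -/(Fs t) -FsE /Fs -IH // => [|k' k'l]; last first.
  by rewrite mnmE; case: eqP => // /eqP k'k; rewrite t0 // inE negb_or k'k.
have iterZ c r x : iter r Fk (c *: x) = c *: iter r Fk x.
  by elim: r => //= r ->; rewrite FkZ.
rewrite iterZ -iterE scalerA -tE big_cons natrM mulrC; congr (_%:R * _ *: _).
by apply: eq_big_seq => k' /t1l ->.
Qed.

End GeneratingFunction.

(** * Terms of lowest degree of minors *)

Section Rearrangement.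
Local Open Scope nat_scope.
Variables (N kap : nat) (A : 'I_N -> nat).
Hypothesis A_fix : forall p : 'I_N, A p = p \/ (p <= kap) && (kap < A p).
Hypothesis A_decr : forall p q : 'I_N, p < q -> p <> A p :> nat -> q <> A q :> nat -> A q < A p.

(** A rearrangement inequality among the permutations s with s p <= A p.  The
    map A decreases except on its fixed points, which the constraint makes
    harmless: let q be the largest index moved by s and r0 its preimage.  Since
    r0 < q <= A r0, the index r0 is not fixed by A, so q <= kap < A r0 and
    hence A q < A r0.  Making s fix q thus lowers the sum, and keeps the
    constraint. *)
Lemma rearrangement (s : 'S_N) : s != 1%g ->
  (forall p, s p <= A p) -> (forall p : 'I_N, kap < p -> s p = p) ->
  \sum_(p < N) p * A p < \sum_(p < N) s p * A p.
Proof.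
move: {2}#|[set p | s p != p]|.+1 (ltnSn #|[set p | s p != p]|) => r.
elim: r s => // r IH s lt_r s1 sA sfix.
have [q0 q0s] : exists q0, s q0 != q0.
  apply/existsP; apply: contraNT s1; rewrite negb_exists => /forallP h.
  by apply/eqP/permP => p; rewrite perm1; apply/eqP; have := h p; rewrite negbK.
pose q := [arg max_(q > q0 | s q != q) (q : nat)].
have [sq qmax] : s q != q /\ forall p, s p != p -> p <= q.
  by rewrite /q; case: arg_maxnP => // q' ? h.
have q_kap : q <= kap.
  by rewrite leqNgt; apply: contra sq => /sfix ->.
have sq_lt : s q < q.
  rewrite ltn_neqAle sq /=; apply: qmax; apply: contraNneq sq => e.
  by apply/eqP/(@perm_inj _ s).
pose r0 := (s^-1)%g q; have sr : s r0 = q by rewrite permKV.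
have rq : r0 != q by apply: contraNneq sq => e; rewrite -{1}e sr.
have r_lt : r0 < q.
  by rewrite ltn_neqAle rq /=; apply: qmax; rewrite sr eq_sym rq.
have qA := sA r0; rewrite sr in qA.
have Ar : kap < A r0 by case: (A_fix r0) => [e|/andP[]] //; move: qA; rewrite e; lia.
have Aqr : A q < A r0.
  case: (A_fix q) => [->|/andP[_ kA]]; first by lia.
  by apply: A_decr => //; lia.
pose s' := (s * tperm q (s q))%g.
have s'q : s' q = q by rewrite permM tpermR.
have s'r : s' r0 = s q by rewrite permM sr tpermL.
have s'o p : p != q -> p != r0 -> s' p = s p.
  move=> pq pr; rewrite permM tpermD //.
    by apply: contraNneq pr => e; apply/eqP/(@perm_inj _ s); rewrite sr.
  by rewrite (inj_eq (@perm_inj _ s)) eq_sym.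
have lt_sum : \sum_(p < N) s' p * A p < \sum_(p < N) s p * A p.
  rewrite (bigD1 q) //= (bigD1 r0) //= [X in _ < X](bigD1 q) //= [X in _ < _ + X](bigD1 r0) //=.
  rewrite s'q s'r sr [X in _ + (_ + X)](eq_bigr (fun p => s p * A p)); last first.
    by move=> p /andP[pq pr]; rewrite s'o.
  have cross a b c d e : a < b -> c < d -> b * c + (a * d + e) < a * c + (b * d + e) by nia.
  exact: cross.
have [s'1|s'n1] := eqVneq s' 1%g.
  apply: leq_trans lt_sum; rewrite ltnS; apply: leq_sum => p _.
  by rewrite s'1 perm1.
apply: ltn_trans lt_sum; apply: IH => //.
- rewrite -ltnS; apply: leq_trans lt_r; rewrite ltnS; apply: proper_card.
  apply/properP; split; last by exists q; rewrite !inE ?s'q ?eqxx.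
  apply/subsetP => p; rewrite !inE; case: (p =P q) => [->|/eqP pq]; first by rewrite s'q eqxx.
  case: (p =P r0) => [-> _|/eqP pr]; first by rewrite sr eq_sym rq.
  by rewrite s'o.
- move=> p; case: (p =P q) => [->|/eqP pq].
    by rewrite s'q; case: (A_fix q) => [->//|/andP[_]]; lia.
  by case: (p =P r0) => [->|/eqP pr]; [rewrite s'r; lia | rewrite s'o].
- move=> p pk; case: (p =P q) => [->|/eqP pq]; first by rewrite s'q.
  by case: (p =P r0) pk => [->|/eqP pr] pk; [lia | rewrite s'o // sfix].
Qed.
End Rearrangement.

Section LowestDeterminants.
Variables (n L : nat) (kap : 'I_L -> 'I_n) (K : fieldType).
Local Notation I := 'I_n.+1.
Local Notation N := (nroots n).
Local Notation P := {mpoly K[N]}.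
Variables (beta : 'I_N -> posroot n) (cf : 'I_N -> K).
Hypothesis beta_bij : bijective beta.
Hypothesis cf0 : forall k, cf k != 0.
Local Notation deg := (move_deg n).
Local Notation wd := (wdeg beta).
Local Notation U l := (unipotent beta cf l).

Lemma top_neq_bot (x : posroot n) : (top x == bot x) = false.
Proof. exact: gtn_eqF (bot_lt_top x). Qed.

Lemma wdegU k : wd U_(k)%MM = rdeg (beta k).
Proof.
rewrite /wdeg (bigD1 k) //= mnm1E eqxx mul1n big1 ?addn0 // => k' /negPf nk.
by rewrite mnm1E eq_sym nk.
Qed.

(** The entry in row a and column q sums over certain chains of moves from q to
    a; a chain of several moves has larger degree than the direct move, so the
    lowest term is the variable of the root. *)
Lemma unipotent_entries l : uniq l ->
  [/\ forall a q : I, (a < q)%N -> U l a q = 0,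
      forall a, U l a a = 1,
      forall k, (U l (top (beta k)) (bot (beta k)))@_U_(k) = if k \in l then cf k else 0 &
      forall k t, (U l (top (beta k)) (bot (beta k)))@_t != 0 -> t <> U_(k)%MM ->
        (rdeg (beta k) < wd t)%N].
Proof.
elim: l => [|k0 l IH] /=.
  move=> _; split.
  - by move=> a q aq; rewrite mxE; case: eqP aq => [->|//]; rewrite ltnn.
  - by move=> a; rewrite mxE eqxx.
  - by move=> k; rewrite mxE top_neq_bot mcoeff0.
  - by move=> k t; rewrite mxE top_neq_bot mcoeff0 eqxx.
move=> /andP[k0l /IH [low diag coe high]].
have root_eq k : top (beta k) = top (beta k0) -> bot (beta k) = bot (beta k0) -> k = k0.
  by move=> e1 e2; apply/(bij_inj beta_bij)/root_inj.
have extra k t : top (beta k) = top (beta k0) -> k != k0 ->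
    (cf k0 *: 'X_k0 * U l (bot (beta k0)) (bot (beta k)))@_t != 0 -> (rdeg (beta k) < wd t)%N.
  move=> et kk0 /mcoeffM_neq0[t1 [t2 [-> h1 h2]]].
  rewrite wdegD // -/(wd); move: h1; rewrite mcoeffZ mcoeffX;
    case: (U_(k0)%MM =P t1) => [<- _|_]; last first.
    by rewrite mulr0n mulr0 eqxx.
  have [lt|gt|e] := ltngtP (bot (beta k0)) (bot (beta k)).
  - by move: h2; rewrite low // mcoeff0 eqxx.
  - have [y ty by_] := posroot_of gt.
    have [g gK Kg] := beta_bij; have yE : y = beta (g y) by rewrite Kg.
    have : (rdeg y <= wd t2)%N.
      have [t2E|/eqP t2n] := eqVneq t2 U_(g y)%MM; first by rewrite t2E wdegU -yE.
      by rewrite yE ltnW //; apply: high t2n; rewrite -yE ty by_.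
    rewrite wdegU !rdegE ty by_ et; have := move_deg_split gt (bot_lt_top (beta k0)); lia.
  - by case/negP: kk0; apply/eqP/root_eq => //; apply: val_inj.
split.
- move=> a q aq; rewrite mxE low // add0r; case: eqP => [aE|_]; last by rewrite !mul0r.
  by rewrite low ?mulr0 //; apply: ltn_trans aq; rewrite aE; apply: bot_lt_top.
- move=> a; rewrite mxE diag; case: eqP => [aE|_]; last by rewrite !mul0r addr0.
  by rewrite low ?mulr0 ?addr0 // aE; apply: bot_lt_top.
- move=> k; rewrite mxE mcoeffD coe inE; case: (k =P k0) => [->|/eqP kk0] /=.
    by rewrite eqxx mul1r diag mulr1 mcoeffZ mcoeffX eqxx mulr1 (negPf k0l) add0r.
  case: eqP => [et|_]; last by rewrite !mul0r mcoeff0 addr0.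
  rewrite mul1r; set c := (X in _ + X); rewrite (_ : c = 0) ?addr0 //.
  by apply/eqP/contraT => /(extra _ _ et kk0); rewrite wdegU ltnn.
- move=> k t; rewrite mxE mcoeffD;
    have [->|h] := eqVneq ((U l (top (beta k)) (bot (beta k)))@_t) 0; last by move=> _;
      apply: high h.
  rewrite add0r; case: (top (beta k) =P _) => [et|_]; last by rewrite !mul0r mcoeff0 eqxx.
  rewrite mul1r; case: (k =P k0) => [->|/eqP kk0]; last by move/(extra _ _ et kk0).
  by rewrite diag mulr1 mcoeffZ mcoeffX; case: (U_(k0)%MM =P t) => [<- _ []//|_];
    rewrite mulr0n mulr0 eqxx.
Qed.

Let Ufull := U (enum 'I_N).

Lemma unipotent_root x k : beta k = x -> lowest wd U_(k)%MM (Ufull (top x) (bot x)).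
Proof.
move=> <-; have [_ _ coe high] := unipotent_entries (enum_uniq 'I_N).
split; first by rewrite coe mem_enum cf0.
by move=> t h1 h2; rewrite wdegU; apply: high h1 h2.
Qed.

Lemma unipotent_atleast (a q : I) : (q <= a)%N -> atleast wd (deg a q) (Ufull a q).
Proof.
rewrite leq_eqVlt => /predU1P[/val_inj ->|qa].
  by move=> t _; rewrite /move_deg subnn.
have [x <- <-] := posroot_of qa; have [g gK Kg] := beta_bij.
by have := lowest_atleast (unipotent_root (Kg x)); rewrite wdegU Kg rdegE.
Qed.

Variable M : 'I_L -> {set posroot n}.
Hypothesis M_kap : forall d x, x \in M d -> (lo x <= kap d <= hi x)%N.
Hypothesis M_anti : forall d, {in M d &, forall x y, root_le x y -> x = y}.

(** In block d, the roots of the antichain M d move their bottoms to their tops;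
    the other indices stay. *)
Definition antichain_state : state n L :=
  [ffun q : pos n L => if [pick x in M q.1 | bot x == q.2] is Some x then top x else q.2].
Definition antichain_mon d : 'X_{1..N} := [multinom (beta k \in M d : nat) | k < N].

(** Intervals with a common end point are comparable. *)
Lemma antichain_bot_inj d x y : x \in M d -> y \in M d -> bot x = bot y -> x = y.
Proof.
move=> xM yM /(congr1 val) /= e; have [le|/ltnW le] := leqP (hi x) (hi y).
  by apply: (M_anti xM yM); rewrite /root_le e leqnn.
by apply/esym/(M_anti yM xM); rewrite /root_le e leqnn.
Qed.

Lemma antichain_stateP d p :
  (exists x, [/\ x \in M d, bot x = p & antichain_state (d, p) = top x]) \/
  ((forall x, x \in M d -> bot x != p) /\ antichain_state (d, p) = p).
Proof.
rewrite ffunE /=; case: pickP => [x /andP[xM /eqP bx]|none]; [left|right].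
  by exists x.
by split=> // x xM; have := none x; rewrite xM /= => ->.
Qed.

(** The permutation s contributes terms of degree at least the sum over p of
    the degrees of the moves from s p to al p, where al is the state.  Up to
    terms independent of s, this is the sum of the s p * al p.  An antichain
    pairs increasing bottoms with decreasing tops, so by [rearrangement] the
    identity is the unique minimum among the permutations with a nonzero
    product, and its lowest term is the monomial of the antichain. *)
Lemma lowest_det d : lowest wd (antichain_mon d) (\det (minor_mx kap Ufull antichain_state d)).
Proof.
have [lowU diagU _ _] := unipotent_entries (enum_uniq 'I_N).
rewrite -/Ufull in lowU diagU.
pose al (p : I) : I := antichain_state (d, p).
pose S (p : I) : 'X_{1..N} :=
  [multinom ((beta k \in M d) && (bot (beta k) == p) : nat) | k < N].
have SE : antichain_mon d = (\sum_p S p)%MM.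
  apply/mnmP => k; rewrite mnm_sumE mnmE (bigD1 (bot (beta k))) //= mnmE eqxx andbT.
  by rewrite big1 ?addn0 // => p /negPf np; rewrite mnmE eq_sym np andbF.
have [g gK Kg] := beta_bij.
have SU p x : x \in M d -> bot x = p -> S p = U_(g x)%MM.
  move=> xM bx; apply/mnmP => k; rewrite mnmE mnm1E; congr nat_of_bool.
  apply/andP/eqP => [[kM /eqP bk]|<-]; last by rewrite Kg xM bx.
  by rewrite (antichain_bot_inj xM kM) ?gK // bx bk.
have S0 p : (forall x, x \in M d -> bot x != p) -> S p = 0%MM.
  move=> none; apply/mnmP => k; rewrite mnmE mnm0E; case: andP => // -[kM /eqP bk].
  by have := none _ kM; rewrite bk eqxx.
have Sdeg p : wd (S p) = deg (al p) p.
  have [[x [xM bx ax]]|[none ax]] := antichain_stateP d p; rewrite /al ax.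
    by rewrite (SU _ _ xM bx) wdegU Kg rdegE bx.
  by rewrite (S0 _ none) /move_deg subnn mul0n; apply: wd0; apply: wdegD.
have al_out (p : I) : (kap d < p)%N -> al p = p.
  move=> kp; have [[x [xM bx _]]|[_]] := antichain_stateP d p => //.
  by have /andP[] := M_kap xM; move: kp; rewrite -bx /=; lia.
rewrite /determinant (bigD1 1%g) //=; apply: lowestD.
  rewrite odd_perm1 expr0 mul1r SE; apply: lowest_prod => [s t|p]; first exact: wdegD.
  rewrite perm1 mxE; case: ifPn => [pk|]; last first.
    rewrite -ltnNge => kp; rewrite eqxx S0; first by apply: lowest1; apply: wdegD.
    by move=> x /M_kap /andP[lx _]; apply: contraTneq kp => <-; rewrite -leqNgt.
  have [[x [xM bx ->]]|[none ->]] := antichain_stateP d p.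
    by rewrite (SU _ _ xM bx) -bx; apply: unipotent_root.
  by rewrite diagU (S0 _ none); apply: lowest1; apply: wdegD.
apply: (big_ind (atleast wd _)) => [|p q|s s1]; [exact: atleast0 | exact: atleastD|].
apply: atleast_sign.
have [/existsP[p bad]|] := boolP [exists p : I, minor_mx kap Ufull antichain_state d p (s p) == 0].
  by rewrite (bigD1 p) //= (eqP bad) mul0r; apply: atleast0.
rewrite negb_exists => /forallP nz.
have s_le (p : I) : (s p <= al p)%N.
  have := nz p; rewrite mxE; case: ifPn => [pk|]; last first.
    by rewrite -ltnNge => kp; case: (p =P s p) => [<-|]; rewrite ?eqxx // (al_out p kp).
  by rewrite leqNgt; apply: contra => /lowU ->.
have s_out (p : I) : (kap d < p)%N -> s p = p.
  move=> kp; have := nz p; rewrite mxE leqNgt kp /=.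
  by case: (p =P s p) => // _; rewrite eqxx.
have gt : (wd (antichain_mon d) < \sum_p deg (al p) (s p))%N.
  have -> : wd (antichain_mon d) = (\sum_p deg (al p) p)%N.
    rewrite SE; transitivity (\sum_p wd (S p))%N; last by apply: eq_bigr => p _; exact: Sdeg.
    by elim/big_rec2: _ => [|p u v _ <-]; [apply: wd0; apply: wdegD | rewrite wdegD].
  have al_ge (p : I) : (p <= al p)%N.
    have [[x [xM <- ]]|[_]] := antichain_stateP d p; rewrite /al => -> //.
    by apply/ltnW/bot_lt_top.
  have := @rearrangement n.+1 (kap d) al _ _ s s1 s_le s_out.
  move=> rea; have {rea} : (\sum_(p : I) p * al p < \sum_(p : I) s p * al p)%N.
    apply: rea => [p|p q pq].
      rewrite /al; have [[x [xM bx ->]]|[_ ->]] := antichain_stateP d p; [right|by left].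
      by rewrite -bx top_val bot_val; have /andP[-> h] := M_kap xM; rewrite ltnS.
    rewrite /al; have [[x [xM bx ->]]|[_ -> []//]] := antichain_stateP d p.
    have [[y [yM by_ ->]]|[_ -> _ []//]] := antichain_stateP d q.
    rewrite !top_val => _ _; rewrite ltnS ltnNge; apply/negP => hxy.
    have lxy : (lo x <= lo y)%N by move: pq; rewrite -bx -by_ !bot_val; lia.
    by have := M_anti xM yM; rewrite /root_le lxy hxy => /(_ isT) xy; move: pq;
      rewrite -bx -by_ xy ltnn.
  have sumE (f : I -> nat) : (forall p, f p <= al p)%N ->
      ((\sum_p deg (al p) (f p))%:Z = \sum_(p : I) (al p)%:Z * (n.+1%:Z - (al p)%:Z)
         - n.+1%:Z * \sum_(p : I) (f p)%:Z + (\sum_(p : I) f p * al p)%N%:Z)%R.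
    move=> fle; rewrite !(big_morph Posz PoszD (erefl _)) mulr_sumr -sumrB -big_split /=.
    apply: eq_bigr => p _; have := fle p; have := ltn_ord (al p); rewrite /move_deg; nia.
  have := sumE (fun p => p) al_ge; have := sumE (fun p => s p) s_le.
  have -> : \sum_(p : I) (s p : nat)%:Z = \sum_(p : I) (p : nat)%:Z.
    by rewrite [RHS](reindex_inj (@perm_inj _ s)).
  lia.
have ap : atleast wd (\sum_p deg (al p) (s p))%N (\prod_p minor_mx kap Ufull antichain_state d p
  (s p)).
  apply: atleast_prod => [u v|p]; first exact: wdegD.
  rewrite mxE; case: ifPn => [pk|]; first exact: unipotent_atleast.
  by rewrite -ltnNge => kp u _; rewrite (s_out p kp) (al_out p kp) /move_deg subnn.
by move=> t /ap h; apply: leq_trans gt h.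
Qed.

Lemma lowest_minors : lowest wd (\sum_d antichain_mon d)%MM (minors kap Ufull antichain_state).
Proof. by apply: lowest_prod lowest_det; exact: wdegD. Qed.

End LowestDeterminants.

(** * Separating the lattice points *)

Lemma count_mem_sum (T : finType) (ks : seq T) (m : T -> nat) (P : pred T) :
  (forall k, count_mem k ks = m k) -> count P ks = (\sum_(k | P k) m k)%N.
Proof.
move=> cnt; rewrite -sum1_count (partition_big id P) //=.
apply: eq_bigr => k Pk; rewrite -cnt -sum1_count; apply: eq_bigl => k' /=.
by case: eqP => [->|]; rewrite ?Pk ?andbF.
Qed.

Section Separation.
Variables (n : nat) (K : numFieldType) (ks : seq 'I_n).
Local Notation N := (nroots n).
Variables (beta : 'I_N -> posroot n) (cf : 'I_N -> K).
Hypothesis beta_bij : bijective beta.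
Hypothesis cf0 : forall k, cf k != 0.
Let kap := tnth (in_tuple ks).

(** The coordinate at the state of an antichain decomposition of s singles out
    f^s among the monomials of degree at most that of s. *)
Lemma separating_state (m : 'I_n -> nat) (s : 'X_{1..N}) (c : posroot n -> nat) :
  sorted leq (map val ks) -> (forall k, count_mem k ks = m k) ->
  (forall k, c (beta k) = s k) ->
  (forall (i j : 'I_n) p, (i <= j)%N -> dyck_path i j p ->
     (\sum_(a <- p) c a <= \sum_(k < n | i <= k <= j) m k)%N) ->
  exists al, ordmon beta cf (@tens_unit _ _ kap K) s (tens_hw kap K) al != 0 /\
    forall t, t <> s -> (wdeg beta t <= wdeg beta s)%N ->
      ordmon beta cf (@tens_unit _ _ kap K) t (tens_hw kap K) al = 0.
Proof.
move=> srt cnt cs pol.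
have cntE (i j : 'I_n) : (\sum_(k < n | i <= k <= j) m k)%N =
    count (fun k : 'I_n => (i <= k <= j)%N) ks.
  by rewrite (count_mem_sum _ cnt).
have bnd l (i j : 'I_n) : sorted (@root_lt n) l -> all (fun x => (i <= lo x) && (hi x <= j))%N l ->
    (\sum_(x <- l) c x <= count (fun k : 'I_n => i <= k <= j) ks)%N.
  by move=> sl al; rewrite -cntE; apply: chain_bound.
have [Ms [sM Mk Ma Mc]] := antichain_decomposition srt bnd.
pose M (d : 'I_(size ks)) := nth set0 Ms d.
have M_kap d x : x \in M d -> (lo x <= kap d <= hi x)%N.
  rewrite /kap (tnth_nth (lo x)) => xM; exact: Mk (ltn_ord d) _ xM.
have M_anti d : {in M d &, forall x y, root_le x y -> x = y} by apply: Ma.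
have sE : s = (\sum_d antichain_mon beta M d)%MM.
  apply/mnmP => k; rewrite -cs Mc mnm_sumE; apply: eq_bigr => d _.
  by rewrite mnmE.
have [nz high] := lowest_minors beta_bij cf0 M_kap M_anti.
rewrite -sE in nz high.
exists (antichain_state M).
have coefE t : ordmon beta cf (@tens_unit _ _ kap K) t (tens_hw kap K) (antichain_state M) =
    (\prod_(k <- enum 'I_N) (t k)`!)%:R * (minors kap (unipotent beta cf (enum 'I_N))
      (antichain_state M))@_t.
  rewrite /ordmon -coef_unipotent ?enum_uniq // => [|k]; last by rewrite mem_enum.
  by rewrite tensZ [coef_tens _ _ _ _]ffunE.
split.
  rewrite coefE mulf_neq0 // pnatr_eq0 -lt0n prodn_gt0 // => k; exact: fact_gt0.
move=> t ts le; rewrite coefE; apply/eqP; rewrite mulf_eq0; apply/orP; right.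
by apply/eqP/eqP; apply: contraT => h; have := high _ h ts; rewrite ltnNge le.
Qed.
End Separation.

(** * Comparing a simple module with the tensor module *)

Section Relation.
Variables (n L : nat) (kap : 'I_L -> 'I_n) (K : numClosedFieldType).
Local Notation I := 'I_n.+1.
Local Notation tens := (tens n L K).
Local Notation tens_hw := (tens_hw kap K).
Local Notation tens_unit := (@tens_unit n L kap K).

(** The hermitian form for which the states are orthonormal; E_(a,b) and
    E_(b,a) are adjoint. *)
Definition form (x y : tens) : K := \sum_al x al * (y al)^*.

Lemma formDl c x x' y : form (c *: x + x') y = c * form x y + form x' y.
Proof.
rewrite /form mulr_sumr -big_split; apply: eq_bigr => al _ /=.
by rewrite ffunE tensZ mulrDl mulrA.
Qed.

Lemma formDr c x y y' : form x (c *: y + y') = c^* * form x y + form x y'.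
Proof.
rewrite /form mulr_sumr -big_split; apply: eq_bigr => al _ /=.
by rewrite ffunE tensZ rmorphD rmorphM /= mulrDr mulrCA.
Qed.

Lemma form_eq0 x : form x x = 0 -> x = 0.
Proof.
move=> x0; apply/ffunP => al; rewrite ffunE; apply/eqP; rewrite -normr_eq0.
have ge0 al' : true -> 0 <= x al' * (x al')^* by rewrite -normCK exprn_ge0.
have := psumr_eq0P ge0 x0 (i := al) isT; rewrite -normCK => /eqP.
by rewrite expf_eq0.
Qed.

Lemma form_unit_at q a b x y : form (unit_at q a b x) y = form x (unit_at q b a y).
Proof.
rewrite /form (bigID (fun al : state n L => al q == a)) /= [X in _ + X]big1 ?addr0; last first.
  by move=> al /negPf h; rewrite unit_atE h !mul0r.
rewrite [RHS](bigID (fun al : state n L => al q == b)) /= [X in _ = _ + X]big1 ?addr0; last first.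
  by move=> al /negPf h; rewrite unit_atE h mul0r rmorph0 mulr0.
rewrite (reindex_onto (fun al => upd al q a) (fun al => upd al q b)) /=; last first.
  by move=> al /eqP <-; rewrite upd_upd upd_id.
apply: eq_big => [al|al /andP[_ /eqP alE]].
  rewrite upd_same eqxx /= upd_upd; apply/eqP/eqP => [<-|<-]; [exact: upd_same | exact: upd_id].
have alq : al q = b by rewrite -alE upd_same.
by rewrite !unit_atE upd_same eqxx alE alq eqxx !mul1r.
Qed.

Lemma form_tens_unit a b x y : form (tens_unit a b x) y = form x (tens_unit b a y).
Proof.
have form_suml (r : seq (pos n L)) (P : pred (pos n L)) F z :
    form (\sum_(q <- r | P q) F q) z = \sum_(q <- r | P q) form (F q) z.
  rewrite /form exchange_big; apply: eq_bigr => al _ /=.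
  by rewrite sum_ffunE mulr_suml.
have form_sumr (r : seq (pos n L)) (P : pred (pos n L)) F z :
    form z (\sum_(q <- r | P q) F q) = \sum_(q <- r | P q) form z (F q).
  rewrite /form exchange_big; apply: eq_bigr => al _ /=.
  by rewrite sum_ffunE rmorph_sum mulr_sumr.
by rewrite form_suml form_sumr; apply: eq_bigr => q _; apply: form_unit_at.
Qed.

Lemma tens_hw_neq0 : tens_hw != 0.
Proof.
apply/eqP => /ffunP/(_ [ffun q : pos n L => q.2]); rewrite !ffunE => /eqP.
rewrite /minors big1 ?oner_eq0 // => d _; rewrite -[RHS](det1 K n.+1); congr (\det _).
by apply/matrixP => p q; rewrite !mxE ffunE; case: ifP.
Qed.

Variables (V : vectType K) (gl_unit : I -> I -> V -> V) (glV : gl_module gl_unit).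
Variables (v : V) (hwv : highest_vector gl_unit (tens_wt kap K) v) (v0 : v != 0).

(** The submodule of the direct sum of V and the tensors generated by the pair of
    highest weight vectors.  It is the graph of an isomorphism between V and the
    submodule generated by [tens_hw]; see [related_0l] and [related_0r]. *)
Inductive related : V -> tens -> Prop :=
| related_hw : related v tens_hw
| related_lin c x x' y y' : related x y -> related x' y' ->
    related (c *: x + x') (c *: y + y')
| related_low (a b : I) x y : (b < a)%N -> related x y -> related (gl_unit a b x) (tens_unit a b y).

Let glT := tens_gl_module kap K.
Let hwT := tens_hw_highest kap K.

Lemma related0 : related 0 0.
Proof.
by have := related_lin (-1) related_hw related_hw; rewrite !scaleN1r !addNr.
Qed.

Lemma relatedZ c x y : related x y -> related (c *: x) (c *: y).
Proof. by move=> xy; have := related_lin c xy related0; rewrite !addr0. Qed.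

Lemma relatedB x x' y y' : related x y -> related x' y' -> related (x - x') (y - y').
Proof.
move=> xy xy'; have := related_lin (-1) xy' xy; rewrite !scaleN1r.
by rewrite ![- _ + _]addrC.
Qed.

Let gl_unit_lin a b : linear (gl_unit a b) := gl_linear glV a b.
Let tens_unit_lin a b : linear (tens_unit a b) := gl_linear glT a b.
HB.instance Definition _ a b := GRing.isLinear.Build K V V *:%R (gl_unit a b) (gl_unit_lin a b).
HB.instance Definition _ a b := GRing.isLinear.Build K tens tens *:%R (tens_unit a b)
  (tens_unit_lin a b).

(** Closure under lowering units is part of the definition; for the others,
    commute them past the lowering units down to the highest weight vectors. *)
Lemma related_unit a b x y : related x y -> related (gl_unit a b x) (tens_unit a b y).
Proof.
move=> xy; elim: xy a b => [|c x1 x2 y1 y2 _ IH1 _ IH2|c d x1 y1 dc r1 IH] a b.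
- have [ab|ba|/val_inj <-] := ltngtP a b.
  + by rewrite (hw_up hwv) // (hw_up hwT) //; apply: related0.
  + exact: related_low related_hw.
  + by rewrite (hw_diag hwv) (hw_diag hwT); apply: relatedZ related_hw.
- by rewrite !linearP; apply: related_lin; [apply: IH1 | apply: IH2].
- have -> : gl_unit a b (gl_unit c d x1) = gl_unit c d (gl_unit a b x1) +
      ((b == c)%:R *: gl_unit a d x1 - (d == a)%:R *: gl_unit c b x1).
    by apply/eqP; rewrite addrC -subr_eq (gl_comm glV).
  have -> : tens_unit a b (tens_unit c d y1) = tens_unit c d (tens_unit a b y1) +
      ((b == c)%:R *: tens_unit a d y1 - (d == a)%:R *: tens_unit c b y1).
    by apply/eqP; rewrite addrC -subr_eq (gl_comm glT).
  rewrite -[X in related (X + _)]scale1r -[X in related _ (X + _)]scale1r.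
  apply: related_lin; first exact: related_low.
  by apply: relatedB; apply: relatedZ.
Qed.

(** An element of the Cartan subalgebra whose eigenvalue strictly increases under
    every lowering unit; it separates the highest weight line from the rest. *)
Let H x : V := \sum_(a < n.+1) (a : nat)%:R *: gl_unit a a x.
Let lam0 : K := \sum_(a < n.+1) (a : nat)%:R * tens_wt kap K a.
Let eig (r : nat) x : Prop := H x = (lam0 + r%:R) *: x.
Let lower x := exists2 r, (0 < r)%N & eig r x.

Let H_lin c x y : H (c *: x + y) = c *: H x + H y.
Proof.
rewrite /H scaler_sumr -big_split; apply: eq_bigr => a _ /=.
by rewrite linearP scalerDr !scalerA mulrC.
Qed.

Let H_v : H v = lam0 *: v.
Proof.
rewrite /H scaler_suml; apply: eq_bigr => a _.
by rewrite (hw_diag hwv) scalerA.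
Qed.

Let H_unit (a b : I) x : H (gl_unit a b x) = gl_unit a b (H x) + (a%:R - b%:R) *: gl_unit a b x.
Proof.
rewrite /H linear_sum.
have -> : (a%:R - b%:R : K) *: gl_unit a b x =
    \sum_(c < n.+1) (c : nat)%:R *: ((c == a)%:R *: gl_unit c b x - (b == c)%:R *: gl_unit a c x).
  under eq_bigr do rewrite scalerBr.
  rewrite sumrB scalerBl; congr (_ - _).
    rewrite (bigD1 a) //= eqxx scale1r big1 ?addr0 // => c /negPf ->.
    by rewrite scale0r scaler0.
  rewrite (bigD1 b) //= eqxx scale1r big1 ?addr0 // => c; rewrite eq_sym => /negPf ->.
  by rewrite scale0r scaler0.
rewrite -big_split; apply: eq_bigr => c _ /=.
by rewrite linearZ -scalerDr -(gl_comm glV) addrC subrK.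
Qed.

Let lower_unit (a b : I) x : (b < a)%N -> lspan lower x -> lspan lower (gl_unit a b x).
Proof.
move=> ba; apply: (lspan_map (gl_unit_lin a b)) => y [r r0 ey]; apply: lspan_mem.
exists (r + (a - b))%N; first by lia.
rewrite /eig H_unit ey linearZ -scalerDl natrD natrB; last exact: ltnW.
by congr (_ *: _); rewrite !addrA.
Qed.

Let lower_unit_v (a b : I) : (b < a)%N -> lspan lower (gl_unit a b v).
Proof.
move=> ba; apply: lspan_mem; exists (a - b)%N; first by rewrite subn_gt0.
by rewrite /eig H_unit H_v linearZ -scalerDl natrB // ltnW.
Qed.

(** A product of factors H - r kills the given combination of eigenvectors but
    acts on v by a nonzero scalar. *)
Let lower_v c : lspan lower (c *: v) -> c = 0.
Proof.
pose op (rs : seq nat) x := foldr (fun r u => H u - (lam0 + r%:R) *: u) x rs.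
have op_lin rs c' x y : op rs (c' *: x + y) = c' *: op rs x + op rs y.
  elim: rs => //= r rs ->; rewrite H_lin scalerDr scalerBr opprD !scalerA.
  by rewrite [_ * c']mulrC addrACA.
have op_eig rs r x : eig r x -> op rs x = (\prod_(r' <- rs) (r%:R - r'%:R)) *: x.
  move=> ex; elim: rs => /= [|r' rs ->]; first by rewrite big_nil scale1r.
  set p := \prod_(_ <- rs) _; have -> : H (p *: x) = p *: H x.
    have := H_lin p x 0; have : H 0 = 0.
      by have := H_lin (-1) 0 0; rewrite scaleN1r addNr scaleN1r addNr.
    by move=> ->; rewrite !addr0.
  rewrite ex !scalerA -scalerBl big_cons -/p; congr (_ *: _).
  by rewrite [_ * p]mulrC -mulrBr mulrC; congr (_ * _); rewrite opprD addrACA subrr add0r.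
have kill x : lspan lower x -> exists2 rs, all (fun r => 0 < r)%N rs & op rs x = 0.
  elim=> [|c' x1 x2 [r r0 e1] _ [rs rs0 e2]]; first by exists [::].
  exists (r :: rs); first by rewrite /= r0.
  rewrite op_lin (op_eig _ _ _ e1) big_cons subrr mul0r scale0r scaler0 add0r /= e2 scaler0 subr0.
  by have := H_lin (-1) 0 0; rewrite scaleN1r addNr scaleN1r addNr.
case/kill => rs rs0; rewrite (op_eig _ 0%N); last first.
  by rewrite /eig addr0 -[c *: v]addr0 H_lin H_v; have := H_lin (-1) 0 0;
    rewrite scaleN1r addNr scaleN1r addNr => ->; rewrite !addr0 !scalerA mulrC.
move/eqP; rewrite scalerA scaler_eq0 (negPf v0) orbF mulf_eq0 => /orP[|/eqP //].
rewrite prodf_seq_eq0 => /hasP[r /(allP rs0) r0 /=].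
by rewrite sub0r oppr_eq0 pnatr_eq0; case: r r0.
Qed.

(** Both components have the same coefficient along the highest weight line: in
    V modulo lower weights, in the tensors by projecting onto [tens_hw]. *)
Let related_hwcoef x y : related x y ->
  exists c, lspan lower (x - c *: v) /\ form y tens_hw = c * form tens_hw tens_hw.
Proof.
elim=> [|c x1 x2 y1 y2 _ [c1 [l1 f1]] _ [c2 [l2 f2]]|a b x1 y1 ba _ [c [l1 f1]]].
- by exists 1; rewrite scale1r subrr mul1r; split=> //; apply: lspan0.
- exists (c * c1 + c2); split; last by rewrite formDl f1 f2 mulrDl mulrA.
  rewrite scalerDl opprD addrACA -scalerA -scalerBr; apply: lspanD => //.
  exact: lspanZ.
- exists 0; split; last first.
    rewrite form_tens_unit (hw_up hwT) // mul0r /form big1 // => al _.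
    by rewrite ffunE rmorph0 mulr0.
  rewrite scale0r subr0 -[x1](subrK (c *: v)) linearD.
  by apply: lspanD; [apply: lower_unit | rewrite linearZ; apply/lspanZ/lower_unit_v].
Qed.

(** If 0 is related to y then y is orthogonal to [tens_hw], and, passing to the
    adjoint, to every tensor that is related to something; in particular to
    itself. *)
Lemma related_0l y : related 0 y -> y = 0.
Proof.
have hw0 z : related 0 z -> form z tens_hw = 0.
  case/related_hwcoef => c []; rewrite sub0r -scaleNr => /lower_v/eqP.
  by rewrite oppr_eq0 => /eqP -> ->; rewrite mul0r.
have orth x' y' : related x' y' -> forall z, related 0 z -> form z y' = 0.
  elim=> [|c x1 x2 y1 y2 _ IH1 _ IH2|a b x1 y1 _ _ IH] z rz.
  - exact: hw0.
  - by rewrite formDr IH1 // IH2 // mulr0 addr0.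
  - by rewrite -form_tens_unit IH //; have := related_unit b a rz; rewrite linear0.
by move=> ry; apply: form_eq0; apply: (orth _ _ ry).
Qed.

(** A subspace given by a predicate is enlarged one vector at a time, until the
    dimension stops it. *)
Lemma vspace_of_pred (P : V -> Prop) : P 0 ->
  (forall c x y, P x -> P y -> P (c *: x + y)) ->
  exists U : {vspace V}, forall x, x \in U <-> P x.
Proof.
move=> P0 Plin.
have memP (U : {vspace V}) (x : V) : (forall y, y \in U -> P y) -> P x ->
    forall y, y \in (U + <[x]>)%VS -> P y.
  move=> UP Px y /memv_addP[u uU [w /vlineP[c ->] ->]].
  by rewrite addrC; apply: Plin => //; apply: UP.
have grow r : (exists U : {vspace V}, forall x, x \in U <-> P x) \/
    exists U : {vspace V}, (r <= \dim U)%N /\ forall x, x \in U -> P x.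
  elim: r => [|r [|[U [rU UP]]]]; [right|by left|].
    by exists 0%VS; split=> // x; rewrite memv0 => /eqP ->.
  have [[x [Px xU]]|none] := boolp.pselect (exists x, P x /\ x \notin U).
    right; exists (U + <[x]>)%VS; split; last exact: memP.
    apply: leq_ltn_trans rU _; rewrite ltn_neqAle dimvS ?addvSl // andbT.
    apply: contra xU => /eqP e; rewrite (_ : U = U + <[x]>)%VS.
      by apply: (subvP (addvSr _ _)); apply: memv_line.
    by apply/eqP; rewrite eqEdim addvSl -e leqnn.
  left; exists U => x; split=> [|Px]; first exact: UP.
  by apply: contraT => xU; case: none; exists x.
have [//|[U [dU _]]] := grow (\dim {:V}).+1.
by have := dimvS (subvf U); rewrite leqNgt dU.
Qed.

Hypothesis simpleV : forall U : {vspace V},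
  (forall a b x, x \in U -> gl_unit a b x \in U) -> U = 0%VS \/ U = fullv.

(** The vectors related to 0 form a submodule.  It does not contain v, because
    the coefficient along the highest weight line would be both 1 and 0; so it is
    zero by simplicity. *)
Lemma related_0r x : related x 0 -> x = 0.
Proof.
have [U UP] : exists U : {vspace V}, forall z, z \in U <-> related z 0.
  apply: vspace_of_pred; first exact: related0.
  by move=> c z1 z2 r1 r2; have := related_lin c r1 r2; rewrite scaler0 addr0.
have [|U0|Uf] := simpleV (U := U).
- by move=> a b z /UP rz; apply/UP; have := related_unit a b rz; rewrite linear0.
- by move/UP; rewrite U0 memv0 => /eqP.
- have /related_hwcoef[c [lv /esym/eqP]] : related v 0 by apply/UP; rewrite Uf memvf.
  have -> : form 0 tens_hw = 0 by rewrite /form big1 // => al _; rewrite ffunE mul0r.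
  rewrite mulf_eq0 => /orP[/eqP c0|/eqP/form_eq0/eqP]; last by rewrite (negPf tens_hw_neq0).
  by move: lv; rewrite c0 scale0r subr0 -[v]scale1r => /lower_v/eqP; rewrite oner_eq0.
Qed.

Variables (beta : 'I_(nroots n) -> posroot n) (cf : 'I_(nroots n) -> K).

Lemma related_ordmon t : related (ordmon beta cf gl_unit t v) (ordmon beta cf tens_unit t tens_hw).
Proof.
rewrite !ordmonE //; apply: relatedZ; elim: mon_word => [|[a b] l IH] /=.
  exact: related_hw.
exact: related_unit.
Qed.

Lemma mons_le_transfer k W t :
  mons_le beta cf tens_unit tens_hw k W (ordmon beta cf tens_unit t tens_hw) ->
  mons_le beta cf gl_unit v k W (ordmon beta cf gl_unit t v).
Proof.
move=> mT; have [x mx rx] : exists2 x, mons_le beta cf gl_unit v k W x &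
    related x (ordmon beta cf tens_unit t tens_hw).
  elim: mT => [|c y y' [s ws ->] _ [x mx rx]]; first by exists 0; [left | exact: related0].
  exists (c *: ordmon beta cf gl_unit s v + x).
    by apply: lspan_cons mx; exists s.
  by apply: related_lin rx; apply: related_ordmon.
have := relatedB (related_ordmon t) rx; rewrite subrr => /related_0r/eqP.
by rewrite subr_eq0 => /eqP ->.
Qed.

End Relation.

(** * Extending a module of traceless matrices to all matrices *)

Section GlExtension.
Variables (K : numFieldType) (n : nat) (m : 'I_n -> nat).
Variables (V : vectType K) (rho : 'M[K]_n.+1 -> 'End(V)) (v : V).
Local Notation I := 'I_n.+1.
Hypothesis sl_rho : sl_module rho.
Hypothesis hwv : highest_weight_vector rho m v.

Definition sl_part (x : 'M[K]_n.+1) : 'M[K]_n.+1 := x - (\tr x / n.+1%:R)%:M.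
Definition rho_sl (x : 'M[K]_n.+1) : 'End(V) := rho (sl_part x).
(** The identity matrix is made to act by the sum of the m_i (i + 1), the number
    of acting positions of the tensor module; this is its share for each
    diagonal unit. *)
Definition central_weight : K := (\sum_(i < n) m i * i.+1)%N%:R / n.+1%:R.
Definition gl_unit (a b : I) (u : V) : V :=
  rho_sl (delta_mx a b) u + ((a == b)%:R * central_weight) *: u.

Let n1 : n.+1%:R != 0 :> K. Proof. by rewrite pnatr_eq0. Qed.

Lemma sl_partP x : in_sl (sl_part x).
Proof.
by rewrite /in_sl /sl_part mxtraceD raddfN /= mxtrace_scalar -[_ / _ *+ _]mulr_natr divfK // subrr.
Qed.

Lemma sl_part_id x : in_sl x -> sl_part x = x.
Proof. by rewrite /in_sl /sl_part => ->; rewrite mul0r raddf0 subr0. Qed.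

Lemma sl_part_linear : linear sl_part.
Proof.
move=> c x y; rewrite /sl_part linearP /= mulrDl -mulrA raddfD /= -scale_scalar_mx.
by rewrite scalerBr opprD addrACA.
Qed.
HB.instance Definition _ := GRing.isLinear.Build K 'M[K]_n.+1 'M[K]_n.+1 *:%R sl_part
  sl_part_linear.

Lemma rho_linear c x y : in_sl x -> in_sl y -> rho (c *: x + y) = c *: rho x + rho y.
Proof. by case: sl_rho => h _; apply: h. Qed.

Lemma rho_sl_linear : linear rho_sl.
Proof. by move=> c x y; rewrite /rho_sl linearP rho_linear //; apply: sl_partP. Qed.
HB.instance Definition _ := GRing.isLinear.Build K 'M[K]_n.+1 'End(V) *:%R rho_sl rho_sl_linear.

Lemma sl_part_lie x y : lie (sl_part x) (sl_part y) = lie x y.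
Proof.
rewrite /lie /sl_part; set p := _%:M; set q := (_ / _)%:M.
have px z : p *m z = z *m p by rewrite /p mul_scalar_mx mul_mx_scalar.
have qx z : q *m z = z *m q by rewrite /q mul_scalar_mx mul_mx_scalar.
rewrite !mulmxBl !mulmxBr !qx !px.
have cancel4 (A B C D E : 'M[K]_n.+1) : A - B - (C - D) - (E - C - (B - D)) = A - E.
  rewrite [E - C - _](_ : _ = E - B - (C - D));
    last by rewrite !opprB ![_ + (D - _)]addrACA [- C - B]addrC.
  by rewrite -[A - B - _]addrA -[E - B - _]addrA [- (E + _)]opprD addrACA subrr addr0.
exact: cancel4.
Qed.

Lemma lie_delta (a b c d : I) : lie (delta_mx a b) (delta_mx c d) =
  (b == c)%:R *: delta_mx a d - (d == a)%:R *: delta_mx c b :> 'M[K]_n.+1.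
Proof. by rewrite /lie !mul_delta_mx_cond -!scaler_nat. Qed.

Lemma in_sl_lie x y : in_sl (lie x y : 'M[K]_n.+1).
Proof. by rewrite /in_sl /lie mxtraceD raddfN /= [X in _ - X]mxtrace_mulC subrr. Qed.

Lemma gl_unit_module : gl_module gl_unit.
Proof.
split=> [a b c x y|a b c d u].
  rewrite /gl_unit; set k := _ * central_weight.
  by rewrite linearP [k *: _]scalerDr [k *: (c *: x)]scalerA [k * c]mulrC -scalerA scalerDr addrACA.
rewrite /gl_unit; set ca := (a == b)%:R * _; set cc := (c == d)%:R * _.
set A := rho_sl (delta_mx a b); set B := rho_sl (delta_mx c d).
have -> : A (B u + cc *: u) + ca *: (B u + cc *: u) - (B (A u + ca *: u) + cc *: (A u + ca *: u)) =
   rho (lie (sl_part (delta_mx a b)) (sl_part (delta_mx c d))) u.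
  case: sl_rho => _ ->; try exact: sl_partP.
  rewrite -/(rho_sl _) -/(rho_sl _) -/A -/B.
  have D (F : 'End(V)) c' x y : F (x + c' *: y) = F x + c' *: F y.
    by rewrite linearD linearZ.
  rewrite !D !scalerDr !scalerA [cc * ca]mulrC.
  have shuffle (P s t r Q : V) : P + s + (t + r) - (Q + t + (s + r)) = P - Q.
    by rewrite [Q + t + _]addrACA -[P + s + _]addrA -[Q + s + _]addrA [- (Q +
      _)]opprD addrACA subrr addr0.
  exact: shuffle.
rewrite sl_part_lie -(sl_part_id (in_sl_lie _ _)) lie_delta -/(rho_sl _) linearB /= add_lfunE
  opp_lfunE.
rewrite ![rho_sl (_ *: _)]linearZ !scale_lfunE !scalerDr !scalerA.
have -> : (b == c)%:R * ((a == d)%:R * central_weight) =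
  (d == a)%:R * ((c == b)%:R * central_weight).
  by rewrite !mulrA (eq_sym d a) (eq_sym c b) [(b == c)%:R * _]mulrC.
by rewrite opprD addrACA subrr addr0.
Qed.

Lemma root_val_tele (x : posroot n) (h : 'M[K]_n.+1) :
  root_val x h = h (bot x) (bot x) - h (top x) (top x).
Proof.
pose F (k : nat) : K := - h (inord k) (inord k).
have inordE (k : nat) (a : I) : k = a -> inord k = a by move=> ->; apply: inord_val.
transitivity (\sum_(lo x <= k < (hi x).+1) (F k.+1 - F k)).
  rewrite (big_nat_widen _ _ n) ?ltn_ord // big_geq_mkord; apply: eq_big => [k|k _].
    by rewrite /= ltnS andbC.
  rewrite /simple_root /F opprK [RHS]addrC; congr (_ - _).
    by rewrite (inordE _ (widen_ord (leqnSn n) k)).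
  by rewrite (inordE _ (lift ord0 k)).
rewrite telescope_sumr; last exact/leqW/lo_le_hi.
rewrite /F opprK addrC (inordE _ (bot x)) // (inordE _ (top x)) //.
Qed.

(** Test the eigenvalue equation on h = E_(i,i) - E_(j,j): if the entry at
    (i, j) is nonzero, the bracket with h multiplies it by 2, so the root has
    value -2 on h, which leaves only (i, j) = (top, bot). *)
Lemma neg_root_vectorE (x : posroot n) (f : 'M[K]_n.+1) : neg_root_vector x f ->
  exists2 c, c != 0 & f = c *: delta_mx (top x) (bot x).
Proof.
move=> [f0 fminus feig].
have ent (i j : I) : f i j != 0 -> (i == top x) && (j == bot x).
  move=> fij; have [ij|ji] := leqP i j; first by rewrite fminus ?eqxx in fij.
  have nij : (i == j) = false by apply: gtn_eqF.
  pose h : 'M[K]_n.+1 := delta_mx i i - delta_mx j j.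
  have hE p q : h p q = (p == q)%:R * ((p == i)%:R - (p == j)%:R).
    rewrite !mxE; case: (p =P q) => [->|pq]; first by rewrite !andbb mul1r.
    rewrite mul0r; case: (p =P i) => [pi|_]; case: (p =P j) => [pj|_] /=; rewrite ?subr0 //.
    - by move: nij; rewrite -pi -pj eqxx.
    - by rewrite -pi eq_sym (introF eqP pq) ?subr0.
    - by rewrite -pj eq_sym (introF eqP pq) ?subr0 ?oppr0.
  have hcartan : in_cartan h.
    split; first by apply/is_diag_mxP => p q /negbTE pq; rewrite hE [p == q]pq mul0r.
    rewrite /in_sl /mxtrace; under eq_bigr do rewrite hE eqxx mul1r.
    rewrite sumrB (bigD1 i) //= [X in _ - X](bigD1 j) //= !eqxx !big1 ?addr0 ?subrr //.
      by move=> p /negPf ->.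
    by move=> p /negPf ->.
  have := congr1 (fun A : 'M[K]_n.+1 => A i j) (feig h hcartan).
  rewrite /lie !mxE root_val_tele.
  rewrite (bigD1 i) //= [X in _ + X - _]big1 ?addr0; last first.
    by move=> p pi; rewrite hE eq_sym (negPf pi) !mul0r.
  rewrite (bigD1 j) //= [X in _ - (_ + X)]big1 ?addr0; last first.
    by move=> p pj; rewrite hE (negPf pj) mul0r mulr0.
  rewrite [f i j * _]mulrC -mulrBl => /(mulIf fij); rewrite !hE !eqxx !mul1r nij (eq_sym j i) nij.
  rewrite subr0 sub0r opprK => /eqP.
  rewrite -subr_eq0 opprK !opprB !addrA => /eqP e.
  have {e} : (2 + (bot x == i) + (top x == j))%N%:R = ((bot x == j) + (top x == i))%N%:R :> K.
    apply/eqP; rewrite -subr_eq0 !natrD -e opprD !addrA; apply/eqP.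
    by rewrite (_ : true%:R = 1 :> K) //; ring.
  move/eqP; rewrite eqr_nat (eq_sym i) (eq_sym j).
  by case: (top x == i); case: (bot x == j); case: (bot x == i); case: (top x == j).
have fE : f = f (top x) (bot x) *: delta_mx (top x) (bot x).
  apply/matrixP => i j; rewrite !mxE; case: (boolP (_ && _)) => [/andP[/eqP -> /eqP ->]|].
    by rewrite mulr1.
  by move=> nij; rewrite mulr0; apply/eqP; apply: contraNT nij; apply: ent.
exists (f (top x) (bot x)) => //.
by apply: contraNneq f0 => e; rewrite fE e scale0r.
Qed.

Lemma in_sl_delta (a b : I) : a != b -> in_sl (delta_mx a b : 'M[K]_n.+1).
Proof.
move=> ab; rewrite /in_sl /mxtrace big1 // => i _; rewrite mxE.
by case: (i =P a) => [->|] //=; rewrite (negPf ab).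
Qed.

Lemma gl_unit_off (a b : I) u : a != b -> gl_unit a b u = rho (delta_mx a b) u.
Proof.
move=> ab; rewrite /gl_unit /rho_sl (negPf ab) mul0r scale0r addr0 sl_part_id //.
exact: in_sl_delta.
Qed.

(** With the chosen action of the identity, the weight at index a is the natural
    number m_a + ... + m_(n-1), the same as for the tensor module. *)
Lemma gl_unit_highest :
  highest_vector gl_unit (fun a : I => (\sum_(i < n | (a <= i)%N) m i)%N%:R) v.
Proof.
case: hwv => v0 up cart; split=> [a b ab|a].
  rewrite gl_unit_off ?neq_ltn ?ab // up // => i j ji; rewrite mxE.
  by case: eqP => //= ia; case: eqP => //= jb; move: ji; rewrite ia jb; lia.
rewrite /gl_unit /rho_sl eqxx mul1r; set h := sl_part _.
have hE (k : I) : h k k = (k == a)%:R - n.+1%:R^-1.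
  rewrite !mxE andbb eqxx mulr1n (_ : \tr _ = 1) ?mul1r //.
  rewrite /mxtrace (bigD1 a) //= mxE !eqxx big1 ?addr0 // => k' /negPf nk.
  by rewrite mxE nk.
rewrite cart; last first.
  split; last exact: sl_partP.
  apply/is_diag_mxP => p q pq; rewrite !mxE.
  have -> : (p == q) = false by apply: negbTE pq.
  rewrite mulr0n subr0; case: (p =P a) => [pa|] //=; case: (q =P a) => // qa.
  by rewrite pa qa eqxx in pq.
rewrite -scalerDl; congr (_ *: _); rewrite /weight_val /central_weight.
rewrite !natr_sum [X in _ = X]big_mkcond /= mulr_suml -big_split /=; apply: eq_bigr => i _.
have -> : fund_weight i h = (a <= i)%N%:R - i.+1%:R / n.+1%:R.
  rewrite /fund_weight; under eq_bigr do rewrite hE.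
  rewrite sumrB sumr_const; congr (_ - _).
    case: leqP => [ai|ia]; last first.
      by rewrite big1 // => k ki; case: eqP => // ka; move: ki; rewrite ka; lia.
    by rewrite (bigD1 a) //= eqxx big1 ?addr0 // => k /andP[_ /negPf ->].
  rewrite -[LHS]mulr_natl; congr (_%:R * _); rewrite -sum1_card.
  rewrite (eq_bigl (fun k : I => (k < i.+1)%N)); last by move=> k; rewrite unfold_in /= ltnS.
  rewrite -(big_ord_widen n.+1 (fun=> 1%N)); first by rewrite sum_nat_const card_ord muln1.
  by apply: leqW; apply: ltn_ord.
rewrite mulrBr natrM -mulrA subrK.
by case: leqP; rewrite ?mulr1 ?mulr0.
Qed.

Lemma gl_unit_simple : simple_module rho -> forall U : {vspace V},
  (forall a b x, x \in U -> gl_unit a b x \in U) -> U = 0%VS \/ U = fullv.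
Proof.
case=> _ _ simple U stab; apply: simple => x u xsl uU.
rewrite -(sl_part_id xsl) -/(rho_sl _) (matrix_sum_delta x).
rewrite linear_sum sum_lfunE; apply: memv_suml => a _.
rewrite linear_sum sum_lfunE; apply: memv_suml => b _.
rewrite linearZ scale_lfunE; apply: memvZ.
by have := memvB (stab a b u uU) (memvZ ((a == b)%:R * central_weight) uU); rewrite addrK.
Qed.

End GlExtension.

(** * Lattice points and Dyck paths *)

Section LatticePoints.
Variables (n : nat) (m : 'I_n -> nat) (beta : 'I_(nroots n) -> posroot n).
Variable g : posroot n -> 'I_(nroots n).
Hypotheses (gK : cancel beta g) (Kg : cancel g beta).

Definition nat_point (s : 'X_{1..nroots n}) : Prop :=
  forall (i j : 'I_n) p, (i <= j)%N -> dyck_path i j p ->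
    (\sum_(a <- p) s (g a) <= \sum_(k < n | i <= k <= j) m k)%N.

Lemma lattice_pointE (R : numDomainType) s : lattice_point beta R m s <-> nat_point s.
Proof.
split=> [[x [x0 xp] xs] i j p ij dp|sp].
  have xE a : x a = (s (g a))%:R by rewrite -xs Kg.
  by have := xp i j p ij dp; rewrite (eq_bigr _ (fun a _ => xE a)) -natr_sum ler_nat.
exists (fun a => (s (g a))%:R) => [|k]; last by rewrite gK.
by split=> [a|i j p ij dp]; rewrite ?ler0n // -natr_sum ler_nat; apply: sp.
Qed.

Lemma nat_pointD s t : nat_point (s + t)%MM -> nat_point t.
Proof.
move=> st i j p ij dp; apply: leq_trans (st i j p ij dp); apply: leq_sum => a _.
by rewrite mnmDE leq_addl.
Qed.

Lemma dyck_path_uniq i j (p : seq (posroot n)) : dyck_path i j p -> uniq p.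
Proof.
case: p => // x p /and3P[_ pp _]; apply: (sorted_uniq (@root_lt_trans n)).
  by move=> y; rewrite /root_lt eqxx.
by apply: sub_path pp => u w; apply: dyck_step_lt.
Qed.

(** The violated inequality only concerns the part of s on one Dyck path. *)
Lemma nat_point_violation s : ~ nat_point s -> exists (i j : 'I_n) p (t : 'X_{1..nroots n}),
  [/\ dyck_path i j p, forall k, t k != 0%N -> beta k \in p,
      (\sum_(k < n | i <= k <= j) m k < \sum_k t k)%N & exists t', s = (t' + t)%MM].
Proof.
move=> nsp; have [i [j [p [ij dp big_p]]]] : exists (i j : 'I_n) p,
    [/\ (i <= j)%N, dyck_path i j p & (\sum_(k < n | i <= k <= j) m k < \sum_(a <- p) s (g a))%N].
  apply: boolp.contrapT => none; apply: nsp => i j p ij dp.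
  by rewrite leqNgt; apply/negP => lt; apply: none; exists i, j, p.
exists i, j, p, [multinom (if beta k \in p then s k else 0%N) | k < nroots n]; split=> //.
- by move=> k; rewrite mnmE; case: ifP.
- apply: leq_trans big_p _; rewrite big_uniq ?(dyck_path_uniq dp) //.
  rewrite (reindex_onto beta g) /= => [|a _]; last exact: Kg.
  rewrite big_mkcond /= leq_sum // => k _; rewrite mnmE gK eqxx andbT.
  by case: (_ \in p).
- exists [multinom (if beta k \in p then 0%N else s k) | k < nroots n].
  by apply/mnmP => k; rewrite mnmDE !mnmE; case: ifP; rewrite ?addn0.
Qed.

(** The list of the kap d: the index k occurs m_k times.  Its order is used in
    peeling off the antichains. *)
Lemma weight_seq : exists2 ks : seq 'I_n,
  sorted leq (map val ks) & forall k, count_mem k ks = m k.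
Proof.
exists (sort (relpre val leq) (flatten [seq nseq (m k) k | k <- enum 'I_n])).
  by rewrite sorted_map; apply: sort_sorted => x y; apply: leq_total.
move=> k; rewrite (seq.permP (permEl (perm_sort _ _))) count_flatten -map_comp sumnE big_map.
rewrite big_enum (bigD1 k) //= count_nseq /= eqxx mul1n big1 ?addn0 // => k' /negPf nk.
by rewrite count_nseq /= nk.
Qed.

End LatticePoints.

Lemma spanningP (K : fieldType) (W : lmodType K) (T : eqType) (S : T -> Prop) (b : T -> W) w :
  lspan (fun y => exists2 s, S s & y = b s) w ->
  exists (r : seq T) (c : T -> K), (forall s, s \in r -> S s) /\ w = \sum_(s <- r) c s *: b s.
Proof.
move=> Sw; suff [r [c [_ rS wE]]] : exists (r : seq T) (c : T -> K),
    [/\ uniq r, forall s, s \in r -> S s & w = \sum_(s <- r) c s *: b s] by exists r, c.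
elim: Sw => [|d x y [s sS ->] _ [r [c [ur rS ->]]]].
  by exists [::], (fun=> 0); split=> //; rewrite big_nil.
have [sr|sr] := boolP (s \in r).
  exists r, (fun t => if t == s then d + c s else c t); split=> //.
  rewrite (bigD1_seq s) //= [RHS](bigD1_seq s) //= eqxx scalerDl addrA; congr (_ + _).
  by apply: eq_bigr => t /negPf ->.
exists (s :: r), (fun t => if t == s then d else c t); split.
- by rewrite /= sr.
- by move=> t /predU1P[->|/rS].
rewrite big_cons eqxx; congr (_ + _); apply: eq_big_seq => t tr.
by case: eqP => // ts; rewrite -ts tr in sr.
Qed.

Lemma sum_tnth (T : finType) (ks : seq T) (P : pred T) :
  (\sum_d P (tnth (in_tuple ks) d) = count P ks)%N.
Proof.
rewrite -sum1_count [RHS]big_mkcond -[X in _ = (\sum_(_ <- X) _)%N]/(tval (in_tuple ks)).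
by rewrite [RHS]big_tuple; apply: eq_bigr => d _; case: (P _).
Qed.

(** * The associated graded module *)

Section GradedModule.
Variables (K : numClosedFieldType) (n : nat) (m : 'I_n -> nat).
Variables (V : vectType K) (rho : 'M[K]_n.+1 -> 'End(V)) (v : V).
Variables (f : posroot n -> 'M[K]_n.+1) (beta : 'I_(nroots n) -> posroot n).
Local Notation N := (nroots n).
Local Notation I := 'I_n.+1.
Implicit Types (s t : 'X_{1..N}).
Hypotheses (simple_rho : simple_module rho) (hwv : highest_weight_vector rho m v).
Hypothesis f_root : forall a, neg_root_vector a (f a).
Variable g : posroot n -> 'I_N.
Hypotheses (gK : cancel beta g) (Kg : cancel g beta).

Let sl_rho : sl_module rho. Proof. by case: simple_rho. Qed.
Let beta_bij : bijective beta. Proof. by exists g. Qed.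
Let cf k : K := f (beta k) (top (beta k)) (bot (beta k)).
Local Notation E := (gl_unit m rho).
Local Notation F := (ordmon beta cf E).
Local Notation wd := (wdeg beta).
Local Notation point := (nat_point m g).
Local Notation filt W := (mons_le beta cf E v 1 W).
Let glE : gl_module E := gl_unit_module m sl_rho.
Let hwE := gl_unit_highest hwv.

Let fE k : cf k != 0 /\ f (beta k) = cf k *: delta_mx (top (beta k)) (bot (beta k)).
Proof.
rewrite /cf; have [c c0 ->] := neg_root_vectorE (f_root (beta k)).
by rewrite !mxE !eqxx mulr1.
Qed.
Let cf0 k : cf k != 0. Proof. by case: (fE k). Qed.

Lemma fmonE s u : fmon rho f beta s u = F s u.
Proof.
rewrite /fmon /ordmon; elim: (enum _) => //= k l ->; apply: eq_iter => x.
have [_ ->] := fE k; rewrite gl_unit_off; last by rewrite neq_ltn bot_lt_top orbT.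
have sl0 : in_sl (0 : 'M[K]_n.+1) by rewrite /in_sl raddf0.
have rho0 : rho 0 = 0.
  have := rho_linear sl_rho (-1) sl0 sl0.
  by rewrite scaler0 addr0 scaleN1r addNr.
have sld : in_sl (delta_mx (top (beta k)) (bot (beta k)) : 'M[K]_n.+1).
  by apply: in_sl_delta; rewrite neq_ltn bot_lt_top orbT.
by have := rho_linear sl_rho (cf k) sld sl0; rewrite rho0 !addr0 => ->; rewrite scale_lfunE.
Qed.

Let F_linear s : linear (F s).
Proof. by move=> c x y; rewrite !ordmonE // (word_linear glE) scalerDr !scalerA mulrC. Qed.

Lemma wdeg_ge_mdeg s : (mdeg s <= wd s)%N.
Proof.
rewrite mdegE /wdeg leq_sum // => k _; rewrite leq_pmulr // /rdeg muln_gt0 /=.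
by rewrite subn_gt0 ltn_ord.
Qed.

Lemma pbw_filtE k u : u \in pbw_filt rho f beta v k <-> filt k%:Z u.
Proof.
split=> [|]; last first.
  elim=> [|c x y [s ws ->] _ IH]; first exact: mem0v.
  apply: memvD IH; apply: memvZ; rewrite mul1n lez_nat in ws.
  have bs : (mdeg s < k.+1)%N by rewrite ltnS (leq_trans (wdeg_ge_mdeg s)).
  apply: (subvP (sumv_sup (BMultinom bs) _ (subvv _))) => //=.
  by rewrite fmonE memv_line.
rewrite /pbw_filt => /memv_sumP[us uP ->]; apply: lspan_sum => s ws.
have /vlineP[c ->] := uP s ws; apply: lspanZ; apply: lspan_mem.
by exists (s : 'X_{1..N}); rewrite ?mul1n ?fmonE.
Qed.

Lemma filt_predE k u : u \in filt_pred (pbw_filt rho f beta v) k <-> filt (k%:Z - 1) u.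
Proof.
case: k => [|k] /=; last by rewrite pbw_filtE; split; apply: mons_leS; lia.
rewrite memv0; split=> [/eqP ->|]; first by left.
by elim=> // c x y [s ws _] _ _; move: ws; rewrite mul1n; lia.
Qed.

Lemma tensor_weight ks : (forall k, count_mem k ks = m k) ->
  highest_vector E (tens_wt (tnth (in_tuple ks)) K) v.
Proof.
move=> cnt; case: hwE => up diag; split=> // a; rewrite diag /tens_wt; congr (_%:R *: _).
by rewrite (sum_tnth ks (fun k : 'I_n => (a <= k)%N)) (count_mem_sum _ cnt).
Qed.

(** The path relation, transferred to V and multiplied by the part of the
    monomial off the path. *)
Lemma nonpoint_low s : ~ point s -> filt ((wd s)%:Z - 1) (F s v).
Proof.
case/(nat_point_violation gK Kg) => i [j [p [t [dp tp big_t [t' sE]]]]].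
have [ks srt cnt] := weight_seq m.
pose kap := tnth (in_tuple ks); have hwE' := tensor_weight cnt.
have v0 : v != 0 by case: hwv.
have low_t : filt ((wd t)%:Z - 1) (F t v).
  apply: (mons_le_transfer glE hwE' v0); first exact: gl_unit_simple.
  apply: (path_relation (i := i) (j := j)) dp tp _ => //.
  by rewrite /active (sum_tnth ks (fun k : 'I_n => (i <= k <= j)%N)) (count_mem_sum _ cnt).
rewrite sE -[F _ v](subKr (F t' (F t v))); apply: lspanB.
  apply: mons_leS (ordmon_mons glE hwE beta_bij cf0 t' low_t).
  by rewrite wdegD; lia.
exact: (ordmonD glE hwE beta_bij cf0).
Qed.

(** A combination of lower degree has a tensor counterpart whose coordinate at
    the separating state of s is zero; the other monomials of the degree of s
    also vanish there. *)
Lemma point_indep s r (c : 'X_{1..N} -> K) : point s -> uniq r -> s \in r ->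
  (forall t, t \in r -> wd t = wd s) ->
  filt ((wd s)%:Z - 1) (\sum_(t <- r) c t *: F t v) -> c s = 0.
Proof.
move=> sp ur sr same low.
have [ks srt cnt] := weight_seq m.
have [al [nz zero]] := separating_state beta_bij cf0 srt cnt (c := fun a => s (g a))
  (s := s) (fun k => congr1 s (gK k)) sp.
set kap := tnth (in_tuple ks) in nz zero.
have hwE' := tensor_weight cnt; rewrite -/kap in hwE'.
have v0 : v != 0 by case: hwv.
have [y ry y0] : exists2 y, related kap E v (\sum_(t <- r) c t *: F t v) y & y al = 0.
  move: low; set u := \sum_(t <- r) _; elim=> [|d x x' [t wt ->] _ [y ry y0]].
    by exists 0; [exact: related0 | rewrite ffunE].
  exists (d *: ordmon beta cf (@tens_unit n _ kap K) t (tens_hw kap K) + y).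
    by apply: related_lin ry; apply: related_ordmon.
  rewrite ffunE tensZ y0 addr0 zero ?mulr0 //; last by move: wt; rewrite mul1n; lia.
  by move=> ts; move: wt; rewrite ts mul1n; lia.
have rs : related kap E v (\sum_(t <- r) c t *: F t v)
    (\sum_(t <- r) c t *: ordmon beta cf (@tens_unit n _ kap K) t (tens_hw kap K)).
  elim: (r) => [|t r' IH]; first by rewrite !big_nil; apply: related0.
  by rewrite !big_cons; apply: related_lin IH; apply: related_ordmon.
have := relatedB rs ry; rewrite subrr => /(related_0l glE hwE' v0)/eqP.
rewrite subr_eq0 => /eqP/(congr1 (fun y : tens n _ K => y al)).
rewrite y0 sum_ffunE (bigD1_seq s) //= tensZ big1_seq ?addr0.
  by move/eqP; rewrite mulf_eq0 (negPf nz) orbF => /eqP.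
move=> t /andP[ts tr]; rewrite tensZ zero ?mulr0 //; first exact/eqP.
by rewrite (same _ tr).
Qed.

Local Notation Fl := (pbw_filt rho f beta v).
Local Notation gen := (gr_gen rho f beta v).

Lemma fmonB s : {morph fmon rho f beta s : x y / x - y}.
Proof.
move=> x y; rewrite !fmonE; have := F_linear s (-1) y x.
by rewrite !scaleN1r ![- _ + _]addrC.
Qed.

Lemma fmon_filt s j u : u \in Fl j -> fmon rho f beta s u \in Fl (j + wd s)%N.
Proof.
move=> /pbw_filtE uj; apply/pbw_filtE; rewrite fmonE PoszD.
exact: (ordmon_mons glE hwE beta_bij cf0).
Qed.

Lemma F_in_filt s k : (wd s <= k)%N -> F s v \in Fl k.
Proof. by move=> sk; apply/pbw_filtE; apply: lspan_mem; exists s; rewrite ?mul1n. Qed.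

Lemma gr_cl_linear k : linear (gr_cl Fl k).
Proof.
move=> c x y; apply: val_inj; apply: boolp.functional_extensionality_dep => j.
change (gr_comp (gr_cl Fl k (c *: x + y)) j =
  c *: gr_comp (gr_cl Fl k x) j + gr_comp (gr_cl Fl k y) j).
rewrite !gr_cl_comp; case: (j == k); last by rewrite scaler0 addr0.
by rewrite !linearP.
Qed.

Lemma gr_cl_eq0 k u : u \in Fl k -> (gr_cl Fl k u = 0 <-> filt (k%:Z - 1) u).
Proof.
move=> uk; split=> [u0|/filt_predE low].
  by apply/filt_predE; rewrite -[u]subr0 -gr_cl_eq ?mem0v // gr_cl0 u0.
by apply/eqP; rewrite -(gr_cl0 Fl k) gr_cl_eq ?mem0v // subr0.
Qed.

Lemma gr_actX s (w : gr Fl) : gr_act 'X_[s] w = gr_map (wd s) (fmon rho f beta s) w.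
Proof. by rewrite /gr_act msuppX big_seq1 mcoeffX eqxx scale1r. Qed.

Lemma gr_act_gen s : gr_act 'X_[s] gen = gr_cl Fl (wd s) (F s v).
Proof.
rewrite gr_actX /gr_gen gr_mapE ?add0n ?fmonE //; first exact: fmonB.
  by move=> j u; apply: fmon_filt.
have := @F_in_filt 0%MM 0; rewrite -fmonE /fmon.
have -> : foldr (fun k u' => iter ((0 : 'X_{1..N})%MM k) (rho (f (beta k))) u') v (enum 'I_N) = v.
  by elim: (enum _) => //= k l ->; rewrite mnm0E.
apply; rewrite /wdeg big1 // => k _; by rewrite mnm0E.
Qed.

(** A homogeneous element is the class of its representative, and components
    beyond the support bound are zero. *)
Lemma gr_decomp (w : gr Fl) :
  w = \sum_(k < supp_bound w) gr_cl Fl k (gr_rep w k).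
Proof.
apply: val_inj; apply: boolp.functional_extensionality_dep => j.
have sum_comp (r : seq 'I_(supp_bound w)) (G : 'I_(supp_bound w) -> gr Fl) :
    gr_comp (\sum_(k <- r) G k) j = \sum_(k <- r) gr_comp (G k) j.
  elim: r => [|k r IH]; first by rewrite !big_nil.
  by rewrite !big_cons -IH.
rewrite [RHS]sum_comp; case: (ltnP j (supp_bound w)) => [lt|ge].
  rewrite (bigD1 (Ordinal lt)) // gr_cl_comp eqxx big1 ?addr0 => [|k kj].
    by rewrite /gr_rep vsvalK reprvK [RHS]addr0.
  by rewrite gr_cl_comp; case: eqP => // e; case/eqP: kj; apply: val_inj.
rewrite big1 => [|k _]; last first.
  by rewrite gr_cl_comp; case: eqP => // e; move: (ltn_ord k); rewrite -e ltnNge ge.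
exact: (projT2 (boolp.cid (boolp.asboolW (valP w)))).
Qed.

(** A monomial that vanishes on the generator vanishes on the whole module,
    since the classes of the monomials commute. *)
Lemma gr_map_nonpoint s (w : gr Fl) : ~ point s -> gr_map (wd s) (fmon rho f beta s) w = 0.
Proof.
move=> ns; rewrite /gr_map big1 // => k _.
have rk := gr_repP w k; apply/gr_cl_eq0; first exact: fmon_filt.
move/pbw_filtE: rk; rewrite fmonE.
have -> : (k + wd s)%N%:Z - 1 = (k%:Z + (wd s)%:Z) - 1 by rewrite PoszD.
apply: (lspan_map (F_linear s)) => _ [t wt ->].
rewrite -[F s _](subrK (F (s + t)%MM v)); apply: lspanD.
  by apply: mons_leS (ordmonD glE hwE beta_bij cf0 s t); rewrite wdegD; move: wt; lia.
have nst : ~ point (s + t)%MM by rewrite addmC => /nat_pointD.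
by apply: mons_leS (nonpoint_low nst); rewrite wdegD; move: wt; lia.
Qed.

(** The component of the degree of s only involves monomials of that degree. *)
Lemma gr_lin_indep : lin_indep point (fun s => gr_act 'X_[s] gen).
Proof.
move=> r c ur rP sum0 s sr; have sp := rP s sr.
pose r' := [seq t <- r | wd t == wd s].
apply: (point_indep (r := r')) sp _ _ _ _.
- exact: filter_uniq.
- by rewrite mem_filter eqxx.
- by move=> t; rewrite mem_filter => /andP[/eqP].
have uF : \sum_(t <- r') c t *: F t v \in Fl (wd s).
  rewrite big_seq; apply: memv_suml => t; rewrite mem_filter => /andP[/eqP wt _].
  by apply: memvZ; apply: F_in_filt; rewrite wt.
apply/gr_cl_eq0 => //; apply: val_inj; apply: boolp.functional_extensionality_dep => j.
change (gr_comp (gr_cl Fl (wd s) (\sum_(t <- r') c t *: F t v)) j = 0).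
rewrite gr_cl_comp; case: eqP => // ->.
have sum_comp (l : seq 'X_{1..N}) (G : 'X_{1..N} -> gr Fl) :
    gr_comp (\sum_(t <- l) G t) (wd s) = \sum_(t <- l) gr_comp (G t) (wd s).
  by elim: l => [|t l IH]; [rewrite !big_nil | rewrite !big_cons -IH].
have := congr1 (fun x : gr Fl => gr_comp x (wd s)) sum0; rewrite sum_comp.
rewrite !linear_sum big_filter [X in _ -> X = _]big_mkcond /= => sum0'.
apply: etrans sum0'; apply: eq_bigr => t _; rewrite gr_act_gen.
transitivity (c t *: gr_comp (gr_cl Fl (wd t) (F t v)) (wd s)); last by [].
rewrite gr_cl_comp eq_sym; case: (wd s =P wd t) => [e|_]; last by rewrite scaler0.
by rewrite !linearZ.
Qed.

Lemma gr_spanning : spanning point (fun s => gr_act 'X_[s] gen).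
Proof.
move=> w; apply: spanningP; rewrite [w]gr_decomp; apply: lspan_sum => k _.
have /pbw_filtE := gr_repP w k.
elim=> [|c x y [s ws ->] _ IH]; first by rewrite gr_cl0; left.
rewrite gr_cl_linear; apply: lspanD IH; apply: lspanZ.
rewrite mul1n lez_nat leq_eqVlt in ws; case/predU1P: ws => [ws|ws].
  have [sp|ns] := boolp.pselect (point s).
    by apply: lspan_mem; exists s; rewrite ?gr_act_gen ?ws.
  rewrite (_ : gr_cl _ _ _ = 0); first by left.
  by apply/gr_cl_eq0; [apply: F_in_filt; rewrite ws | rewrite -ws; apply: nonpoint_low].
rewrite (_ : gr_cl _ _ _ = 0); first by left.
apply/gr_cl_eq0; first exact/F_in_filt/ltnW.
by apply: lspan_mem; exists s => //; rewrite mul1n; lia.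
Qed.

(** A polynomial applied to the generator keeps exactly its terms at lattice
    points, and these are independent. *)
Lemma gr_annihilatorE p : gr_annihilator rho f beta v p <->
  forall s, s \in msupp p -> ~ point s.
Proof.
split=> [ann s sp ps|np w]; last first.
  by rewrite /gr_act big_seq big1 // => s /np ns; rewrite gr_map_nonpoint // scaler0.
pose r := [seq t <- msupp p | boolp.asbool (point t)].
have sr : s \in r by rewrite mem_filter sp andbT; apply/boolp.asboolP.
suff ps0 : p@_s = 0 by move: sp; rewrite mcoeff_msupp ps0 eqxx.
apply: (@gr_lin_indep r (fun t => p@_t)) sr => [|t|].
- exact/filter_uniq/msupp_uniq.
- by rewrite mem_filter => /andP[/boolp.asboolP].
have sum0 := ann gen; rewrite /gr_act in sum0; rewrite -[RHS]sum0 /r big_filter [LHS]big_mkcond /=.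
apply: eq_bigr => t _; rewrite gr_actX.
by case: boolp.asboolP => // nt; rewrite gr_map_nonpoint // scaler0.
Qed.

Lemma gr_annihilator_monomial : monomial_ideal (gr_annihilator rho f beta v).
Proof.
exists (fun s => ~ point s) => p; rewrite gr_annihilatorE; split=> [np|[r [rM ->]] t].
  exists [seq ((p@_s)%:MP, 'X_[s]) | s <- msupp p]; split.
    by move=> _ /mapP[s sp ->] /=; exists s => //; apply: np.
  rewrite big_map {1}[p]mpolyE; apply: eq_bigr => s _ /=.
  by rewrite mul_mpolyC.
rewrite mcoeff_msupp raddf_sum /= => nz pt.
have /hasP[[q h] qhr /= nzt] : has (fun qh : {mpoly K[N]} * {mpoly K[N]} =>
  (qh.1 * qh.2)@_t != 0) r.
  apply: contraNT nz => /hasPn none; rewrite big_seq big1 // => qh qhr.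
  by apply/eqP; have := none _ qhr; rewrite negbK.
have [s ns /= hE] := rM _ qhr; move: nzt; rewrite hE => /mcoeffM_neq0[t1 [t2 [tE _]]].
rewrite mcoeffX; case: (s =P t2) => [e _|_]; last by rewrite eqxx.
by apply: ns; apply: (nat_pointD (s := t1)); rewrite e -tE.
Qed.

End GradedModule.

Theorem theoremA (R : realType) (n : nat) (m : 'I_n -> nat)
    (V : vectType R[i]) (rho : 'M[R[i]]_n.+1 -> 'End(V)) (v : V)
    (f : posroot n -> 'M[R[i]]_n.+1)
    (beta : 'I_(nroots n) -> posroot n) :
  simple_module rho ->
  highest_weight_vector rho m v ->
  (forall a, neg_root_vector a (f a)) ->
  bijective beta ->
  is_basis (lattice_point beta R m)
    (fun s => gr_act 'X_[s] (gr_gen rho f beta v))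
  /\ monomial_ideal (gr_annihilator rho f beta v).
Proof.
move=> simple_rho hwv f_root [g gK Kg].
have pointE s := lattice_pointE m gK Kg R s.
have monomial := gr_annihilator_monomial simple_rho hwv f_root gK Kg.
split=> //.
split=> [r c ur rS sum0|w].
  apply: (gr_lin_indep simple_rho hwv f_root gK Kg) ur _ sum0 => s /rS.
  by move/pointE.
have [r [c [rS wE]]] := gr_spanning simple_rho hwv f_root gK Kg w.
by exists r, c; split=> // s /rS /pointE.
Qed.
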